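(* Suppose that $p=2$ and does not ramify in $R$. Consider the quadratic polynomial $Q=\bigoplus_{i\in\mathbb{N}} 2^i Q_i \oplus L$, where each $Q_i$ is a unimodular quadratic form of rank $r_i$ over $R$, where there is a positive integer $\omega$ such that $Q_i=0$ for $i>\omega$, and where $L$ is a linear form involving at most one indeterminate. For each $j\in\mathbb{N}$ let \[ Q_{(j)}=\bigoplus_{\substack{0\le i\le j\\ i\equiv j \pmod 2}} Q_i,\qquad r_{(j)}=\operatorname{rank}(Q_{(j)})=\sum_{\substack{0\le i\le j\\ i\equiv j\pmod 2}} r_i,\qquad q_{(j)}=q^{\sum_{0\le i<j} r_{(i)}}. \] Then the Igusa local zeta function $Z_Q(t)$ of $Q$ is given as follows, in terms of the quantities $I(P_0,P_1,P_2)$ described in the context (and with $\langle 1\rangle$ denoting the rank-one form $x^2$): \begin{itemize} \item If $L=0$, let $r=\sum_{i\in\mathbb{N}} r_i$; then \begin{multline*} Z_Q(t)=\sum_{0\le i<\omega-1}\frac{t^i}{q_{(i)}} I(Q_{(i)},Q_{(i+1)},Q_{i+2})\\ +\left(\frac{t^{\omega-1}}{q_{(\omega-1)}} I(Q_{(\omega-1)},Q_{(\omega)},0)+\frac{t^{\omega}}{q_{(\omega)}} I(Q_{(\omega)},Q_{(\omega-1)},0)\right)\left(1-\frac{t^2}{q^r}\right)^{-1}. \end{multline*} \item If $L=ax$ with $2\le v_2(a)<\infty$, write $\lambda=v_2(a)$; then \begin{multline*} Z_Q(t)=\sum_{0\le i<\lambda-2}\frac{t^i}{q_{(i)}} I(Q_{(i)},Q_{(i+1)},Q_{i+2})+\frac{t^{\lambda-2}}{q_{(\lambda-2)}}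 I(Q_{(\lambda-2)},Q_{(\lambda-1)},\langle 1\rangle)\\ +\frac{t^{\lambda-1}}{q_{(\lambda-1)}} I(Q_{(\lambda-1)},\langle 1\rangle,\langle 1\rangle)+\frac{t^\lambda}{q_{(\lambda)}}\left(\frac{1-1/q}{1-t/q}\right). \end{multline*} \item If $L=ax$ with $v_2(a)=1$, then \[ Z_Q(t)=I(Q_{(0)},\langle 1\rangle,\langle 1\rangle)+\frac{t}{q^{r_0}}\left(\frac{1-1/q}{1-t/q}\right). \] \item If $L=ax$ with $v_2(a)=0$, then $Z_Q(t)=\frac{1-1/q}{1-t/q}$. \end{itemize}
   Context: Setting: $K$ is a $2$-adic field in which $2$ is unramified, with valuation ring $R$, uniformizer $\pi=2$, valuation $v_2$, and residue field $\mathbb{F}_q$ of order $q$; $R^*$ is the unit group. For a polynomial $f$ over $R$ in $n$ variables, the Igusa local zeta function is $Z_f(s)=\int_{R^n}|f(x)|_K^s\,dx$ (Haar measure), written as a rational function of $t=q^{-s}$. $\mathrm{Tr}\colon K\to\mathbb{Q}_2$ is the absolute trace, and for $a\in\mathbb{Z}_2$ we set $(-1)^a=(-1)^{(a \bmod 2)}$. A quadratic form is unimodular if its symmetric matrix over $R$ has unit determinant; the norm of a form is the ideal of $R$ generated by its values. Notation for forms: $\langle a\rangle$ denotes the rank-one form $ax^2$ ($a\in R^*$); $\mathbb{H}$ is the hyperbolic plane $2xy$; $\mathbb{E}$ is the elliptic plane $2y^2f(x/y)$ with $f$ a quadratic polynomial over $R$ whose reduction mod $2$ is irreducible over $\mathbb{F}_q$.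 $\mathrm{P}(+)$ denotes a direct sum of copies of $\mathbb{H}$ and $\mathrm{P}(-)$ denotes $\mathbb{E}$ direct sum copies of $\mathbb{H}$, with the number of planes chosen so that the whole form has the specified rank; for a form $Q_i$ the sign is written $\pm_i$ (and $\mp_i$ is the opposite sign). E.g. if $\operatorname{rank}(Q_i)=r_i$ and $Q_i=\langle a\rangle\oplus\mathrm{P}(\pm_i)$, then $Q_i=\langle a\rangle\oplus\mathbb{H}^{(r_i-1)/2}$ (if $\pm_i=+$) or $Q_i=\langle a\rangle\oplus\mathbb{E}\oplus\mathbb{H}^{(r_i-3)/2}$ (if $\pm_i=-$). Every unimodular form is equivalent to one of $\mathrm{P}(\pm)$ (norm $2R$, or $0$ if rank $0$), $\langle a\rangle\oplus\mathrm{P}(\pm)$, or $\langle a\rangle\oplus\langle b\rangle\oplus\mathrm{P}(\pm)$ (norm $R$) with $a\equiv b\equiv1\pmod 2$. The quantity $I(Q_0,Q_1,Q_2)$ for unimodular forms $Q_0,Q_1,Q_2$ of ranks $r_0,r_1,r_2$ (with $a\equiv b\equiv c\equiv d\equiv 1 \pmod 2$, and writing $\iota=\frac{1-1/q}{1-t/q}$) is given by: (A) $Q_0=\mathrm{P}(\pm_0)$: if $\operatorname{norm}(Q_1)\ne R$, $I=(1\mp_0 q^{-r_0/2})(t\pm_0 t^2/q^{r_0/2})\,\iota$; if $\operatorname{norm}(Q_1)=R$, $I=(1-q^{-r_0})\,t\,\iota$. (B) $Q_0=\langle a\rangle\oplus\mathrm{P}(\pm_0)$: if $\operatorname{norm}(Q_1)\ne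 R$, $I=\big(1-\frac{t^2}{q^{r_0}}\pm_0\frac{t^2-t}{q^{(r_0+1)/2}}\big)\iota$; if $\operatorname{norm}(Q_1)=R$, $I=(1-\frac{t}{q^{r_0}})\iota$. (C) $Q_0=\langle a\rangle\oplus\langle b\rangle\oplus\mathrm{P}(\pm_0)$ with $4\mid a+b$, $\sigma=(-1)^{\mathrm{Tr}((a+b)/(4a))}$: - $Q_1=\mathrm{P}(\pm_1)$, $\operatorname{norm}(Q_2)\ne R$: $I=\big(1-\frac{t^2}{q^{r_0}}\pm_0\frac{t^2-t}{q^{r_0/2}}\pm_1\frac{\sigma(t^3-t^2)}{q^{r_0+r_1/2}}\big)\iota$; - $\operatorname{norm}(Q_1)\ne R$, $\operatorname{norm}(Q_2)=R$: $I=\big(1-\frac{t^2}{q^{r_0}}\pm_0\frac{t^2-t}{q^{r_0/2}}\big)\iota$; - $Q_1=\langle c\rangle\oplus\mathrm{P}(\pm_1)$, $\operatorname{norm}(Q_2)\ne R$: $I=\big(1-\frac{t}{q^{r_0}}\pm_1\frac{\sigma(t^3-t^2)}{q^{r_0+(r_1+1)/2}}\big)\iota$; - $Q_1=\langle c\rangle\oplus\langle d\rangle\oplus\mathrm{P}(\pm_1)$, $4\mid a+b+c+d$, $\operatorname{norm}(Q_2)\ne R$: $I=\big(1-\frac{t}{q^{r_0}}\pm_1\frac{\sigma(t^3-t^2)}{q^{r_0+r_1/2}}\big)\iota$; - $Q_1=\langle c\rangle\oplus\langle d\rangle\oplus\mathrm{P}(\pm_1)$, $4\nmid a+b+c+d$,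 $\operatorname{norm}(Q_2)\ne R$: $I=(1-\frac{t}{q^{r_0}})\iota$; - $\operatorname{norm}(Q_1)=\operatorname{norm}(Q_2)=R$: $I=(1-\frac{t}{q^{r_0}})\iota$. (D) $Q_0=\langle a\rangle\oplus\langle b\rangle\oplus\mathrm{P}(\pm_0)$ with $4\nmid a+b$: - $\operatorname{norm}(Q_1)\ne R$: $I=(1-\frac{t^2}{q^{r_0}})\iota$; - $Q_1=\langle c\rangle\oplus\mathrm{P}(\pm_1)$, $\operatorname{norm}(Q_2)\ne R$, $\phi=(-1)^{\mathrm{Tr}\left(\frac{c}{2}\left[\left(\frac{a+b}{2c}\right)^q+\frac{a+b}{2c}\right]\right)}$: $I=\big(1-\frac{t}{q^{r_0}}\pm_1\frac{\phi(t^3-t^2)}{q^{r_0+(r_1+1)/2}}\big)\iota$; - $Q_1=\langle c\rangle\oplus\langle d\rangle\oplus\mathrm{P}(\pm_1)$, $4\mid a+b+c+d$, $\operatorname{norm}(Q_2)\ne R$, $\psi=(-1)^{\mathrm{Tr}\left(\frac{c}{2}\left[\left(\frac{c+d}{2}\right)^q+\frac{a+b}{2c}\right]\right)}$: $I=\big(1-\frac{t}{q^{r_0}}\pm_1\frac{\psi(t^3-t^2)}{q^{r_0+r_1/2}}\big)\iota$; - $Q_1=\langle c\rangle\oplus\langle d\rangle\oplus\mathrm{P}(\pm_1)$, $4\nmid a+b+c+d$, $\operatorname{norm}(Q_2)\ne R$: $I=(1-\frac{t}{q^{r_0}})\iota$; - $\operatorname{norm}(Q_1)=\operatorname{norm}(Q_2)=R$: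 $I=(1-\frac{t}{q^{r_0}})\iota$. *)

(* Defs.v *)
From HB Require Import structures.
From mathcomp Require Import all_boot all_order all_algebra all_field.
From mathcomp Require Import complex.
From mathcomp Require Import all_classical all_reals all_analysis.

Set Implicit Arguments.
Unset Strict Implicit.
Unset Printing Implicit Defensive.

Import Order.TTheory GRing.Theory Num.Theory.
Import numFieldNormedType.Exports.

Local Open Scope classical_set_scope.
Local Open Scope ring_scope.

(* [val_ge v m x] means v(x) >= m with the convention v(0) = +oo; the integer
   [v 0] itself is irrelevant everywhere. *)
Definition val_ge (K : fieldType) (v : K -> int) (m : int) : {pred K} :=
  fun x => (x == 0) || (m <= v x).

(* K is complete for the discrete valuation v, 2 is a uniformizer, and red
   identifies the residue field with k.  Only the values of red on the valuation
   ring matter.  Characteristic 0 is a consequence: 2 <> 0 and v(2) > 0. *)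
Record dyadic_valuation (K : fieldType) (k : finFieldType)
    (v : K -> int) (red : K -> k) : Prop := DyadicValuation {
  dv_two_neq0 : (2 : K) != 0;
  dv_two : v 2 = 1;
  dv_M : forall x y, x != 0 -> y != 0 -> v (x * y) = v x + v y;
  dv_D : forall m x y, x \in val_ge v m -> y \in val_ge v m ->
    x + y \in val_ge v m;
  dv_complete : forall u : nat -> K,
    (forall m : int, exists N : nat, forall i j : nat,
       (N <= i)%N -> (N <= j)%N -> u i - u j \in val_ge v m) ->
    exists l : K, forall m : int, exists N : nat, forall i : nat,
      (N <= i)%N -> u i - l \in val_ge v m;
  dv_red1 : red 1 = 1;
  dv_redD : {in val_ge v 0 &, forall x y, red (x + y) = red x + red y};
  dv_redM : {in val_ge v 0 &, forall x y, red (x * y) = red x * red y};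
  dv_red_eq0 : {in val_ge v 0, forall x, (red x == 0) = (x \in val_ge v 1)};
  dv_red_surj : forall c : k, exists2 x, x \in val_ge v 0 & red x = c
}.

(* The base Q2 is pinned down as the field of 2-adic numbers by being complete
   with uniformizer 2 and residue field F_2; K is a finite extension of it, and
   compatibility of the normalized valuations says that K / Q2 is unramified. *)
Structure dyadicField := DyadicField {
  Q2 : fieldType;
  val2 : Q2 -> int;
  red2 : Q2 -> 'F_2;
  Q2P : dyadic_valuation val2 red2;
  dfield :> fieldExtType Q2;
  resF : finFieldType;
  vK : dfield -> int;
  redK : dfield -> resF;
  dfieldP : dyadic_valuation vK redK;
  vK_ext : forall x : Q2, x != 0 -> vK (x%:A) = val2 x
}.

Arguments vK {d} _.
Arguments redK {d} _.

Section DyadicField.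
Variable K : dyadicField.

Definition resq : nat := #|resF K|.

Definition valring : {pred K} := val_ge vK 0.

Definition valunit (x : K) : bool := (x != 0) && (vK x == 0).

Definition dvdR (d x : K) : bool := x / d \in valring.

Definition fieldTr (x : K) : Q2 K :=
  \tr (passmx.mxof (vbasis {:K}) (vbasis {:K}) (amull x)).

(* (-1)^a = (-1)^(a mod 2) for a in Z_2. *)
Definition signZ2 (C : pzRingType) (a : Q2 K) : C :=
  if a \in val_ge (@val2 K) 1 then 1 else -1.

Record qform := QForm { rk : nat; qmx : 'M[K]_rk }.

Definition qeval (Q : qform) (x : 'rV[K]_(rk Q)) : K :=
  (x *m qmx Q *m x^T) 0 0.

Definition unimodular (Q : qform) : Prop :=
  [/\ (qmx Q)^T = qmx Q, qmx Q \is a mxOver valring & valunit (\det (qmx Q))].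

Definition qf0 : qform := @QForm 0 0.

Definition qfadd (P Q : qform) : qform :=
  @QForm (rk P + rk Q) (block_mx (qmx P) 0 0 (qmx Q)).

Definition qfscale (c : K) (Q : qform) : qform := @QForm (rk Q) (c *: qmx Q).

Definition qf1 (a : K) : qform := @QForm 1 a%:M.

(* 2xy *)
Definition qfH : qform := @QForm 2 (\matrix_(i, j) (i != j)%:R).

(* 2y^2 f(x/y) = 2 f_2 x^2 + 2 f_1 xy + 2 f_0 y^2 *)
Definition qfE (f : {poly K}) : qform :=
  @QForm 2 (\matrix_(i, j)
    if i != j then f`_1 else if i == 0 then 2 * f`_2 else 2 * f`_0).

(* The reduction is required to be quadratic as well: a linear reduction would
   also be irreducible, but gives a hyperbolic plane. *)
Definition elliptic_poly (f : {poly K}) : Prop :=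
  [/\ f \is a polyOver valring, size f = 3%N, size (map_poly redK f) = 3%N
    & irreducible_poly (map_poly redK f)].

Definition qfHs (m : nat) : qform := iter m (qfadd qfH) qf0.

(* Equivalence over the valuation ring: U is invertible with inverse V, so the
   ranks agree; the rectangular format avoids casts. *)
Definition qequiv (P Q : qform) : Prop :=
  exists (U : 'M[K]_(rk P, rk Q)) (V : 'M[K]_(rk Q, rk P)),
    [/\ U \is a mxOver valring, V \is a mxOver valring,
        U *m V = 1%:M, V *m U = 1%:M & U *m qmx Q *m U^T = qmx P].

(* Signs are booleans, true standing for +. *)
Inductive planes : bool -> qform -> Prop :=
| PlanesP m : planes true (qfHs m)
| PlanesN f m : elliptic_poly f -> planes false (qfadd (qfE f) (qfHs m)).

Definition one_mod2 (a : K) : Prop := dvdR 2 (a - 1).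

Definition type0 (e : bool) (Q : qform) : Prop :=
  exists2 P, planes e P & qequiv Q P.

Definition type1 (a : K) (e : bool) (Q : qform) : Prop :=
  one_mod2 a /\ exists2 P, planes e P & qequiv Q (qfadd (qf1 a) P).

Definition type2 (a b : K) (e : bool) (Q : qform) : Prop :=
  [/\ one_mod2 a, one_mod2 b
    & exists2 P, planes e P & qequiv Q (qfadd (qf1 a) (qfadd (qf1 b) P))].

Definition qnorm (Q : qform) : set K :=
  [set y | exists s : seq (K * 'rV[K]_(rk Q)),
     (forall p, p \in s -> p.1 \in valring /\ p.2 \is a mxOver valring) /\
     y = \sum_(p <- s) p.1 * qeval p.2].

Definition normR (Q : qform) : Prop := qnorm Q = [set x | x \in valring].

Section Iquantity.
Variables (C : fieldType) (t : C).

Local Notation q := (resq%:R : C).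
Local Notation sg e := ((-1) ^+ (~~ e) : C).

Definition iota_q : C := (1 - q^-1) / (1 - t / q).

Definition sigma_sign (a b : K) : C := signZ2 C (fieldTr ((a + b) / (4 * a))).

Definition phi_sign (a b c : K) : C :=
  signZ2 C (fieldTr
    (c / 2 * (((a + b) / (2 * c)) ^+ resq + (a + b) / (2 * c)))).

Definition psi_sign (a b c d : K) : C :=
  signZ2 C (fieldTr
    (c / 2 * (((c + d) / 2) ^+ resq + (a + b) / (2 * c)))).

(* [Ival Q0 Q1 Q2 z]: some presentation of the forms by the normal forms above
   assigns the value z to I(Q0, Q1, Q2).  The halved exponents are exact, since
   the type of the form determines the parity of its rank. *)
Inductive Ival (Q0 Q1 Q2 : qform) : C -> Prop :=
| IvalA1 e0 : type0 e0 Q0 -> ~ normR Q1 ->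
    Ival Q0 Q1 Q2
      ((1 - sg e0 / q ^+ (rk Q0 %/ 2))
       * (t + sg e0 * (t ^+ 2 / q ^+ (rk Q0 %/ 2))) * iota_q)
| IvalA2 e0 : type0 e0 Q0 -> normR Q1 ->
    Ival Q0 Q1 Q2 ((1 - 1 / q ^+ rk Q0) * t * iota_q)
| IvalB1 a e0 : type1 a e0 Q0 -> ~ normR Q1 ->
    Ival Q0 Q1 Q2
      ((1 - t ^+ 2 / q ^+ rk Q0
        + sg e0 * ((t ^+ 2 - t) / q ^+ ((rk Q0).+1 %/ 2))) * iota_q)
| IvalB2 a e0 : type1 a e0 Q0 -> normR Q1 ->
    Ival Q0 Q1 Q2 ((1 - t / q ^+ rk Q0) * iota_q)
| IvalC1 a b e0 e1 : type2 a b e0 Q0 -> dvdR 4 (a + b) ->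
    type0 e1 Q1 -> ~ normR Q2 ->
    Ival Q0 Q1 Q2
      ((1 - t ^+ 2 / q ^+ rk Q0
        + sg e0 * ((t ^+ 2 - t) / q ^+ (rk Q0 %/ 2))
        + sg e1 * (sigma_sign a b * (t ^+ 3 - t ^+ 2)
                   / q ^+ (rk Q0 + rk Q1 %/ 2))) * iota_q)
| IvalC2 a b e0 : type2 a b e0 Q0 -> dvdR 4 (a + b) ->
    ~ normR Q1 -> normR Q2 ->
    Ival Q0 Q1 Q2
      ((1 - t ^+ 2 / q ^+ rk Q0
        + sg e0 * ((t ^+ 2 - t) / q ^+ (rk Q0 %/ 2))) * iota_q)
| IvalC3 a b e0 c e1 : type2 a b e0 Q0 -> dvdR 4 (a + b) ->
    type1 c e1 Q1 -> ~ normR Q2 ->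
    Ival Q0 Q1 Q2
      ((1 - t / q ^+ rk Q0
        + sg e1 * (sigma_sign a b * (t ^+ 3 - t ^+ 2)
                   / q ^+ (rk Q0 + (rk Q1).+1 %/ 2))) * iota_q)
| IvalC4 a b e0 c d e1 : type2 a b e0 Q0 -> dvdR 4 (a + b) ->
    type2 c d e1 Q1 -> dvdR 4 (a + b + c + d) -> ~ normR Q2 ->
    Ival Q0 Q1 Q2
      ((1 - t / q ^+ rk Q0
        + sg e1 * (sigma_sign a b * (t ^+ 3 - t ^+ 2)
                   / q ^+ (rk Q0 + rk Q1 %/ 2))) * iota_q)
| IvalC5 a b e0 c d e1 : type2 a b e0 Q0 -> dvdR 4 (a + b) ->
    type2 c d e1 Q1 -> ~~ dvdR 4 (a + b + c + d) -> ~ normR Q2 ->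
    Ival Q0 Q1 Q2 ((1 - t / q ^+ rk Q0) * iota_q)
| IvalC6 a b e0 : type2 a b e0 Q0 -> dvdR 4 (a + b) ->
    normR Q1 -> normR Q2 ->
    Ival Q0 Q1 Q2 ((1 - t / q ^+ rk Q0) * iota_q)
| IvalD1 a b e0 : type2 a b e0 Q0 -> ~~ dvdR 4 (a + b) ->
    ~ normR Q1 ->
    Ival Q0 Q1 Q2 ((1 - t ^+ 2 / q ^+ rk Q0) * iota_q)
| IvalD2 a b e0 c e1 : type2 a b e0 Q0 -> ~~ dvdR 4 (a + b) ->
    type1 c e1 Q1 -> ~ normR Q2 ->
    Ival Q0 Q1 Q2
      ((1 - t / q ^+ rk Q0
        + sg e1 * (phi_sign a b c * (t ^+ 3 - t ^+ 2)
                   / q ^+ (rk Q0 + (rk Q1).+1 %/ 2))) * iota_q)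
| IvalD3 a b e0 c d e1 : type2 a b e0 Q0 -> ~~ dvdR 4 (a + b) ->
    type2 c d e1 Q1 -> dvdR 4 (a + b + c + d) -> ~ normR Q2 ->
    Ival Q0 Q1 Q2
      ((1 - t / q ^+ rk Q0
        + sg e1 * (psi_sign a b c d * (t ^+ 3 - t ^+ 2)
                   / q ^+ (rk Q0 + rk Q1 %/ 2))) * iota_q)
| IvalD4 a b e0 c d e1 : type2 a b e0 Q0 -> ~~ dvdR 4 (a + b) ->
    type2 c d e1 Q1 -> ~~ dvdR 4 (a + b + c + d) -> ~ normR Q2 ->
    Ival Q0 Q1 Q2 ((1 - t / q ^+ rk Q0) * iota_q)
| IvalD5 a b e0 : type2 a b e0 Q0 -> ~~ dvdR 4 (a + b) ->
    normR Q1 -> normR Q2 ->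
    Ival Q0 Q1 Q2 ((1 - t / q ^+ rk Q0) * iota_q).

(* The value does not depend on the presentation, and every unimodular form has
   one, so that neither the choice nor the default 0 plays any role on
   unimodular forms. *)
Definition Iq (Q0 Q1 Q2 : qform) : C := xget 0 [set z | Ival Q0 Q1 Q2 z].

End Iquantity.

Section Space.
Variable n : nat.

Definition Kn : Type := 'rV[K]_n.
HB.instance Definition _ := Choice.on Kn.
HB.instance Definition _ := isPointed.Build Kn (0 : 'rV[K]_n).

Definition openKn : set (set Kn) :=
  [set U | forall x : 'rV[K]_n, U x -> exists m : nat,
     forall y : 'rV[K]_n, (forall i, dvdR (2 ^+ m) (y 0 i - x 0 i)) -> U y].

Definition borelKn := g_sigma_algebraType openKn.

Definition Rn : set Kn := [set x : 'rV[K]_n | x \is a mxOver valring].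

Definition haar (R : realType) (mu : {measure set borelKn -> \bar R}) : Prop :=
  mu Rn = 1%E /\
  forall (x : 'rV[K]_n) (A : set borelKn), measurable A ->
    mu [set x + (y : 'rV[K]_n) | y in A] = mu A.

End Space.

Section Zeta.
Variable R : realType.

Definition cexp (z : R[i]) : R[i] :=
  let: (a +i* b)%C := z in
  ((expR a * cos b) +i* (expR a * sin b))%C.

(* x^s for a real x >= 0, with 0^s = 0 (used for Re s > 0). *)
Definition cpow (x : R) (s : R[i]) : R[i] :=
  if x == 0 then 0 else cexp ((ln x)%:C%C * s).

Definition dyadic_abs (x : K) : R := if x == 0 then 0 else (resq%:R : R) ^ (- vK x).

Definition zeta n (mu : {measure set borelKn n -> \bar R})
    (f : 'rV[K]_n -> K) (s : R[i]) : R[i] :=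
  ((\int[mu]_(x in @Rn n) (complex.Re (cpow (dyadic_abs (f x)) s)))
   +i* (\int[mu]_(x in @Rn n) (complex.Im (cpow (dyadic_abs (f x)) s))))%C.

End Zeta.

Section Sums.
Variable Q : nat -> qform.

Definition qftotal (w : nat) : qform :=
  \big[qfadd/qf0]_(0 <= i < w.+1) qfscale (2 ^+ i) (Q i).

(* The direct sum of the quadratic part and the linear form with coefficients L
   in l further indeterminates. *)
Definition quad_poly (w l : nat) (L : 'rV[K]_l)
    (x : 'rV[K]_(rk (qftotal w) + l)) : K :=
  qeval (lsubmx x) + (rsubmx x *m L^T) 0 0.

Definition Qpar (j : nat) : qform :=
  \big[qfadd/qf0]_(0 <= i < j.+1 | odd i == odd j) Q i.

Definition qpar (j : nat) : nat := resq ^ (\sum_(0 <= i < j) rk (Qpar i)).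

End Sums.

End DyadicField.

(* Main.v *)
(* Let t^v be truncated at level J: on 2^J R it is replaced by its mean there, a constant.
   The truncated function factors through R / 2^J, so its Haar integral along the quadratic
   polynomial is a finite mean over residue classes, and it differs from |f|^s by O(|t|^J).

   For a form Q_0 + 2 Q_1 + 4 Q_2 + ... the mean over the vectors whose Q_0-component is
   primitive is I(Q_0, Q_1, Q_2): moving along the gradient averages the value over 8 R, so
   only residues modulo 8 matter, and the planes, the squares and the signs (through additive
   Hilbert 90 for the residue field) are evaluated by hand.  The remaining vectors have
   Q_0-component 2x; halving the value turns the form into Q_1 + 2 (Q_0 + Q_2) + 4 Q_3 + ...,
   with a factor t / q^(r_0).  A linear term a x makes the value equidistributed modulo 2^v(a),
   which stops this recursion; without one it becomes periodic of period 2 after omega steps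
   and sums to a geometric series of ratio t^2 / q^r. *)

From HB Require Import structures.
Require Import Defs.
From mathcomp Require Import all_boot all_order all_algebra all_field.
From mathcomp Require Import perm complex ring zify measurable_realfun.
From mathcomp Require Import all_classical all_reals all_analysis.

Set Implicit Arguments.
Unset Strict Implicit.
Unset Printing Implicit Defensive.

Import Order.TTheory GRing.Theory Num.Theory.
Import numFieldNormedType.Exports.
Local Open Scope ring_scope.

(** * Valuation ring and residue field *)

(** The modulus 8 comes from the factor 2 in the polar form. Translating a primitive vector x by
    2^(e+1) y changes Q by 2^(e+2) (B(x, y) + 2^e Q(y)), and the linear term dominates once 2^e Q
    has even diagonal: e = 0 suffices for even forms, odd ones need e = 1. Hence I involves three
    consecutive forms, and Q_2 only through its norm: modulo 8 the form 4 Q_2 is trivial or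
    equidistributed on 4 R, which keeps the truncation level 3 or lowers it to 2. With the mean as
    terminal value every recursion is exact at each finite level; the error enters once, in the
    comparison with the integral. A linear term of valuation lambda lowers the level to lambda, so
    only L = 0 needs a limit. [Iq] selects some value of the relation [Ival], so two facts are
    needed: every unimodular form has a normal form, and every admissible presentation gives the
    same mean. The signs require the trace of K over [Q2] modulo 2 to be the Frobenius sum of the
    residue field, which rests on a lifted integral basis. *)

Section DyadicValuation.
Variables (K : fieldType) (k : finFieldType) (v : K -> int) (red : K -> k).
Hypothesis H : dyadic_valuation v red.
Local Notation V := (val_ge v).

Lemma val_geE m x : (x \in V m) = (x == 0) || (m <= v x).
Proof. by []. Qed.

Lemma val_ge0 m : 0 \in V m.
Proof. by rewrite val_geE eqxx. Qed.

Lemma val1 : v 1 = 0.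
Proof.
have := dv_M H (oner_neq0 K) (oner_neq0 K); rewrite mulr1.
by move/eqP; rewrite -subr_eq subrr => /eqP <-.
Qed.

Lemma valN1 : v (- 1) = 0.
Proof.
have N0 : (- 1 : K) != 0 by rewrite oppr_eq0 oner_neq0.
have := dv_M H N0 N0; rewrite mulrNN mulr1 val1 -mulr2n => /esym/eqP.
by rewrite mulrn_eq0 /= => /eqP.
Qed.

Lemma valX x n : x != 0 -> v (x ^+ n) = v x *+ n.
Proof.
move=> x0; elim: n => [|n IH]; first by rewrite expr0 val1 mulr0n.
by rewrite exprS (dv_M H) ?expf_neq0 // IH mulrS.
Qed.

Lemma valV x : x != 0 -> v x^-1 = - v x.
Proof.
move=> x0; have := dv_M H x0 (invr_neq0 x0); rewrite divff // val1 => /esym/eqP.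
by rewrite addrC addr_eq0 => /eqP.
Qed.

Lemma val_geN m x : x \in V m -> - x \in V m.
Proof.
rewrite !val_geE oppr_eq0; case: (eqVneq x 0) => //= x0.
by rewrite -mulN1r (dv_M H) ?oppr_eq0 ?oner_neq0 // valN1 add0r.
Qed.

Lemma val_geB m x y : x \in V m -> y \in V m -> x - y \in V m.
Proof. by move=> xm ym; apply: (dv_D H) => //; apply: val_geN. Qed.

Lemma val_geM m n x y : x \in V m -> y \in V n -> x * y \in V (m + n).
Proof.
rewrite !val_geE mulf_eq0; case: (eqVneq x 0) => //= x0.
by case: (eqVneq y 0) => //= y0 xm ym; rewrite (dv_M H) // lerD.
Qed.

Lemma val_ge_le m n x : m <= n -> x \in V n -> x \in V m.
Proof. by rewrite !val_geE => mn; case: eqP => //= _; apply: le_trans. Qed.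

Lemma val2X n : v (2 ^+ n) = n%:Z.
Proof. by rewrite valX ?(dv_two_neq0 H) // (dv_two H) pmulrn intz. Qed.

Lemma val_ge_mul2 n m x : (2 ^+ n * x \in V (n%:Z + m)) = (x \in V m).
Proof.
have h2 : (2 : K) ^+ n != 0 by rewrite expf_neq0 // (dv_two_neq0 H).
rewrite !val_geE mulf_eq0 (negbTE h2) /=; case: (eqVneq x 0) => //= x0.
by rewrite (dv_M H) // val2X lerD2l.
Qed.

Lemma val_ge_eq0 x : (forall m : nat, x \in V m%:Z) -> x = 0.
Proof.
move=> h; apply/eqP; apply/negPn/negP => x0.
by have := h (`|v x|.+1)%N; rewrite val_geE (negbTE x0) /=; lia.
Qed.

Lemma red_eq x y : x \in V 0 -> y \in V 0 -> (red x == red y) = (x - y \in V 1).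
Proof.
move=> xR yR; rewrite -(dv_red_eq0 H) ?val_geB //.
have -> : red x = red (x - y) + red y by rewrite -(dv_redD H) ?subrK ?val_geB.
by rewrite -subr_eq0 addrK.
Qed.

Lemma char_residue : (2 : k) = 0.
Proof.
have oneR : (1 : K) \in V 0 by rewrite val_geE val1 lexx orbT.
have h : red 2 == 0.
  by rewrite (dv_red_eq0 H) val_geE (dv_two H) ?lexx ?orbT // ler01 orbT.
by move: h; rewrite -[2]/(1 + 1) (dv_redD H) // (dv_red1 H) => /eqP.
Qed.

End DyadicValuation.

Section ValuationRing.
Variable K : dyadicField.
Implicit Types x y u : K.
Local Notation R := (@valring K).
Local Notation HK := (dfieldP K).

Lemma valring_subring : subring_closed R.
Proof.
split=> [|x y|x y].
- by rewrite val_geE (val1 HK) lexx orbT.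
- exact: (val_geB HK).
- by move=> xR yR; apply: (val_geM HK xR yR).
Qed.
HB.instance Definition _ := GRing.isSubringClosed.Build K R valring_subring.

Definition idl (m : nat) : {pred K} := val_ge vK m%:Z.

Lemma idl_zmod m : zmod_closed (idl m).
Proof. by split=> [|x y]; [exact: val_ge0 | exact: (val_geB HK)]. Qed.
HB.instance Definition _ m := GRing.isZmodClosed.Build K (idl m) (idl_zmod m).

Lemma idl0 x : (x \in idl 0) = (x \in R). Proof. by []. Qed.

Lemma idlMl m x y : x \in R -> y \in idl m -> x * y \in idl m.
Proof. by move=> xR ym; have := val_geM HK xR ym; rewrite add0r. Qed.

Lemma idlMr m x y : x \in idl m -> y \in R -> x * y \in idl m.
Proof. by move=> xm yR; rewrite mulrC idlMl. Qed.

Lemma idlM m n x y : x \in idl m -> y \in idl n -> x * y \in idl (m + n).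
Proof. by move=> xm ym; rewrite /idl PoszD (val_geM HK). Qed.

Lemma idl_le m n x : (m <= n)%N -> x \in idl n -> x \in idl m.
Proof. by move=> mn; apply: val_ge_le; rewrite lez_nat. Qed.

Lemma idl_ring m x : x \in idl m -> x \in R.
Proof. exact: idl_le. Qed.

Lemma idl_mul2X n m x : (2 ^+ n * x \in idl (n + m)) = (x \in idl m).
Proof. by rewrite /idl PoszD (val_ge_mul2 HK). Qed.

Lemma idl_mul2 m x : (2 * x \in idl m.+1) = (x \in idl m).
Proof. by rewrite -{1}[2]expr1 -add1n idl_mul2X. Qed.

Lemma idl2X n x : x \in R -> 2 ^+ n * x \in idl n.
Proof. by move=> xR; rewrite -[n in idl n]addn0 idl_mul2X. Qed.

Lemma idl_two x : x \in R -> 2 * x \in idl 1.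
Proof. by move=> xR; rewrite idl_mul2. Qed.

Lemma two_neq0 : (2 : K) != 0. Proof. exact: dv_two_neq0 HK. Qed.

Lemma idlP n x : reflect (exists2 y, y \in R & x = 2 ^+ n * y) (x \in idl n).
Proof.
have h2 : (2 : K) ^+ n != 0 by rewrite expf_neq0 // two_neq0.
apply: (iffP idP) => [xn|[y yR ->]]; last exact: idl2X.
exists (x / 2 ^+ n); last by rewrite mulrC divfK.
by rewrite -idl0 -(idl_mul2X n) addn0 mulrC divfK.
Qed.

Lemma ring_nat n : n%:R \in R. Proof. exact: rpred_nat. Qed.
Lemma ring_two : 2 \in R. Proof. exact: rpred_nat. Qed.

Lemma redD : {in R &, {morph redK : x y / x + y}}. Proof. exact: dv_redD HK. Qed.
Lemma redM : {in R &, {morph redK : x y / x * y}}. Proof. exact: dv_redM HK. Qed.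
Lemma red1 : redK (1 : K) = 1. Proof. exact: dv_red1 HK. Qed.
Lemma redP x y : x \in R -> y \in R -> reflect (redK x = redK y) (x - y \in idl 1).
Proof. by move=> xR yR; apply: (iffP idP); rewrite -(red_eq HK) // => /eqP. Qed.
Lemma red0P x : x \in R -> reflect (redK x = 0) (x \in idl 1).
Proof. by move=> xR; apply: (iffP idP); rewrite -(dv_red_eq0 HK) // => /eqP. Qed.
Lemma red0 : redK (0 : K) = 0. Proof. by apply/red0P; rewrite ?rpred0. Qed.

Lemma resF_char2 (x : resF K) : x + x = 0.
Proof. by rewrite -mulr2n -mulr_natl (char_residue HK) mul0r. Qed.

Lemma resF_opp (x : resF K) : - x = x.
Proof. by apply/eqP; rewrite eq_sym -subr_eq0 opprK resF_char2. Qed.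

Lemma redX x n : x \in R -> redK (x ^+ n) = redK x ^+ n.
Proof.
move=> xR; elim: n => [|n IH]; first by rewrite red1.
by rewrite !exprS redM ?rpredX // IH.
Qed.
Lemma valunitE x : valunit x = (x \in R) && (x \notin idl 1).
Proof.
rewrite /valunit !val_geE; case: (eqVneq x 0) => //= x0.
by rewrite -ltNge eq_le andbC; congr (_ && _); lia.
Qed.

Lemma unit_ring x : valunit x -> x \in R. Proof. by rewrite valunitE => /andP[]. Qed.
Lemma unit_neq0 x : valunit x -> x != 0. Proof. by case/andP. Qed.
Lemma unitV x : valunit x -> valunit x^-1.
Proof.
move=> /andP[x0 /eqP vx]; rewrite /valunit invr_neq0 // (valV HK) // vx.
by rewrite oppr0 eqxx.
Qed.
Lemma unitVring x : valunit x -> x^-1 \in R.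
Proof. by move/unitV/unit_ring. Qed.
Lemma unitM x y : valunit x -> valunit y -> valunit (x * y).
Proof.
move=> /andP[x0 /eqP vx] /andP[y0 /eqP vy]; rewrite /valunit mulf_neq0 //.
by rewrite (dv_M HK) // vx vy addr0 eqxx.
Qed.
Lemma unitN x : valunit x -> valunit (- x).
Proof. by rewrite !valunitE !rpredN. Qed.
Lemma unit1 : valunit (1 : K).
Proof. by rewrite /valunit oner_neq0 (val1 HK) eqxx. Qed.
Lemma unit_cong x y : valunit x -> y - x \in idl 1 -> valunit y.
Proof.
rewrite !valunitE => /andP[xR xn] yx; have yE : y = (y - x) + x by rewrite subrK.
rewrite yE rpredD ?(idl_ring yx) //=.
by apply: contra xn => h; rewrite -(addKr (y - x) x) rpredD ?rpredN.
Qed.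
Lemma unit_idlM m u x : valunit u -> (u * x \in idl m) = (x \in idl m).
Proof.
move=> uu; apply/idP/idP => [h|]; last by apply/idlMl/unit_ring.
by rewrite -(mulKf (unit_neq0 uu) x) idlMl // unitVring.
Qed.
Lemma idl_prime x y : x \in R -> y \in R -> (x * y \in idl 1) = (x \in idl 1) || (y \in idl 1).
Proof.
move=> xR yR; case: (boolP (x \in idl 1)) => [h|h] /=; first by rewrite idlMr.
by rewrite unit_idlM // valunitE xR.
Qed.
Lemma red_neq0 x : valunit x -> redK x != 0.
Proof. by rewrite valunitE => /andP[xR]; apply: contraNneq => /red0P; apply. Qed.
(** The lift of 0 is forced to be 0, so that an expansion with leading digit 0 is exactly twice the
    expansion of its other digits. *)
Definition rlift (c : resF K) : K :=
  if c == 0 then 0 else s2val (cid2 (dv_red_surj HK c)).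

Lemma rlift0 : rlift 0 = 0. Proof. by rewrite /rlift eqxx. Qed.
Lemma rlift_ring c : rlift c \in R.
Proof. by rewrite /rlift; case: eqP => _; [exact: rpred0 | case: cid2]. Qed.
Lemma rliftK c : redK (rlift c) = c.
Proof. by rewrite /rlift; case: eqP => [->|_]; [exact: red0 | case: cid2]. Qed.

(** Squaring is injective in characteristic 2, hence onto on a finite field. *)
Lemma resF_sqrt (c : resF K) : exists d, d ^+ 2 = c.
Proof.
have inj : injective (fun d : resF K => d ^+ 2).
  move=> x y /= /eqP; rewrite -subr_eq0 subr_sqr mulf_eq0 => /orP[|].
    by rewrite subr_eq0 => /eqP.
  by rewrite -[y in x + y]resF_opp subr_eq0 => /eqP.
have [g _ gK] := injF_bij inj; exists (g c); exact: gK.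
Qed.

Lemma sqrt_mod2 x : x \in R -> exists2 y, y \in R & y ^+ 2 - x \in idl 1.
Proof.
move=> xR; have [d hd] := resF_sqrt (redK x).
exists (rlift d); first exact: rlift_ring.
by apply/redP; rewrite ?rpredX ?rlift_ring // redX ?rlift_ring // rliftK.
Qed.

End ValuationRing.

Arguments idl : clear implicits.

Section RingMembership.
Variable K : dyadicField.
Local Notation R := (@valring K).
Lemma valringD x y : x \in R -> y \in R -> x + y \in R. Proof. exact: rpredD. Qed.
Lemma valringM x y : x \in R -> y \in R -> x * y \in R. Proof. exact: rpredM. Qed.
Lemma valringN x : x \in R -> - x \in R. Proof. by rewrite rpredN. Qed.
Lemma valringX x n : x \in R -> x ^+ n \in R. Proof. exact: rpredX. Qed.
Lemma valring0 : 0 \in R. Proof. exact: rpred0. Qed.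
Lemma valring1 : 1 \in R. Proof. exact: rpred1. Qed.
End RingMembership.

Ltac inR := repeat first [ assumption | exact: valring0 | exact: valring1
  | exact: ring_nat | exact: rlift_ring | apply: valringX | apply: valringN
  | apply: valringM | apply: valringD | apply: unit_ring; assumption ].

(** * Means over the valuation ring modulo a power of 2 *)

Section Digits.
Variable K : dyadicField.
Implicit Types x y : K.
Local Notation R := (@valring K).
Local Notation k := (resF K).

Fixpoint expansion (s : seq k) : K :=
  if s is c :: s' then rlift c + 2 * expansion s' else 0.

Lemma expansion_ring s : expansion s \in R.
Proof. by elim: s => [|c s IH] /=; inR. Qed.

Lemma expansion_rcons s c :
  expansion (rcons s c) = expansion s + 2 ^+ size s * rlift c.
Proof.
elim: s => [|d s IH] /=; first by rewrite mulr0 addr0 add0r mul1r.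
by rewrite IH mulrDr addrA exprS mulrA.
Qed.

Lemma expansion_ex m x : x \in R ->
  exists d : m.-tuple k, x - expansion d \in idl K m.
Proof.
elim: m x => [|m IH] x xR; first by exists [tuple]; rewrite subr0 idl0.
have : x - rlift (redK x) \in idl K 1 by apply/redP; inR; rewrite rliftK.
move=> /idlP[y yR hy]; have [d hd] := IH y yR.
exists [tuple of redK x :: d].
by rewrite /= opprD addrA hy expr1 -mulrBr idl_mul2.
Qed.

Lemma expansion_inj m (d d' : m.-tuple k) :
  expansion d - expansion d' \in idl K m -> d = d'.
Proof.
elim: m d d' => [|m IH] d d'; first by rewrite (tuple0 d) (tuple0 d').
case/tupleP: d => c d; case/tupleP: d' => c' d' /= h.
have ec : c = c'.
  rewrite -(rliftK c) -(rliftK c'); apply/redP; inR.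
  have -> : rlift c - rlift c' = (rlift c + 2 * expansion d
     - (rlift c' + 2 * expansion d')) - 2 * (expansion d - expansion d') by ring.
  by rewrite rpredB ?(idl_le _ h) // idl_two // rpredB ?expansion_ring.
rewrite ec in h *; congr [tuple of _ :: _]; apply: IH.
by rewrite -idl_mul2 mulrBr; move: h; rewrite opprD addrACA subrr add0r.
Qed.

Definition digits m x : m.-tuple k :=
  odflt [tuple of nseq m 0] [pick d : m.-tuple k | x - expansion d \in idl K m].

Lemma digitsP m x : x \in R -> x - expansion (digits m x) \in idl K m.
Proof.
by move=> xR; rewrite /digits; case: pickP => //= h; have [d] := expansion_ex m xR; rewrite h.
Qed.

Lemma digits_inj m x y : x \in R -> y \in R ->
  digits m x = digits m y -> x - y \in idl K m.
Proof.
move=> xR yR e; have -> : x - y = (x - expansion (digits m x))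
  - (y - expansion (digits m y)) by rewrite e; ring.
by rewrite rpredB ?digitsP.
Qed.

Lemma resq_gt1 : (1 < resq K)%N.
Proof.
rewrite /resq (cardD1 0) (cardD1 1) !inE oner_eq0 /=; lia.
Qed.

End Digits.

Ltac inRx := repeat first [ exact: expansion_ring | progress inR | apply: valringX
  | apply: valringN | apply: valringM | apply: valringD ].

Section Mean.
Variables (K : dyadicField) (C : numFieldType) (M : nat).
Local Notation R := (@valring K).
Local Notation k := (resF K).
Local Notation T := (M.-tuple k).
Local Notation q := ((resq K)%:R : C).
Local Notation expn_ := (fun d : T => expansion d).

Lemma q_neq0 : q != 0.
Proof. by rewrite pnatr_eq0 -lt0n (ltn_trans _ (resq_gt1 K)). Qed.

(** For [F] periodic modulo 2^M this is the Haar integral over R^n ([Rintegral_mean]). As a finite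
    sum over digit vectors it makes sense in any [numFieldType], and changes of variables reduce to
    permutations. *)
Definition mean n (F : 'rV[K]_n -> C) : C :=
  (q ^+ (M * n))^-1 * \sum_(x : 'rV[T]_n) F (map_mx expn_ x).

Definition mean1 (G : K -> C) : C :=
  (q ^+ M)^-1 * \sum_(d : T) G (expansion d).

Definition per (m : nat) (G : K -> C) :=
  forall x y, x \in R -> y \in R -> x - y \in idl K m -> G x = G y.

Definition perv n (F : 'rV[K]_n -> C) :=
  forall x y, x \is a mxOver R -> y \is a mxOver R ->
    x - y \is a mxOver (idl K M) -> F x = F y.

Lemma per_le m n G : (m <= n)%N -> per m G -> per n G.
Proof. by move=> mn pG x y xR yR xy; apply: pG => //; apply: idl_le xy. Qed.

Lemma map_expansion_ring n (x : 'rV[T]_n) : map_mx expn_ x \is a mxOver R.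
Proof. by apply/mxOverP => i j; rewrite mxE expansion_ring. Qed.

Lemma mean_ext n F F' : (forall x : 'rV[K]_n, x \is a mxOver R -> F x = F' x) ->
  mean F = mean F'.
Proof.
by move=> h; congr (_ * _); apply: eq_bigr => x _; rewrite h ?map_expansion_ring.
Qed.

Lemma mean1_ext G G' : (forall x, x \in R -> G x = G' x) -> mean1 G = mean1 G'.
Proof. by move=> h; congr (_ * _); apply: eq_bigr => x _; rewrite h ?expansion_ring. Qed.

Lemma mean1E G : mean1 G = mean (fun x : 'rV_1 => G (x 0 0)).
Proof.
rewrite /mean /mean1 muln1; congr (_ * _).
rewrite (reindex (fun d : T => const_mx d : 'rV_1)) /=.
  by apply: eq_bigr => d _; rewrite !mxE.
by exists (fun x : 'rV_1 => x 0 0) => [d|x] _; rewrite ?mxE //; apply/rowP => i; rewrite !mxE ord1.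
Qed.

Lemma meanD n F F' : mean (fun x : 'rV[K]_n => F x + F' x) = mean F + mean F'.
Proof. by rewrite /mean big_split /= mulrDr. Qed.
Lemma meanZ n c F : mean (fun x : 'rV[K]_n => c * F x) = c * mean F.
Proof. by rewrite /mean -mulr_sumr mulrCA. Qed.
Lemma mean_cst n c : mean (fun x : 'rV[K]_n => c) = c.
Proof.
rewrite /mean sumr_const card_mx card_tuple mul1n -[#|k|]/(resq K).
by rewrite -expnM -[c *+ _]mulr_natl natrX mulKf // expf_neq0 // q_neq0.
Qed.
Lemma mean1D F F' : mean1 (fun x => F x + F' x) = mean1 F + mean1 F'.
Proof. by rewrite !mean1E meanD. Qed.
Lemma mean1Z c F : mean1 (fun x => c * F x) = c * mean1 F.
Proof. by rewrite !mean1E meanZ. Qed.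
Lemma mean1_cst c : mean1 (fun x => c) = c.
Proof. by rewrite mean1E mean_cst. Qed.

Lemma mean_exchange n m F :
  mean (fun x : 'rV[K]_n => mean (fun y : 'rV[K]_m => F x y)) =
  mean (fun y => mean (fun x => F x y)).
Proof.
rewrite /mean -!mulr_sumr mulrCA; congr (_ * (_ * _)); exact: exchange_big.
Qed.
Lemma mean_mean1 n F :
  mean (fun x : 'rV[K]_n => mean1 (fun y => F x y)) =
  mean1 (fun y => mean (fun x => F x y)).
Proof.
rewrite mean1E mean_exchange; apply: mean_ext => x _; exact: mean1E.
Qed.
Lemma mean1_exchange F :
  mean1 (fun x => mean1 (fun y => F x y)) = mean1 (fun y => mean1 (fun x => F x y)).
Proof.
by rewrite mean1E mean_mean1; apply: mean1_ext => y _; rewrite [RHS]mean1E.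
Qed.

Lemma mean0 F : mean F = F (0 : 'rV[K]_0).
Proof.
rewrite -[RHS](mean_cst 0); apply: mean_ext => x _; congr F.
by apply/rowP; case.
Qed.

Lemma mean_cat n1 n2 F : mean F = mean (fun x : 'rV[K]_n1 =>
   mean (fun y : 'rV[K]_n2 => F (row_mx x y))).
Proof.
rewrite /mean -mulr_sumr mulrA -invfM mulnDr exprD; congr (_^-1 * _).
rewrite pair_big /= (reindex (fun p : 'rV[T]_n1 * 'rV[T]_n2 => row_mx p.1 p.2)) /=.
  by apply: eq_bigr => -[x y] _ /=; rewrite map_row_mx.
exists (fun x : 'rV_(n1 + n2) => (lsubmx x, rsubmx x)) => [[x y]|x] _ /=.
  by rewrite row_mxKl row_mxKr.
by rewrite hsubmxK.
Qed.

Lemma mean_cons n F : mean F = mean1 (fun s =>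
   mean (fun y : 'rV[K]_n => F (row_mx (s%:M : 'M[K]_1) y))).
Proof.
rewrite (@mean_cat 1 n) mean1E; apply: mean_ext => x _; apply: mean_ext => y _.
by congr (F (row_mx _ _)); apply/rowP => i; rewrite !mxE ord1 eqxx.
Qed.

(** An injection of the finite set R^n modulo 2^M into itself is a permutation, so no Jacobian
    appears and no inverse of [phi] has to be exhibited. *)
Lemma mean_bij n (phi : 'rV[K]_n -> 'rV[K]_n) F :
  (forall x, x \is a mxOver R -> phi x \is a mxOver R) ->
  (forall x y, x \is a mxOver R -> y \is a mxOver R ->
     phi x - phi y \is a mxOver (idl K M) -> x - y \is a mxOver (idl K M)) ->
  perv F -> mean (fun x => F (phi x)) = mean F.
Proof.
move=> pR pI pF; congr (_ * _).
pose s (x : 'rV[T]_n) := map_mx (digits M) (phi (map_mx expn_ x)).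
have sI : injective s.
  move=> x y /matrixP e; apply/matrixP => i j; apply: expansion_inj.
  have: map_mx expn_ x - map_mx expn_ y \is a mxOver (idl K M).
    apply: pI; rewrite ?map_expansion_ring //; apply/mxOverP => a b.
    have := e a b; rewrite !mxE; apply: digits_inj; apply/mxOverP;
    by apply: pR; exact: map_expansion_ring.
  by move/mxOverP/(_ i j); rewrite !mxE.
rewrite [RHS](reindex s) /=; last exact/onW_bij/(injF_bij sI).
apply: eq_bigr => x _; apply: pF; rewrite ?pR ?map_expansion_ring //.
apply/mxOverP => i j; rewrite !mxE; apply: digitsP.
by apply/mxOverP/pR/map_expansion_ring.
Qed.

Lemma perv1 G : per M G -> perv (fun x : 'rV_1 => G (x 0 0)).
Proof.
move=> pG x y /mxOverP xR /mxOverP yR /mxOverP xy; apply: pG => //.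
by have := xy 0 0; rewrite !mxE.
Qed.

Lemma mean1_bij (phi : K -> K) G :
  (forall x, x \in R -> phi x \in R) ->
  (forall x y, x \in R -> y \in R -> phi x - phi y \in idl K M -> x - y \in idl K M) ->
  per M G -> mean1 (fun x => G (phi x)) = mean1 G.
Proof.
move=> pR pI pG; rewrite !mean1E -[RHS](@mean_bij 1 (fun x => (phi (x 0 0))%:M)) //; first last.
- exact: perv1.
- move=> x y /mxOverP xR /mxOverP yR /mxOverP h; apply/mxOverP => i j.
  rewrite !ord1 !mxE; apply: pI => //; by have := h 0 0; rewrite !mxE eqxx.
- move=> x /mxOverP xR; apply/mxOverP => i j; rewrite !ord1 mxE eqxx; exact: pR.
by apply: mean_ext => x _; rewrite mxE eqxx.
Qed.

Lemma mean_shift n (a : 'rV[K]_n) F : a \is a mxOver R -> perv F ->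
  mean (fun x => F (x + a)) = mean F.
Proof.
move=> aR pF; rewrite (@mean_bij n (fun x => x + a)) // => [x xR|x y _ _].
  by rewrite rpredD.
by rewrite opprD addrACA subrr addr0.
Qed.

(** Translation invariance, averaged over an auxiliary vector [y]; the inner mean can then be
    evaluated for fixed [x]. The gradient arguments start here. *)
Lemma mean_avg n m (phi : 'rV[K]_m -> 'rV[K]_n) F :
  (forall y, y \is a mxOver R -> phi y \is a mxOver R) -> perv F ->
  mean F = mean (fun x => mean (fun y => F (x + phi y))).
Proof.
move=> pR pF; rewrite mean_exchange -[LHS](mean_cst m); apply: mean_ext => y yR.
by rewrite mean_shift ?pR.
Qed.

Lemma mean_avg1 n (phi : K -> 'rV[K]_n) F :
  (forall y, y \in R -> phi y \is a mxOver R) -> perv F ->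
  mean F = mean (fun x => mean1 (fun y => F (x + phi y))).
Proof.
move=> pR pF; rewrite (@mean_avg n 1 (fun y => phi (y 0 0))) //.
  by apply: mean_ext => x _; rewrite mean1E.
by move=> y /mxOverP yR; apply: pR.
Qed.

Lemma mean1_shift a G : a \in R -> per M G -> mean1 (fun x => G (a + x)) = mean1 G.
Proof.
move=> aR pG; apply: (@mean1_bij (fun x => a + x)) => // [x xR|x y _ _].
  by rewrite rpredD.
by rewrite opprD addrACA subrr add0r.
Qed.

(** The difference of two values is x - y times a unit congruent to [u] modulo 2, so the polynomial
    is injective modulo every power of 2. *)
Lemma mean1_quad u w c G : valunit u -> w \in R -> c \in R -> per M G ->
  mean1 (fun y => G (c + (u * y + 2 * (w * y ^+ 2)))) = mean1 G.
Proof.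
move=> uu wR cR pG; apply: (@mean1_bij (fun y => _)) => // [x xR|x y xR yR].
  by inR.
have -> : c + (u * x + 2 * (w * x ^+ 2)) - (c + (u * y + 2 * (w * y ^+ 2))) =
   (u + 2 * (w * (x + y))) * (x - y) by ring.
rewrite unit_idlM //; apply: unit_cong uu _.
by rewrite addrC addKr idl_two //; inR.
Qed.

Lemma mean1_unit u c G : valunit u -> c \in R -> per M G ->
  mean1 (fun y => G (c + u * y)) = mean1 G.
Proof.
move=> uu cR pG; rewrite -(mean1_quad uu (rpred0 _) cR pG).
by apply: mean1_ext => y _; rewrite mul0r mulr0 addr0.
Qed.

End Mean.

Section MeanEven.
Variables (K : dyadicField) (C : numFieldType) (M : nat).
Hypothesis M0 : (0 < M)%N.
Local Notation R := (@valring K).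
Local Notation k := (resF K).
Local Notation q := ((resq K)%:R : C).

Lemma sum_tuple_cons m (G : seq k -> C) :
  \sum_(d : m.+1.-tuple k) G d = \sum_(c : k) \sum_(d : m.-tuple k) G (c :: d).
Proof.
rewrite pair_big /= (reindex (fun p : k * m.-tuple k => [tuple of p.1 :: p.2])) //=.
exists (fun t => (thead t, [tuple of behead t])) => [[c d]|t] _ /=.
  by congr (_, _); apply: val_inj.
by apply: val_inj => /=; case/tupleP: t.
Qed.

Lemma sum_tuple_rcons m (G : seq k -> C) :
  \sum_(d : m.+1.-tuple k) G d = \sum_(c : k) \sum_(d : m.-tuple k) G (rcons d c).
Proof.
rewrite pair_big /= (reindex (fun p : k * m.-tuple k => [tuple of rcons p.2 p.1])) //=.
apply/onW_bij/inj_card_bij; last by rewrite card_prod !card_tuple expnS.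
by move=> [c d] [c' d'] /(congr1 val) /= /rcons_inj [/val_inj -> ->].
Qed.

Lemma mean1_res (g : k -> C) :
  mean1 M (fun x : K => g (redK x)) = q^-1 * \sum_(c : k) g c.
Proof.
case: M M0 => // m _; rewrite /mean1.
rewrite (@sum_tuple_cons m (fun s => g (redK (expansion s)))).
rewrite (eq_bigr (fun c => q ^+ m * g c)) => [|c _]; last first.
  rewrite (eq_bigr (fun=> g c)) => [|d _ /=].
    by rewrite sumr_const card_tuple -[g c *+ _]mulr_natl natrX.
  congr g; rewrite -[RHS]rliftK; apply/redP; [by inRx|by inRx|].
  by rewrite addrC addKr idl_two ?expansion_ring.
rewrite -mulr_sumr exprS invfM -mulrA mulKf //.
by rewrite expf_neq0 // q_neq0.
Qed.

(** Multiplication by 2 shifts digits. On the left only the tuples with first digit 0 survive, on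
    the right the last digit is invisible modulo 2^M; both sides become one sum over the remaining
    digits. *)
Lemma mean1_even G : per M G ->
  mean1 M (fun x : K => (x \in idl K 1)%:R * G x) = q^-1 * mean1 M (fun x => G (2 * x)).
Proof.
case: M M0 => // m _ pG; rewrite /mean1.
rewrite (@sum_tuple_cons m (fun s => (expansion s \in idl K 1)%:R * G (expansion s))).
rewrite (@sum_tuple_rcons m (fun s => G (2 * expansion s))).
rewrite (bigD1 0) //= [X in _ + X]big1 ?addr0 => [|c c0]; last first.
  rewrite big1 // => d _; have -> : (rlift c + 2 * expansion d \in idl K 1) = false.
    apply/negbTE; rewrite rpredDr; last by rewrite idl_two ?expansion_ring.
    by apply: contra c0 => /red0P => /(_ (rlift_ring _)); rewrite rliftK => ->.
  by rewrite mul0r.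
have -> : \sum_(c : k) \sum_(d : m.-tuple k) G (2 * expansion (rcons d c)) =
   q * \sum_(d : m.-tuple k) G (2 * expansion d).
  rewrite (eq_bigr (fun=> \sum_(d : m.-tuple k) G (2 * expansion d))).
    by rewrite sumr_const -[_ *+ _]mulr_natl.
  move=> c _; apply: eq_bigr => d _; apply: pG; [by inRx|by inRx|].
  rewrite expansion_rcons size_tuple -mulrBr addrC addKr idl_mul2.
  by apply: idl2X; inR.
rewrite [RHS]mulrCA mulKf ?q_neq0 //; congr (_ * _); apply: eq_bigr => d _.
by rewrite rlift0 add0r idl_two ?expansion_ring // mul1r.
Qed.

Lemma perv_cons n (F : 'rV[K]_(1 + n) -> C) y : y \is a mxOver R -> perv M F ->
  per M (fun s => F (row_mx (s%:M : 'M[K]_1) y)).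
Proof.
move=> yR pF s s' sR s'R ss; apply: pF.
- apply/mxOverP => i j; rewrite mxE; case: fintype.split => a; rewrite ?ord1 ?mxE ?eqxx //.
  exact: (mxOverP yR).
- apply/mxOverP => i j; rewrite mxE; case: fintype.split => a; rewrite ?ord1 ?mxE ?eqxx //.
  exact: (mxOverP yR).
apply/mxOverP => i j; rewrite !mxE; case: fintype.split => a; rewrite ?ord1 ?mxE ?eqxx //.
by rewrite subrr rpred0.
Qed.

Lemma mxOver_row_mx (S : {pred K}) m n1 n2 (A : 'M[K]_(m, n1)) (B : 'M[K]_(m, n2)) :
  (row_mx A B \is a mxOver S) = (A \is a mxOver S) && (B \is a mxOver S).
Proof.
apply/mxOverP/andP => [h|[/mxOverP hA /mxOverP hB] i j].
  split; apply/mxOverP => i j.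
    by have := h i (lshift _ j); rewrite row_mxEl.
  by have := h i (rshift _ j); rewrite row_mxEr.
by rewrite mxE; case: fintype.split.
Qed.

Lemma mxOver_scalar1 (S : {pred K}) s : ((s%:M : 'M[K]_1) \is a mxOver S) = (s \in S).
Proof.
apply/mxOverP/idP => [/(_ 0 0)|h i j]; first by rewrite mxE eqxx.
by rewrite !ord1 mxE eqxx.
Qed.

Lemma mean_even n (F : 'rV[K]_n -> C) : perv M F ->
  mean M (fun x => (x \is a mxOver (idl K 1))%:R * F x) =
  (q ^+ n)^-1 * mean M (fun x => F (2 *: x)).
Proof.
elim: n F => [|n IH] F pF.
  rewrite !mean0 scaler0 expr0 invr1 mul1r.
  by rewrite rpred0 mul1r.
have step : forall s, s \in R -> perv M (fun y : 'rV_n => F (row_mx (s%:M : 'M[K]_1) y)).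
  move=> s sR x y xR yR xy; apply: pF.
  - by rewrite (@mxOver_row_mx _ 1 1 n) xR mxOver_scalar1 sR.
  - by rewrite (@mxOver_row_mx _ 1 1 n) yR mxOver_scalar1 sR.
  suff : (row_mx (s%:M : 'M[K]_1) x - row_mx s%:M y : 'rV_(1 + n)) \is a mxOver (idl K M) by [].
  by rewrite opp_row_mx add_row_mx mxOver_row_mx xy subrr rpred0.
rewrite !(@mean_cons K C M n).
transitivity (mean1 M (fun s : K => (s \in idl K 1)%:R *
   ((q ^+ n)^-1 * mean M (fun y : 'rV_n => F (row_mx (s%:M : 'M[K]_1) (2 *: y)))))).
  apply: mean1_ext => s sR; rewrite -(IH _ (step _ sR)) -meanZ.
  apply: mean_ext => y yR.
  by rewrite (@mxOver_row_mx _ 1 1 n) mxOver_scalar1 mulrA -natrM mulnb.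
rewrite mean1_even; last first.
  move=> s s' sR s'R ss; congr (_ * _); apply: mean_ext => y yR.
  by apply: (perv_cons _ pF) => //; apply: mxOverZ => //; exact: ring_two.
rewrite exprS invfM -mulrA; congr (_ * _); rewrite -mean1Z.
apply: mean1_ext => s sR; congr (_ * _); apply: mean_ext => y yR.
have e : (2 : K) *: (row_mx (s%:M : 'M[K]_1) y : 'rV_(1 + n)) = row_mx (2 * s)%:M (2 *: y).
  by rewrite scale_row_mx scale_scalar_mx.
by rewrite -e.
Qed.

End MeanEven.

(** * Quadratic forms, parity of the diagonal and the norm *)

Section QuadraticForms.
Variable K : dyadicField.
Implicit Types (Q P : qform K).
Local Notation R := (@valring K).

Lemma det_ring n (A : 'M[K]_n) : A \is a mxOver R -> \det A \in R.
Proof.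
move=> /mxOverP AR; apply: rpred_sum => s _; apply: rpredM.
  by apply: rpredX; rewrite rpredN; apply: rpred1.
by apply: rpred_prod => i _; apply: AR.
Qed.

Lemma invmx_ring n (A : 'M[K]_n) : A \is a mxOver R -> valunit (\det A) ->
  invmx A \is a mxOver R.
Proof.
move=> AR dA; rewrite /invmx; case: ifP => // _.
apply: mxOverZ; first exact: unitVring.
apply/mxOverP => i j; rewrite mxE /cofactor; apply: rpredM.
  by apply: rpredX; rewrite rpredN; apply: rpred1.
by apply: det_ring; apply/mxOverP => a b; rewrite !mxE; apply/mxOverP.
Qed.

Definition bil Q (x y : 'rV[K]_(rk Q)) : K := (x *m qmx Q *m y^T) 0 0.

(** Equivalent to having norm different from R ([not_normRP]), but phrased on diagonal entries, the
    form in which the gradient argument and the block splittings use it. *)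
Definition evenform Q := forall i, qmx Q i i \in idl K 1.
Definition symint Q := (qmx Q)^T = qmx Q /\ qmx Q \is a mxOver R.

Lemma unimod_symint Q : unimodular Q -> symint Q. Proof. by case. Qed.

Lemma bil_ring Q x y : qmx Q \is a mxOver R -> x \is a mxOver R ->
  y \is a mxOver R -> @bil Q x y \in R.
Proof.
move=> QR xR yR; rewrite /bil; apply/mxOverP; do 2?apply: mxOverM => //.
by apply/mxOverP => i j; rewrite mxE; apply/mxOverP.
Qed.

Lemma qeval_ring Q x : qmx Q \is a mxOver R -> x \is a mxOver R -> qeval (Q := Q) x \in R.
Proof. by move=> QR xR; apply: bil_ring. Qed.

Lemma bilC Q x y : (qmx Q)^T = qmx Q -> @bil Q x y = bil y x.
Proof.
move=> sQ; rewrite /bil -[in LHS](trmxK (x *m _ *m _)) [in LHS]mxE.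
by rewrite !trmx_mul trmxK sQ mulmxA.
Qed.
Lemma bilDl Q x x' y : @bil Q (x + x') y = bil x y + bil x' y.
Proof. by rewrite /bil !mulmxDl mxE. Qed.
Lemma bilNl Q x y : @bil Q (- x) y = - bil x y.
Proof. by rewrite /bil !mulNmx mxE. Qed.
Lemma bilDr Q x y y' : @bil Q x (y + y') = bil x y + bil x y'.
Proof. by rewrite /bil linearD mulmxDr mxE. Qed.
Lemma bilZl Q a x y : @bil Q (a *: x) y = a * bil x y.
Proof. by rewrite /bil -!scalemxAl mxE. Qed.
Lemma bilZr Q a x y : @bil Q x (a *: y) = a * bil x y.
Proof. by rewrite /bil linearZ -scalemxAr mxE. Qed.
Lemma bil_delta Q x j : @bil Q x (delta_mx 0 j) = (x *m qmx Q) 0 j.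
Proof. by rewrite /bil trmx_delta -colE mxE. Qed.
Lemma qeval_delta Q j : qeval (Q := Q) (delta_mx 0 j) = qmx Q j j.
Proof. by rewrite -[qeval _]/(bil _ _) bil_delta -rowE mxE. Qed.

Lemma qevalD Q x y : (qmx Q)^T = qmx Q ->
  qeval (Q := Q) (x + y) = qeval x + (2 * bil x y + qeval y).
Proof.
move=> sQ; rewrite -![qeval _]/(bil _ _) !(bilDl, bilDr) (bilC y x sQ); ring.
Qed.
Lemma qevalZ Q a x : qeval (Q := Q) (a *: x) = a ^+ 2 * qeval x.
Proof. by rewrite -![qeval _]/(bil _ _) bilZl bilZr mulrA. Qed.

Lemma mxOver_delta m n i j : (delta_mx i j : 'M[K]_(m, n)) \is a mxOver R.
Proof. by apply/mxOverP => a b; rewrite mxE; apply: ring_nat. Qed.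

Lemma bil_idl m Q x y : qmx Q \is a mxOver R -> x \is a mxOver (idl K m) ->
  y \is a mxOver R -> @bil Q x y \in idl K m.
Proof.
move=> /mxOverP QR /mxOverP xR /mxOverP yR; rewrite /bil mxE.
apply: rpred_sum => i _; rewrite !mxE; apply: idlMr; last exact: yR.
by apply: rpred_sum => j _; apply: idlMr.
Qed.

Lemma qeval_cong m Q x y : symint Q -> x \is a mxOver R -> y \is a mxOver R ->
  x - y \is a mxOver (idl K m) -> qeval (Q := Q) x - qeval y \in idl K m.
Proof.
move=> [sQ QR] xR yR xy.
have -> : qeval x - qeval y = bil (x - y) x + bil (x - y) y.
  rewrite -![qeval _]/(bil _ _) !bilDl !bilNl (bilC y x sQ); ring.
by apply: rpredD; apply: bil_idl.
Qed.

(** Off-diagonal entries of a symmetric matrix are counted twice, so only the diagonal survives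
    modulo 2. *)
Lemma qeval_mod2 Q x : symint Q -> x \is a mxOver R ->
  qeval (Q := Q) x - \sum_i qmx Q i i * x 0 i ^+ 2 \in idl K 1.
Proof.
move=> [sQ QR] xR; rewrite [x in qeval x]row_sum_delta.
set s := index_enum _; elim: s => [|i s IH].
  rewrite !big_nil -[qeval _]/(bil _ _) /bil !mul0mx mxE subr0; exact: rpred0.
rewrite !big_cons qevalD // qevalZ qeval_delta.
set y := \sum_(j <- s) _ in IH *.
have yR : y \is a mxOver R.
  by apply: rpred_sum => j _; apply: mxOverZ; [apply/mxOverP | exact: mxOver_delta].
have -> : forall a b c d e : K, a ^+ 2 * b + (2 * c + d) - (b * a ^+ 2 + e) = 2 * c + (d - e).
  by move=> *; ring.
apply: rpredD => //; apply: idl_two; apply: bil_ring => //.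
by apply: mxOverZ; [apply/mxOverP | exact: mxOver_delta].
Qed.

Lemma qeval_even Q x : symint Q -> evenform Q -> x \is a mxOver R ->
  qeval (Q := Q) x \in idl K 1.
Proof.
move=> hQ eQ xR; rewrite -(subrK (\sum_i qmx Q i i * x 0 i ^+ 2) (qeval x)).
apply: rpredD; first exact: qeval_mod2.
by apply: rpred_sum => i _; apply: idlMr => //; apply: valringX; apply/mxOverP.
Qed.

Lemma normRP Q : symint Q -> normR Q <-> exists i, valunit (qmx Q i i).
Proof.
move=> hQ; have [_ QR] := hQ; split=> [nQ|[i ui]].
  apply: contrapT => hn; have eQ : evenform Q.
    move=> i; apply/negPn/negP => h; apply: hn; exists i.
    by rewrite valunitE h (mxOverP QR).
  have : qnorm Q 1 by rewrite nQ /=; exact: valring1.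
  case=> s [hs e1]; have : (1 : K) \in idl K 1.
    rewrite e1 big_seq; apply: rpred_sum => p /hs [p1 p2].
    by apply: idlMl => //; apply: qeval_even.
  by have := unit1 K; rewrite valunitE => /andP[_ /negbTE ->].
apply/seteqP; split => y /=.
  case=> s [hs ->]; rewrite big_seq; apply: rpred_sum => p /hs [p1 p2].
  by apply: rpredM => //; apply: qeval_ring.
move=> yR; exists [:: (y / qmx Q i i, delta_mx 0 i)]; split.
  move=> p; rewrite inE => /eqP -> /=; split; last exact: mxOver_delta.
  by apply: valringM => //; apply: unitVring.
by rewrite big_seq1 /= qeval_delta divfK // unit_neq0.
Qed.

Lemma not_normRP Q : symint Q -> ~ normR Q <-> evenform Q.
Proof.
move=> hQ; have [_ QR] := hQ; split=> [h i|h nQ].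
  apply/negPn/negP => hi; apply/h/(normRP hQ); exists i.
  by rewrite valunitE hi (mxOverP QR).
by have [j] := proj1 (normRP hQ) nQ; rewrite valunitE h andbF.
Qed.

Lemma qeval_add P Q (x : 'rV_(rk P)) (y : 'rV_(rk Q)) :
  qeval (Q := qfadd P Q) (row_mx x y) = qeval x + qeval y.
Proof.
rewrite /qeval /= mul_row_block !mulmx0 addr0 add0r tr_row_mx mul_row_col mxE.
by [].
Qed.

Lemma qeval_scale a Q x : qeval (Q := qfscale a Q) x = a * qeval (Q := Q) x.
Proof. by rewrite /qeval /= -scalemxAr -scalemxAl mxE. Qed.

Lemma symint_scale a Q : a \in R -> symint Q -> symint (qfscale a Q).
Proof. by move=> aR [sQ QR]; split; [rewrite linearZ /= sQ | apply: mxOverZ]. Qed.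

Lemma mxOver_block (S : {pred K}) m1 m2 n1 n2 (A : 'M[K]_(m1, n1)) (B : 'M[K]_(m1, n2))
   (C : 'M[K]_(m2, n1)) (D : 'M[K]_(m2, n2)) :
  A \is a mxOver S -> B \is a mxOver S -> C \is a mxOver S -> D \is a mxOver S ->
  block_mx A B C D \is a mxOver S.
Proof.
move=> /mxOverP hA /mxOverP hB /mxOverP hC /mxOverP hD; apply/mxOverP => i j.
by rewrite mxE; case: fintype.split => a; rewrite mxE; case: fintype.split.
Qed.

Lemma symint_add P Q : symint P -> symint Q -> symint (qfadd P Q).
Proof.
move=> [sP PR] [sQ QR]; split; first by rewrite /= tr_block_mx !trmx0 sP sQ.
by apply: mxOver_block => //; rewrite rpred0.
Qed.

Lemma unimod_add P Q : unimodular P -> unimodular Q -> unimodular (qfadd P Q).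
Proof.
move=> uP uQ; have [] := symint_add (unimod_symint uP) (unimod_symint uQ).
by split=> //; rewrite /= det_ublock unitM //; [case: uP | case: uQ].
Qed.

Lemma unimod0 : unimodular (qf0 K).
Proof. by split; rewrite /= ?det_mx00 ?unit1 ?flatmxOver ?trmx0. Qed.

Lemma even_add P Q : evenform P -> evenform Q -> evenform (qfadd P Q).
Proof.
move=> eP eQ i; rewrite /=; case: (fintype.splitP i) => j ij.
  by have -> : i = lshift _ j by [apply: val_inj]; rewrite block_mxEul.
by have -> : i = rshift _ j by [apply: val_inj]; rewrite block_mxEdr.
Qed.

Lemma rk_equiv P Q : qequiv P Q -> rk P = rk Q.
Proof.
move=> [U [V [_ _ UV VU _]]]; apply/eqP; rewrite eqn_leq.
by rewrite (mulmx1_min UV) (mulmx1_min VU).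
Qed.

End QuadraticForms.

(** * Laws of the values of a form, as operators on functions *)

Section Distribution.
Variables (K : dyadicField) (C : numFieldType) (M : nat).
Hypothesis M2 : (2 < M)%N.
Implicit Types (Q P : qform K) (G : K -> C) (c : K).
Local Notation R := (@valring K).
Local Notation q := ((resq K)%:R : C).

Let M0 : (0 < M)%N. Proof. exact: ltn_trans M2. Qed.

(** The law of the values of [Q] acts on functions by convolution: orthogonal sums become
    compositions ([dist_add]), and the operators commute ([dist_comm], [dist_unif]). Its variant
    [distp] keeps the primitive vectors only and is not renormalised by their mass. *)
Definition dist Q G c : C := mean M (fun x : 'rV[K]_(rk Q) => G (c + qeval x)).
Definition distp Q G c : C := mean M (fun x : 'rV[K]_(rk Q) =>
  (x \isn't a mxOver (idl K 1))%:R * G (c + qeval x)).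
Definition unif j G c : C := mean1 M (fun y => G (c + 2 ^+ j * y)).

Lemma dist_ext Q G G' c : qmx Q \is a mxOver R -> c \in R ->
  (forall x, x \in R -> G x = G' x) -> dist Q G c = dist Q G' c.
Proof.
by move=> QR cR h; apply: mean_ext => x xR; apply/h/valringD => //; exact: qeval_ring.
Qed.
Lemma distp_ext Q G G' c : qmx Q \is a mxOver R -> c \in R ->
  (forall x, x \in R -> G x = G' x) -> distp Q G c = distp Q G' c.
Proof.
move=> QR cR h; apply: mean_ext => x xR; congr (_ * _).
by apply/h/valringD => //; exact: qeval_ring.
Qed.
Lemma dist_add P Q G c : dist (qfadd P Q) G c = dist P (dist Q G) c.
Proof.
rewrite /dist mean_cat; apply: mean_ext => x _; apply: mean_ext => y _.
by rewrite qeval_add addrA.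
Qed.

Lemma distp_add P Q G c : distp (qfadd P Q) G c =
  mean M (fun x : 'rV_(rk P) => mean M (fun y : 'rV_(rk Q) =>
   (~~ ((x \is a mxOver (idl K 1)) && (y \is a mxOver (idl K 1))))%:R
   * G (c + (qeval x + qeval y)))).
Proof.
rewrite /distp mean_cat; apply: mean_ext => x _; apply: mean_ext => y _.
by rewrite qeval_add mxOver_row_mx.
Qed.

Lemma dist_comm P Q G c : dist P (dist Q G) c = dist Q (dist P G) c.
Proof.
rewrite /dist mean_exchange; apply: mean_ext => x _; apply: mean_ext => y _.
by rewrite addrAC.
Qed.

Lemma dist_unif Q j G c : dist Q (unif j G) c = unif j (dist Q G) c.
Proof.
rewrite /dist /unif mean_mean1; apply: mean1_ext => x _; apply: mean_ext => y _.
by rewrite addrAC.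
Qed.

Lemma dist0 G c : dist (qf0 K) G c = G c.
Proof. by rewrite /dist mean0 /qeval /= !mul0mx mxE addr0. Qed.

Lemma dist_scale a Q G c : dist (qfscale a Q) G c = dist Q (fun s => G (c + a * s)) 0.
Proof. by apply: mean_ext => x _; rewrite qeval_scale add0r. Qed.

Lemma perD m G c : c \in R -> per m G -> per m (fun x => G (c + x)).
Proof.
move=> cR pG x y xR yR xy; apply: pG; [by inR|by inR|].
by rewrite opprD addrACA subrr add0r.
Qed.

Lemma per_shift m n c a G : c \in R -> a \in R -> (forall x, x \in idl K m -> a * x \in idl K n) ->
  per n G -> per m (fun x => G (c + a * x)).
Proof.
move=> cR aR h pG x y xR yR xy; apply: pG; [by inR|by inR|].
by rewrite opprD addrACA subrr add0r -mulrBr h.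
Qed.

Lemma per2X m j c G : c \in R -> per (j + m) G -> per m (fun x => G (c + 2 ^+ j * x)).
Proof.
by move=> cR; apply: per_shift; rewrite // ?idl0; inR => x; rewrite idl_mul2X.
Qed.

Lemma per_dist m Q G : qmx Q \is a mxOver R -> per m G -> per m (dist Q G).
Proof.
move=> QR pG x y xR yR xy; apply: mean_ext => z zR; apply: pG.
- by apply: valringD => //; apply: qeval_ring.
- by apply: valringD => //; apply: qeval_ring.
by rewrite opprD addrACA subrr addr0.
Qed.

Lemma per_unif m j G : per m G -> per m (unif j G).
Proof.
move=> pG x y xR yR xy; apply: mean1_ext => z zR; apply: pG; inR.
by rewrite opprD addrACA subrr addr0.
Qed.

Lemma per_unif_level j G : per M G -> (j <= M)%N -> per j (unif j G).
Proof.
move=> pG jM x y xR yR /idlP[z zR xy].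
have pG' : per M (fun s => G (y + 2 ^+ j * s)).
  by apply: per2X => //; apply: per_le pG; apply: leq_addl.
rewrite /unif -(mean1_shift zR pG'); apply: mean1_ext => s sR.
by congr G; rewrite mulrDr addrA -xy addrCA subrr addr0.
Qed.

Lemma unif_id j G c : c \in R -> per j G -> unif j G c = G c.
Proof.
move=> cR pG; rewrite -[RHS](mean1_cst K M); apply: mean1_ext => x xR; apply: pG; inR.
by rewrite addrAC subrr add0r idl2X.
Qed.

Lemma unif_unif i j G c : (i <= j)%N -> per M G -> c \in R ->
  unif i (unif j G) c = unif i G c.
Proof.
move=> ij pG cR; rewrite /unif mean1_exchange -[RHS](mean1_cst K M).
apply: mean1_ext => y yR.
have pG' : per M (fun s => G (c + 2 ^+ i * s)).
  by apply: per2X => //; apply: per_le pG; apply: leq_addl.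
have aR : 2 ^+ (j - i) * y \in R by inR.
rewrite -(mean1_shift aR pG'); apply: mean1_ext => s sR; congr G.
by rewrite mulrDr mulrA -exprD subnKC // addrAC addrA addrAC.
Qed.

Lemma perv_qeval Q G c : symint Q -> c \in R -> per M G ->
  perv M (fun x : 'rV_(rk Q) => G (c + qeval x)).
Proof.
move=> hQ cR pG x y xR yR xy; have [_ QR] := hQ; apply: pG.
- by apply: valringD => //; apply: qeval_ring.
- by apply: valringD => //; apply: qeval_ring.
by rewrite opprD addrACA subrr add0r qeval_cong.
Qed.

Lemma even_cong n (x y : 'rV[K]_n) : x - y \is a mxOver (idl K 1) ->
  (x \is a mxOver (idl K 1)) = (y \is a mxOver (idl K 1)).
Proof.
move=> xy; apply/idP/idP => h; first by rewrite -(subKr x y) rpredB.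
by rewrite -(subrK y x) rpredD.
Qed.

Lemma mxOver_idl_le m m' n n' (x : 'M[K]_(n, n')) : (m <= m')%N ->
  x \is a mxOver (idl K m') -> x \is a mxOver (idl K m).
Proof. by move=> h /mxOverP hx; apply/mxOverP => i j; apply: idl_le (hx i j). Qed.

Lemma perv_qevalp Q G c : symint Q -> c \in R -> per M G ->
  perv M (fun x : 'rV_(rk Q) => (x \isn't a mxOver (idl K 1))%:R * G (c + qeval x)).
Proof.
move=> hQ cR pG x y xR yR xy; congr ((~~ _)%:R * _).
  by apply: even_cong; apply: mxOver_idl_le xy.
exact: (perv_qeval hQ cR pG).
Qed.

(** An invertible integral matrix preserves 2 R^n; the flag passed to [F] lets one argument serve
    both [dist] and [distp]. *)
Lemma qequiv_mean P Q (F : bool -> K -> C) : qequiv P Q ->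
  perv M (fun x : 'rV_(rk Q) => F (x \is a mxOver (idl K 1)) (qeval x)) ->
  mean M (fun x : 'rV_(rk P) => F (x \is a mxOver (idl K 1)) (qeval x)) =
  mean M (fun x : 'rV_(rk Q) => F (x \is a mxOver (idl K 1)) (qeval x)).
Proof.
move=> PQ; have := rk_equiv PQ; case: P Q PQ => n A [n' B] /= [U [V /= [UR VR UV VU e]]] nn.
subst n' => pF.
have idlU m (x : 'rV_n) (W : 'M[K]_n) : W \is a mxOver R -> x \is a mxOver (idl K m) ->
    x *m W \is a mxOver (idl K m).
  move=> /mxOverP WR /mxOverP xR; apply/mxOverP => i j; rewrite mxE.
  by apply: rpred_sum => l _; apply: idlMr.
rewrite -[RHS](@mean_bij K C M n (fun x => x *m U)) //; first last.
- move=> x y xR yR; rewrite -mulmxBl => /(idlU _ _ _ VR).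
  by rewrite -mulmxA UV mulmx1.
- by move=> x xR; apply: mxOverM.
apply: mean_ext => x xR; congr (F _ _).
  apply/idP/idP => [h|/(idlU _ _ _ VR)]; first exact: idlU.
  by rewrite -mulmxA UV mulmx1.
by rewrite /qeval /= -e trmx_mul !mulmxA.
Qed.

Lemma dist_equiv P Q G c : qequiv P Q -> symint Q -> per M G -> c \in R ->
  dist P G c = dist Q G c.
Proof.
move=> PQ hQ pG cR; apply: (qequiv_mean (F := fun _ s => G (c + s)) PQ).
exact: perv_qeval.
Qed.

Lemma distp_equiv P Q G c : qequiv P Q -> symint Q -> per M G -> c \in R ->
  distp P G c = distp Q G c.
Proof.
move=> PQ hQ pG cR; apply: (qequiv_mean (F := fun b s => (~~ b)%:R * G (c + s)) PQ).
exact: perv_qevalp.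
Qed.

(** Non-primitive vectors are of the form 2 y and have mass q^(-r); there the value is 4 Q(y). This
    identity is the source of the recursion. *)
Lemma dist_split Q G c : symint Q -> per M G -> c \in R ->
  dist Q G c = distp Q G c + (q ^+ rk Q)^-1 * dist (qfscale 4 Q) G c.
Proof.
move=> hQ pG cR.
have -> : dist (qfscale 4 Q) G c = mean M (fun x : 'rV_(rk Q) => G (c + qeval (2 *: x))).
  apply: mean_ext => x _; rewrite qeval_scale qevalZ; congr (G (_ + _ * _)); ring.
rewrite -(mean_even M0 (perv_qeval hQ cR pG)) -meanD; apply: mean_ext => x _.
by case: (x \is a _); rewrite ?mul0r ?mul1r ?add0r ?addr0.
Qed.

Lemma dist_id m Q G c : qmx Q \is a mxOver R -> per m G -> c \in R ->
  (forall x, x \is a mxOver R -> qeval (Q := Q) x \in idl K m) -> dist Q G c = G c.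
Proof.
move=> QR pG cR h; rewrite -[RHS](mean_cst K M (rk Q)); apply: mean_ext => x xR.
apply: pG => //; first by apply: valringD => //; apply: qeval_ring.
by rewrite addrC addKr h.
Qed.

(* The gradient of [Q] at a primitive vector is twice a primitive vector. *)
Lemma distp_unif e Q G c : unimodular Q ->
  (forall i, 2 ^+ e * qmx Q i i \in idl K 1) -> per M G -> c \in R ->
  distp Q G c = distp Q (unif e.+2 G) c.
Proof.
move=> uQ eQ pG cR; have hQ := unimod_symint uQ; have [sQ QR dQ] := uQ.
(* The shift by 2^(e+1) z keeps [x] primitive and changes the value by 2^(e+2) (B(x, z) + 2^e
   Q(z)). *)
rewrite {1}/distp (@mean_avg K C M _ _ (fun z : 'rV_(rk Q) => 2 ^+ e.+1 *: z)); first last.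
- exact: perv_qevalp.
- by move=> y yR; apply: mxOverZ => //; exact: valringX (ring_two K).
apply: mean_ext => x xR.
transitivity (mean M (fun y : 'rV_(rk Q) => (x \isn't a mxOver (idl K 1))%:R *
    G (c + qeval (x + 2 ^+ e.+1 *: y)))).
  apply: mean_ext => y yR; congr ((~~ _)%:R * _); apply: even_cong.
  rewrite addrC addKr; apply/mxOverP => i j; rewrite mxE exprS -mulrA.
  by apply: idl_two; apply: valringM; [exact: valringX (ring_two K) | apply/mxOverP].
rewrite meanZ; case: (boolP (x \is a _)) => [|xp]; first by rewrite !mul0r.
congr (_ * _).
have [j uj] : exists j, valunit ((x *m qmx Q) 0 j).
  apply: contrapT => hn; move/negP: xp; apply.
  have -> : x = x *m qmx Q *m invmx (qmx Q).
    by rewrite mulmxK // unitmxE unitfE unit_neq0.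
  apply/mxOverP => a b; rewrite mxE; apply: rpred_sum => i _; apply: idlMr; last first.
    by apply/mxOverP; apply: invmx_ring.
  rewrite ord1; apply/negPn/negP => hi; apply: hn; exists i.
  by rewrite valunitE hi andbT; apply/mxOverP/mxOverM.
have aR : c + qeval x \in R by apply: valringD => //; apply: qeval_ring.
pose G' s := G (c + qeval x + 2 ^+ e.+2 * s).
have pG' : per M G' by apply: per2X => //; apply: per_le pG; apply: leq_addl.
have gE (y : 'rV_(rk Q)) : G (c + qeval (x + 2 ^+ e.+1 *: y)) = G' (bil x y + 2 ^+ e * qeval y).
  by congr G; rewrite qevalD // bilZr qevalZ !exprS; ring.
have bR (y : 'rV_(rk Q)) : y \is a mxOver R -> bil x y + 2 ^+ e * qeval y \in R.
  move=> yR; apply: valringD; first exact: bil_ring.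
  by apply: valringM; [exact: valringX (ring_two K)|exact: qeval_ring].
rewrite (mean_ext M (fun y _ => gE y)) -[RHS](mean_cst K M (rk Q)).
(* Only the coordinate [j] is averaged, on top of a frozen [y]: the coefficient of [s] is then a
   unit and that of [s ^+ 2] is even by [eQ], as [mean1_quad] requires. *)
rewrite (@mean_avg1 K C M _ (fun s => s *: delta_mx 0 j)); first last.
- move=> y z yR zR yz; apply: pG'; rewrite ?bR //.
  rewrite opprD addrACA -mulrBr; apply: rpredD; last first.
    by apply: idlMl; [exact: valringX (ring_two K)|exact: qeval_cong].
  rewrite (bilC x y sQ) (bilC x z sQ) -bilNl -bilDl; exact: bil_idl.
- by move=> y yR; apply: mxOverZ => //; apply: mxOver_delta.
apply: mean_ext => y yR.
have [w wR hw] := idlP _ _ (eQ j); rewrite expr1 in hw.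
have uu : valunit ((x *m qmx Q) 0 j + 2 * (2 ^+ e * bil y (delta_mx 0 j))).
  apply: (unit_cong uj); rewrite addrC addKr; apply: idl_two; apply: valringM.
    exact: valringX (ring_two K).
  by apply: bil_ring => //; apply: mxOver_delta.
rewrite -[RHS](mean1_quad uu wR (bR _ yR) pG'); apply: mean1_ext => s sR.
congr G'; rewrite bilDr qevalD // !bilZr bil_delta qevalZ qeval_delta.
transitivity (bil x y + 2 ^+ e * qeval y + ((x *m qmx Q) 0 j * s +
  2 * (2 ^+ e * bil y (delta_mx 0 j)) * s + (2 ^+ e * qmx Q j j) * s ^+ 2)); first ring.
by rewrite hw; ring.
Qed.

(** Squaring permutes the residue field, hence so does the reduction of the polynomial c + a s^2. *)
Lemma mean1_sq a c G : valunit a -> c \in R -> per 1 G ->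
  mean1 M (fun s => G (c + a * s ^+ 2)) = mean1 M G.
Proof.
move=> ua cR pG; have aR := unit_ring ua.
have GE s : s \in R -> G s = (fun b => G (rlift b)) (redK s).
  by move=> sR; apply: pG; inR; apply/redP; inR; rewrite rliftK.
rewrite (mean1_ext M (G' := fun s => (fun b => G (rlift (redK c + redK a * b ^+ 2))) (redK s))).
  rewrite [RHS](mean1_ext M GE) (mean1_res M0 (fun b => G (rlift (redK c + redK a * b ^+ 2)))).
  rewrite (mean1_res M0 (fun b => G (rlift b))); congr (_ * _).
  rewrite [RHS](reindex (fun b => redK c + redK a * b ^+ 2)) //.
  apply/onW_bij/injF_bij => x y /addrI /(mulfI (red_neq0 ua)) /eqP.
  rewrite -subr_eq0 subr_sqr mulf_eq0 => /orP[|]; first by rewrite subr_eq0 => /eqP.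
  by rewrite -[y in x + y]resF_opp subr_eq0 => /eqP.
by move=> s sR; rewrite GE; inR; rewrite redD ?redM ?redX; inR.
Qed.

(** Translate along a basis vector with unit diagonal entry: the cross term is even, and the square
    equidistributes modulo 2 by [mean1_sq]. *)
Lemma dist_normR Q G c : symint Q -> normR Q -> per 1 G -> c \in R ->
  dist Q G c = mean1 M G.
Proof.
move=> hQ /(normRP hQ) [j uj] pG cR; have [sQ QR] := hQ.
rewrite /dist (@mean_avg1 K C M _ (fun s => s *: delta_mx 0 j)); first last.
- by apply: perv_qeval => //; apply: per_le pG.
- by move=> y yR; apply: mxOverZ => //; apply: mxOver_delta.
rewrite -[RHS](mean_cst K M (rk Q)); apply: mean_ext => x xR.
have aR : c + qeval x \in R by apply: valringD => //; apply: qeval_ring.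
rewrite -(mean1_sq uj aR pG); apply: mean1_ext => s sR; apply: pG.
- apply: valringD => //; apply: qeval_ring => //; apply: rpredD => //.
  by apply: mxOverZ => //; apply: mxOver_delta.
- by inR.
rewrite qevalD // bilZr qevalZ qeval_delta.
have -> : forall a b d e f : K, a + (b + (d + e * f)) - (a + b + f * e) = d by move=> *; ring.
apply: idl_two; apply: valringM => //; apply: bil_ring => //; exact: mxOver_delta.
Qed.

End Distribution.

(** * Hyperbolic and elliptic planes *)

Section Planes.
Variable K : dyadicField.
Local Notation R := (@valring K).
Local Notation k := (resF K).

Definition vec2 (x y : K) : 'rV[K]_2 := \row_i (if i == 0 then x else y).

Lemma qeval2 (A : 'M[K]_2) x y : qeval (Q := QForm A) (vec2 x y) =
  A 0 0 * x ^+ 2 + (A 0 1 + A 1 0) * (x * y) + A 1 1 * y ^+ 2.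
Proof.
rewrite /qeval /= !mxE !big_ord_recl !big_ord0 !mxE !big_ord_recl !big_ord0 !mxE /=.
have -> : lift ord0 ord0 = 1 :> 'I_2 by apply: val_inj.
by rewrite -[ord0]/(0 : 'I_2); ring.
Qed.

Lemma irreducible_noroot (F : fieldType) (p : {poly F}) x :
  irreducible_poly p -> size p = 3 -> p.[x] != 0.
Proof.
move=> [_ hp] sp; apply/negP => px; have := hp ('X - x%:P).
rewrite size_XsubC dvdp_XsubCl => /(_ isT px)/eqp_size; by rewrite size_XsubC sp.
Qed.

Lemma horner3 (F : fieldType) (p : {poly F}) x : size p = 3 ->
  p.[x] = p`_0 + p`_1 * x + p`_2 * x ^+ 2.
Proof.
move=> sp; rewrite horner_coef sp !big_ord_recl big_ord0 /= addr0 expr0 mulr1.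
by rewrite addrA expr1.
Qed.

Variable f : {poly K}.
Hypothesis ef : elliptic_poly f.

Lemma elliptic_coef i : f`_i \in R.
Proof. by case: ef => /polyOverP h _ _ _; apply: h. Qed.

Lemma elliptic_aniso (x y : k) :
  redK f`_2 * x ^+ 2 + redK f`_1 * (x * y) + redK f`_0 * y ^+ 2 = 0 ->
  (x == 0) && (y == 0).
Proof.
case: ef => fR _ sf irr.
have fE i : (map_poly redK f)`_i = redK f`_i by rewrite coef_map_id0 ?red0.
have lc : redK f`_2 != 0.
  by rewrite -fE -[2%N]/(3%N.-1) -sf -lead_coefE lead_coef_eq0 -size_poly_eq0 sf.
case: (eqVneq y 0) => [->|y0].
  rewrite expr0n /= !mulr0 !addr0 => /eqP; rewrite mulf_eq0 (negbTE lc) /=.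
  by rewrite sqrf_eq0 => ->.
move=> h; have := irreducible_noroot (x / y) irr sf; rewrite horner3 // !fE.
have -> : redK f`_0 + redK f`_1 * (x / y) + redK f`_2 * (x / y) ^+ 2 =
  (redK f`_2 * x ^+ 2 + redK f`_1 * (x * y) + redK f`_0 * y ^+ 2) / y ^+ 2.
  by field.
by rewrite h mul0r eqxx.
Qed.

(** If the middle coefficient were even, the reduction f_2 x^2 + f_0 y^2 would vanish at x = sqrt
    f_0, y = sqrt f_2. Anisotropy then forces f_2 = 0, and (1, 0) becomes a forbidden zero. *)
Lemma elliptic_unit : valunit f`_1.
Proof.
rewrite valunitE elliptic_coef /=; apply/negP => /(red0P (elliptic_coef 1)) f1.
have [x hx] := resF_sqrt (redK f`_0); have [y hy] := resF_sqrt (redK f`_2).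
have : redK f`_2 * x ^+ 2 + redK f`_1 * (x * y) + redK f`_0 * y ^+ 2 = 0.
  by rewrite hx hy f1 mul0r addr0 mulrC resF_char2.
move=> /elliptic_aniso /andP[/eqP x0 /eqP y0].
have : redK f`_2 * 1 ^+ 2 + redK f`_1 * (1 * 0) + redK f`_0 * 0 ^+ 2 = 0.
  by rewrite -hy y0 !expr0n /= !(mul0r, mulr0) !addr0.
by move=> /elliptic_aniso; rewrite oner_eq0.
Qed.

Lemma ord2P (P : 'I_2 -> Prop) : P 0 -> P 1 -> forall i, P i.
Proof.
move=> p0 p1 i; case: (unliftP 0 i) => [j ->|->//].
by have -> : lift 0 j = 1 :> 'I_2 by rewrite (ord1 j); apply: val_inj.
Qed.

Lemma det2 (A : 'M[K]_2) : \det A = A 0 0 * A 1 1 - A 0 1 * A 1 0.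
Proof.
rewrite (expand_det_row _ 0) !big_ord_recl big_ord0 /cofactor !det_mx11 !mxE.
have -> : lift ord0 ord0 = 1 :> 'I_2 by apply: val_inj.
rewrite (_ : lift 1 0 = 0 :> 'I_2); last by apply: val_inj.
by rewrite -[ord0]/(0 : 'I_2) /= expr0 expr1; ring.
Qed.

Lemma unimod2 a b d : a \in R -> b \in R -> d \in R -> valunit (a * d - b ^+ 2) ->
  unimodular (QForm (\matrix_(i < 2, j < 2) if i != j then b else if i == 0 then a else d)).
Proof.
move=> aR bR dR u; split=> /=.
- by apply/matrixP => i j; rewrite !mxE eq_sym; case: (eqVneq i j) => //= ->.
- by apply/mxOverP => i j; rewrite !mxE; case: ifP => // _; case: ifP.
by rewrite det2 !mxE /= -expr2.
Qed.

Lemma unimodE : unimodular (qfE f).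
Proof.
apply: unimod2; try exact: elliptic_coef;
  try (by apply: valringM; [exact: ring_two|exact: elliptic_coef]).
apply: (unit_cong (unitN (unitM elliptic_unit elliptic_unit))).
rewrite -expr2 opprK subrK -mulrA; apply: idl_two; do 2?apply: valringM;
  by [exact: ring_two | exact: elliptic_coef].
Qed.

Lemma evenE : evenform (qfE f).
Proof. by apply: ord2P; rewrite mxE /=; apply/idl_two/elliptic_coef. Qed.

End Planes.

Section HyperbolicPlanes.
Variable K : dyadicField.

Lemma unimodH : unimodular (qfH K).
Proof.
split=> /=.
- by apply/matrixP => i j; rewrite !mxE eq_sym.
- by apply/mxOverP => i j; rewrite !mxE; apply: ring_nat.
by rewrite det2 !mxE /= mul0r mulr1 sub0r; apply: unitN; apply: unit1.
Qed.

Lemma evenH : evenform (qfH K).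
Proof. by move=> i; rewrite mxE eqxx; apply: val_ge0. Qed.

Lemma planes_props e (P : qform K) : planes e P ->
  [/\ unimodular P, evenform P & rk P = (rk P %/ 2).*2]%N.
Proof.
have Hs m : [/\ unimodular (qfHs K m), evenform (qfHs K m) & rk (qfHs K m) = m.*2]%N.
  elim: m => [|m [u ev r]]; first by split; [exact: unimod0|case|].
  split; [exact: unimod_add unimodH u|exact: even_add evenH ev|].
  by rewrite -[qfHs K m.+1]/(qfadd (qfH K) (qfHs K m)) /= r.
case=> [m|f m ef]; have [u ev r] := Hs m.
  by split=> //; rewrite r; lia.
split; [exact: unimod_add (unimodE ef) u|exact: even_add (evenE ef) ev|].
by rewrite /= r; lia.
Qed.

End HyperbolicPlanes.

Section PlanesDistribution.
Variables (K : dyadicField) (C : numFieldType) (M : nat).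
Hypothesis M2 : (2 < M)%N.
Implicit Types (Q P : qform K) (G : K -> C) (c : K).
Local Notation R := (@valring K).
Local Notation k := (resF K).
Local Notation q := ((resq K)%:R : C).

Let M0 : (0 < M)%N. Proof. exact: ltn_trans M2. Qed.

Lemma mean_vec2 F : mean M F = mean1 M (fun x => mean1 M (fun y => F (@vec2 K x y) : C)).
Proof.
rewrite (@mean_cons K C M 1); apply: mean1_ext => x _; rewrite mean1E.
apply: mean_ext => y _; congr F; apply/rowP; apply: ord2P.
  by rewrite [RHS]mxE mxE; case: fintype.splitP => j //; rewrite !ord1 mxE eqxx.
rewrite [RHS]mxE mxE; case: fintype.splitP => j //=; first by rewrite ord1.
by rewrite ord1.
Qed.

Lemma mean1_ind : mean1 M (fun x : K => (x \in idl K 1)%:R : C) = q^-1.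
Proof.
rewrite -[RHS]mulr1 -[X in _ * X](mean1_cst K M) -(mean1_even M0 (G := fun=> 1)) //.
by apply: mean1_ext => x _; rewrite mulr1.
Qed.

Lemma mean1_ind_shift y0 : y0 \in R ->
  mean1 M (fun x : K => (x - y0 \in idl K 1)%:R : C) = q^-1.
Proof.
move=> yR; rewrite -mean1_ind -(mean1_shift (a := - y0) (G := fun x => (x \in idl K 1)%:R)) ?rpredN //.
  by apply: mean1_ext => x _; rewrite addrC.
move=> x y xR yR' xy; congr (_%:R); congr nat_of_bool; apply/idP/idP => h.
  by rewrite -(subKr x y) rpredB // (idl_le _ xy).
by rewrite -(subrK y x) rpredD // (idl_le _ xy).
Qed.

Lemma mean1_cond (G : K -> C) a : per M G -> (forall x, x \in R -> x \notin idl K 1 -> G x = a) ->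
  mean1 M G = (1 - q^-1) * a + q^-1 * mean1 M (fun x => G (2 * x)).
Proof.
move=> pG h; rewrite -(mean1_even M0 pG) mulrBl mul1r -[X in X - _](mean1_cst K M).
rewrite -mean1_ind -mulNr -mulN1r mulrAC -mean1Z -!mean1D.
apply: mean1_ext => x xR; case: (boolP (x \in _)) => hx.
  by rewrite mul1r mulr1 mulN1r subrr add0r.
by rewrite (h _ xR hx) mulr0 mul0r !addr0.
Qed.

(** Modulo 4 the values of [P] follow a signed mixture: weight 1 - al uniform on 2 R, weight al at
    0. The weights al multiply under direct sums, with 1/q for a hyperbolic and -1/q for an elliptic
    plane; this is the origin of the signed powers q^(-r/2) in the values of I. *)
Definition plane_like P (al : C) := forall G c, per 2 G -> c \in R ->
  dist M P G c = (1 - al) * unif M 1 G c + al * G c.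

Lemma plane_like_add P P' a b : symint P -> symint P' ->
  plane_like P a -> plane_like P' b -> plane_like (qfadd P P') (a * b).
Proof.
move=> hP [sP' PR'] hPa hPb G c pG cR; have pGM : per M G by apply: per_le pG; exact: ltnW.
rewrite dist_add hPa //; last exact: per_dist.
rewrite -dist_unif hPb //; last exact: per_unif.
by rewrite unif_unif // hPb //; ring.
Qed.

Lemma plane_like0 : plane_like (qf0 K) 1.
Proof. by move=> G c _ _; rewrite dist0 subrr mul0r add0r mul1r. Qed.

(** For [x] a unit, 2xy is uniform on 2 R; for [x] even, an event of mass 1/q, it vanishes modulo
    4. *)
Lemma plane_likeH : plane_like (qfH K) q^-1.
Proof.
move=> G c pG cR; rewrite /dist mean_vec2.
have pG1 : per 1 (fun s => G (c + 2 * s)).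
  by have := @per2X K C 1 1 c G cR; apply.
transitivity (mean1 M (fun x => unif M 1 G c + (x \in idl K 1)%:R * (G c - unif M 1 G c))).
  apply: mean1_ext => x xR; case: (boolP (x \in _)) => hx.
    rewrite mul1r addrC subrK -[RHS](mean1_cst K M); apply: mean1_ext => y yR.
    rewrite qeval2 !mxE /=; apply: pG; inR.
    have -> : c + (0 * x ^+ 2 + (1 + 1) * (x * y) + 0 * y ^+ 2) - c = 2 * (x * y) by ring.
    by rewrite idl_mul2 idlMr.
  rewrite mul0r addr0 /unif -(mean1_unit (u := x) (c := 0) (G := fun s => G (c + 2 * s))) //; first last.
  - by apply: per_le pG1.
  - by rewrite rpred0.
  - by rewrite valunitE xR.
  apply: mean1_ext => y yR; rewrite qeval2 !mxE /=; congr G; ring.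
by rewrite mean1D mean1_cst (mean1_ext M (G' := fun x => (G c - unif M 1 G c) * (x \in idl K 1)%:R))
  ?mean1Z ?mean1_ind => [|x _]; ring.
Qed.

(* Multiplying the argument by [s] multiplies an anisotropic form by [s ^+ 2], and every
   element of the residue field is a square, so all nonzero values are equally frequent. *)
Lemma aniso_sum (phi : k -> k -> k) (g : k -> C) :
  (forall s x y, phi (s * x) (s * y) = s ^+ 2 * phi x y) ->
  (forall x y, phi x y = 0 -> (x == 0) && (y == 0)) ->
  \sum_x \sum_y g (phi x y) = (q + 1) * (\sum_u g u) - q * g 0.
Proof.
move=> hom an; have phi0 : phi 0 0 = 0.
  by have := hom 0 0 0; rewrite mul0r expr0n mul0r.
rewrite pair_big /= (bigD1 (0, 0)) //= phi0.
set S := \sum_(p | _) _; set U := \sum_(u : k | u != 0) g u.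
have cardk : \sum_(s : k | s != 0) (1 : C) = q - 1.
  have -> : q = \sum_(s : k) 1 by rewrite sumr_const.
  by rewrite [in RHS](bigD1 0) //= addrAC subrr add0r.
have SE (s : k) : s != 0 -> S = \sum_(p : k * k | p != (0, 0)) g (s ^+ 2 * phi p.1 p.2).
  move=> s0; rewrite /S (reindex (fun p : k * k => (s * p.1, s * p.2))) /=.
    apply: eq_big => [[x y]|[x y] _] /=; last by rewrite hom.
    by rewrite !xpair_eqE !mulf_eq0 (negbTE s0).
  exists (fun p => (s^-1 * p.1, s^-1 * p.2)) => -[x y] _ /=.
    by rewrite !mulKf.
  by rewrite !mulVKf.
have : (q - 1) * S = (q ^+ 2 - 1) * U.
  rewrite -cardk mulr_suml (eq_bigr (fun s => \sum_(p : k * k | p != (0, 0)) g (s ^+ 2 * phi p.1 p.2))).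
    rewrite exchange_big /= (eq_bigr (fun=> U)) => [|[x y] xy].
      rewrite sumr_const -[U *+ _]mulr_natl; congr (_ * _).
      have -> : #|[pred p : k * k | p != (0, 0)]| = (#|{: k * k}| - 1)%N.
        by rewrite (cardC1 (0, 0)) subn1.
      by rewrite natrB ?card_prod ?natrM ?expr2 // muln_gt0 -[#|k|]/(resq K) (ltn_trans _ (resq_gt1 K)).
    have p0 : phi x y != 0 by apply: contraNneq xy => /an /andP[/eqP -> /eqP ->].
    rewrite [RHS](reindex (fun s : k => s ^+ 2 * phi x y)) /=.
      by apply: eq_bigl => s; rewrite mulf_eq0 (negbTE p0) orbF sqrf_eq0.
    apply/onW_bij/injF_bij => a b /(mulIf p0) /eqP.
    rewrite -subr_eq0 subr_sqr mulf_eq0 => /orP[|]; first by rewrite subr_eq0 => /eqP.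
    by rewrite -[b in a + b]resF_opp subr_eq0 => /eqP.
  by move=> s s0; rewrite mul1r -SE.
have q1 : q - 1 != 0 by rewrite subr_eq0 (eqr_nat _ _ 1) gtn_eqF // resq_gt1.
rewrite (_ : q ^+ 2 - 1 = (q - 1) * (q + 1)); last by ring.
rewrite -mulrA => /(mulfI q1) ->; rewrite [in RHS](bigD1 0) //= -/U; ring.
Qed.

Lemma plane_likeE f : elliptic_poly f -> plane_like (qfE f) (- q^-1).
Proof.
move=> ef G c pG cR; rewrite /dist mean_vec2.
have fR := elliptic_coef ef.
have pG1 : per 1 (fun s => G (c + 2 * s)).
  by have := @per2X K C 1 1 c G cR; apply.
pose g (b : k) := G (c + 2 * rlift b).
have gE s : s \in R -> G (c + 2 * s) = g (redK s).
  by move=> sR; apply: (pG1); inR; apply/redP; inR; rewrite rliftK.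
pose phi (x y : k) := redK f`_2 * x ^+ 2 + redK f`_1 * (x * y) + redK f`_0 * y ^+ 2.
have uE : unif M 1 G c = q^-1 * \sum_u g u.
  rewrite -(mean1_res M0) /unif; apply: mean1_ext => y yR.
  by rewrite expr1 gE.
rewrite (mean1_ext M (G' := fun x => (fun a => q^-1 * \sum_b g (phi a b)) (redK x))) => [|x xR].
  (* By [aniso_sum] each nonzero residue is taken q + 1 times and 0 only once, whence the weight
     -1/q. *)
  rewrite (mean1_res M0 (fun a => q^-1 * \sum_b g (phi a b))) -mulr_sumr (aniso_sum (phi := phi)).
  - have -> : G c = g 0 by rewrite /g rlift0 mulr0 addr0.
    by rewrite uE; field; exact: q_neq0.
  - by move=> s x y; rewrite /phi; ring.
  - exact: elliptic_aniso.
rewrite -(mean1_res M0 (fun b => g (phi (redK x) b))); apply: mean1_ext => y yR.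
have sR : f`_2 * x ^+ 2 + f`_1 * (x * y) + f`_0 * y ^+ 2 \in R.
  by do ?apply: valringD; apply: valringM; rewrite ?fR //; inR.
rewrite qeval2 !mxE /=.
have -> : 2 * f`_2 * x ^+ 2 + (f`_1 + f`_1) * (x * y) + 2 * f`_0 * y ^+ 2 =
  2 * (f`_2 * x ^+ 2 + f`_1 * (x * y) + f`_0 * y ^+ 2) by ring.
rewrite gE //; congr g; rewrite /phi.
have f0 := fR 0%N; have f1 := fR 1%N; have f2 := fR 2%N.
by rewrite !redD ?redM ?redX; inR.
Qed.

Local Notation sg e := ((-1) ^+ (~~ e) : C).

Lemma planes_dist e P : planes e P -> plane_like P (sg e / q ^+ (rk P %/ 2)).
Proof.
have Hs m : plane_like (qfHs K m) (q ^+ m)^-1.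
  elim: m => [|m IH]; first by rewrite invr1; exact: plane_like0.
  rewrite exprS invfM; apply: plane_like_add => //; last exact: plane_likeH.
    exact/unimod_symint/unimodH.
  by have [u _ _] := planes_props (PlanesP K m); apply: unimod_symint.
have rHs m : rk (qfHs K m) = m.*2.
  by elim: m => // m IH; rewrite -[qfHs K m.+1]/(qfadd (qfH K) (qfHs K m)) /= IH.
case=> [m|f m ef].
  by rewrite rHs -muln2 mulnK // expr0 mul1r.
rewrite /= rHs -[(2 + m.*2)%N]/(m.+1.*2) -muln2 mulnK // expr1 mulN1r.
rewrite exprS invfM -mulNr; apply: plane_like_add; [| |exact: plane_likeE|exact: Hs].
  exact/unimod_symint/unimodE.
by have [u _ _] := planes_props (PlanesP K m); apply: unimod_symint.
Qed.

(** Primitive vectors of an even form average the function over 4 R, and modulo 4 the mixture law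
    applies. The non-primitive vectors, of mass q^(-r) = al^2 and value 0 modulo 4, are then
    subtracted. *)
Lemma planes_distp e P G c : planes e P -> per M G -> c \in R ->
  distp M P G c = (1 - sg e / q ^+ (rk P %/ 2)) * unif M 1 G c
    + (sg e / q ^+ (rk P %/ 2) - (sg e / q ^+ (rk P %/ 2)) ^+ 2) * unif M 2 G c.
Proof.
move=> pP pG cR; have [uP eP rP] := planes_props pP; have hP := unimod_symint uP.
rewrite (distp_unif M2 (e := 0)) // => [|j]; last by rewrite mul1r.
have p2 : per 2 (unif M 2 G) by apply: per_unif_level => //; exact: ltnW.
have pM : per M (unif M 2 G) by apply: per_unif.
have := dist_split M2 hP pM cR; rewrite (planes_dist pP p2 cR) unif_unif //.
rewrite (@dist_id K C M 2 (qfscale 4 P)) //; first last.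
- move=> x xR; rewrite qeval_scale (_ : 4 = 2 ^+ 2 :> K); last by ring.
  by apply: idl2X; apply: qeval_ring => //; case: hP.
- by case: (symint_scale (ring_nat K 4) hP).
move=> e1; apply/eqP; rewrite -subr_eq in e1 *.
move/eqP: e1; rewrite -subr_eq => /eqP <-.
have -> : q ^+ rk P = (q ^+ (rk P %/ 2)) ^+ 2 by rewrite {1}rP -exprM muln2.
apply/eqP; rewrite exprMn sqrr_sign exprVn; ring.
Qed.

End PlanesDistribution.

(** * The truncated power of t *)

Section TruncatedPower.
Variables (K : dyadicField) (C : numFieldType) (M : nat) (t : C).
Hypothesis M2 : (2 < M)%N.
Local Notation R := (@valring K).
Local Notation q := ((resq K)%:R : C).
Hypothesis tq : 1 - t / q != 0.
Local Notation iot := (iota_q K t).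

(* [t ^ v(c)] truncated at level [j]: on [2 ^ j R] the value is the mean of [t ^ v]
   there, so that averaging over [2 ^ i R] just lowers the truncation level. *)
Fixpoint ztrunc (j : nat) (c : K) : C :=
  if j is j'.+1 then if c \in idl K 1 then t * ztrunc j' (c / 2) else 1 else iot.

Lemma ztruncS2 j c : c \in R -> ztrunc j.+1 (2 * c) = t * ztrunc j c.
Proof. by move=> cR /=; rewrite idl_two // [2 * c]mulrC mulfK // two_neq0. Qed.

Lemma ztrunc_unit j c : c \notin idl K 1 -> ztrunc j.+1 c = 1.
Proof. by move=> /negbTE /= ->. Qed.

Lemma ztrunc_per j : per j (ztrunc j).
Proof.
elim: j => [//|j IH] x y xR yR xy.
have xy1 : x - y \in idl K 1 by apply: idl_le xy.
have exy : (x \in idl K 1) = (y \in idl K 1).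
  apply/idP/idP => h; first by rewrite -(subKr x y) rpredB.
  by rewrite -(subrK y x) rpredD.
rewrite /= exy; case: ifP => // hy; rewrite hy in exy; congr (_ * _).
move: hy => /idlP [y' y'R ey]; move: exy => /idlP [x' x'R ex].
rewrite !expr1 in ey ex; rewrite ex ey ![2 * _]mulrC !mulfK ?two_neq0 //.
by apply: IH => //; move: xy; rewrite ex ey -mulrBr idl_mul2.
Qed.

Lemma ztrunc_mulu j u c : valunit u -> c \in R -> ztrunc j (u * c) = ztrunc j c.
Proof.
move=> uu; elim: j c => [//|j IH] c cR /=; rewrite unit_idlM //.
case: ifP => // /idlP [c' c'R ->]; rewrite expr1 mulrCA ![2 * _]mulrC !mulfK ?two_neq0 //.
by rewrite IH.
Qed.

(** The functional equation of the mean of t^v: units have mass 1 - 1/q and value 1, while 2 R has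
    mass 1/q and contributes a factor t. *)
Lemma iotaE : iot = 1 - q^-1 + t * iot / q.
Proof.
have q0 := q_neq0 K C; have qt : q - t != 0.
  apply: contraNneq tq => h; have -> : 1 - t / q = (q - t) / q by field.
  by rewrite h mul0r.
by rewrite /iota_q; field; rewrite q0 qt.
Qed.

Lemma mean_ztrunc j : (j <= M)%N -> mean1 M (ztrunc j) = iot.
Proof.
elim: j => [|j IH] jM; first by rewrite mean1_cst.
rewrite (mean1_cond M2 (a := 1)); first last.
- by move=> x _; apply: ztrunc_unit.
- exact: (per_le jM (@ztrunc_per j.+1)).
rewrite (mean1_ext M (G' := fun x => t * ztrunc j x)) => [|x xR]; last by rewrite ztruncS2.
by rewrite mean1Z IH 1?ltnW // [RHS]iotaE mulr1 mulrC.
Qed.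

Lemma unif_ztrunc i j c : (i <= j <= M)%N -> c \in R ->
  unif M i (ztrunc j) c = ztrunc i c.
Proof.
move=> /andP[]; elim: i j c => [|i IH] j c ij jM cR.
  rewrite -[RHS](mean_ztrunc jM); rewrite -[RHS](mean1_shift cR); last exact: (per_le jM (@ztrunc_per j)).
  by apply: mean1_ext => x _; rewrite expr0 mul1r.
case: j ij jM => // j ij jM; case: (boolP (c \in idl K 1)) => hc; last first.
  rewrite ztrunc_unit // -[RHS](mean1_cst K M); apply: mean1_ext => y yR.
  rewrite ztrunc_unit // rpredDr // exprS -mulrA idl_two //; inR.
move: hc => /idlP [c' c'R ->]; rewrite expr1 ztruncS2 // -(IH j c') // 1?ltnW // -mean1Z.
by apply: mean1_ext => y yR; rewrite exprS -mulrA -mulrDr ztruncS2 //; inR.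
Qed.

End TruncatedPower.

(** * Local integrals *)

Section LocalIntegral.
Variables (K : dyadicField) (C : numFieldType) (M : nat) (t : C).
Hypothesis M2 : (2 < M)%N.
Implicit Types (P Q : qform K) (G : K -> C).
Local Notation R := (@valring K).
Local Notation k := (resF K).
Local Notation q := ((resq K)%:R : C).
Local Notation sg e := ((-1) ^+ (~~ e) : C).
Hypothesis tq : 1 - t / q != 0.
Local Notation iot := (iota_q K t).
Local Notation zt := (ztrunc (K := K) t).

Let M0 : (0 < M)%N. Proof. exact: ltn_trans M2. Qed.

Lemma dvdR2X n x : dvdR (2 ^+ n : K) x = (x \in idl K n).
Proof.
have h2 : (2 : K) ^+ n != 0 by rewrite expf_neq0 // two_neq0.
by rewrite /dvdR -idl0 -(idl_mul2X n) addn0 mulrC divfK.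
Qed.
Lemma dvdR2 x : dvdR (2 : K) x = (x \in idl K 1).
Proof. by rewrite -(dvdR2X 1) expr1. Qed.
Lemma dvdR4 x : dvdR (4 : K) x = (x \in idl K 2).
Proof. by rewrite -(dvdR2X 2); congr dvdR; ring. Qed.

Lemma one_mod2P (a : K) : one_mod2 a -> a - 1 \in idl K 1.
Proof. by rewrite /one_mod2 dvdR2. Qed.
Lemma one_mod2_unit (a : K) : one_mod2 a -> valunit a.
Proof. by move/one_mod2P/(unit_cong (unit1 K)). Qed.

Lemma idl_cong x y m : x - y \in idl K m -> (x \in idl K m) = (y \in idl K m).
Proof.
move=> xy; apply/idP/idP => h; first by rewrite -(subKr x y) rpredB.
by rewrite -(subrK y x) rpredD.
Qed.

Lemma qf1_mean a (H : bool -> K -> C) :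
  mean M (fun x : 'rV_(rk (qf1 a)) => H (x \is a mxOver (idl K 1)) (qeval x)) =
  mean1 M (fun x => H (x \in idl K 1) (a * x ^+ 2)).
Proof.
rewrite mean1E; apply: mean_ext => x _; congr (H _ _).
  apply/mxOverP/idP => [|h i j]; first exact.
  by rewrite !ord1.
by rewrite /qeval /= mul_mx_scalar -scalemxAl mxE mxE big_ord1 !mxE expr2.
Qed.

Lemma dist_qf1 a G c : dist M (qf1 a) G c = mean1 M (fun x => G (c + a * x ^+ 2)).
Proof. exact: (qf1_mean a (fun _ s => G (c + s))). Qed.

Lemma symint_qf1 a : a \in R -> symint (qf1 a).
Proof.
move=> aR; split; first by rewrite /= tr_scalar_mx.
by apply: mxOver_scalar => //; exact: valring0.
Qed.

Lemma dist_scale_add a P Q G c : dist M (qfscale a (qfadd P Q)) G c =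
  dist M (qfscale a P) (dist M (qfscale a Q) G) c.
Proof.
rewrite !dist_scale dist_add; apply: mean_ext => x _; rewrite dist_scale.
apply: mean_ext => y _; congr G; ring.
Qed.

Lemma dist_scale_equiv a P Q G c : a \in R -> qequiv P Q -> symint Q -> per M G -> c \in R ->
  dist M (qfscale a P) G c = dist M (qfscale a Q) G c.
Proof.
move=> aR PQ hQ pG cR; rewrite !dist_scale; apply: dist_equiv => //; last exact: valring0.
by apply: per_shift pG => // x xM; apply: idlMl.
Qed.

(** At precision 2^(j+1) only the parity of the values of [Q] is visible. Together with
    [dist_even2X] this is how the norms of Q_1 and Q_2 enter the case distinction. *)
Lemma dist_normR2X j Q G c : symint Q -> normR Q -> per j.+1 G -> c \in R ->
  dist M (qfscale (2 ^+ j) Q) G c = unif M j G c.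
Proof.
move=> hQ nQ pG cR; rewrite dist_scale (dist_normR M2 hQ nQ) //; last exact: valring0.
by apply: per2X => //; rewrite addn1.
Qed.

Lemma dist_even2X j Q G c : symint Q -> evenform Q -> per j.+1 G -> c \in R ->
  dist M (qfscale (2 ^+ j) Q) G c = G c.
Proof.
move=> hQ eQ pG cR; apply: (dist_id M _ pG) => //.
  by case: (symint_scale (valringX j (ring_two K)) hQ).
by move=> x xR; rewrite qeval_scale -[j.+1]addn1 idl_mul2X qeval_even.
Qed.

Lemma planes_sq e P : planes e P -> (sg e / q ^+ (rk P %/ 2)) ^+ 2 = (q ^+ rk P)^-1.
Proof.
move=> /planes_props[_ _ rP].
by rewrite exprMn sqrr_sign mul1r exprVn -exprM muln2 -rP.
Qed.

(** Since [P] is even, a unit coordinate on the rank-one form makes the value a unit, where [G] is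
    1. An even coordinate 2 z adds 4 a z^2 and leaves the primitivity condition to [P]. *)
Lemma distp_type1 a e P G : planes e P -> valunit a -> per M G ->
  (forall c, c \in R -> c \notin idl K 1 -> G c = 1) ->
  distp M (qfadd (qf1 a) P) G 0 =
  (1 - q^-1) + q^-1 * mean1 M (fun z => distp M P G (4 * (a * z ^+ 2))).
Proof.
move=> pP ua pG G1; have [uP eP _] := planes_props pP; have hP := unimod_symint uP.
have [_ PR] := hP; have aR := unit_ring ua.
rewrite distp_add (qf1_mean a (fun b s => mean M (fun y : 'rV_(rk P) =>
   (~~ (b && (y \is a mxOver (idl K 1))))%:R * G (0 + (s + qeval y))))).
rewrite (mean1_cond M2 (a := 1)); first last.
- move=> x xR hx; rewrite -[RHS](mean_cst K M (rk P)); apply: mean_ext => y yR.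
  rewrite (negbTE hx) mul1r add0r; have yE := qeval_even hP eP yR; apply: G1.
    by apply: valringD; [inR|apply: idl_ring yE].
  rewrite rpredDr // unit_idlM // expr2 idl_prime // negb_or hx //.
- move=> x x' xR x'R xx; apply: mean_ext => y yR; rewrite (idl_cong (idl_le _ xx)) //.
  congr (_ * _); rewrite !add0r; apply: pG.
  + by apply: valringD; [inR|apply: qeval_ring].
  + by apply: valringD; [inR|apply: qeval_ring].
  rewrite opprD addrACA subrr addr0 -mulrBr; apply: idlMl => //.
  by rewrite subr_sqr; apply: idlMr => //; inR.
rewrite mulr1; congr (_ + _ * _); apply: mean1_ext => x xR; apply: mean_ext => y yR.
rewrite idl_two //= add0r; congr (_ * G (_ + _)); ring.
Qed.

(** [b] says that the rank-one coordinates are even, so that [w] itself must be primitive. Otherwise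
    every [w] counts, and the even ones add G(c) with mass q^(-r), because 4 P vanishes modulo 8. *)
Lemma mean_pair_ind (b : bool) e P G c : planes e P -> per M G -> per 3 G -> c \in R ->
  mean M (fun w : 'rV_(rk P) => (~~ (b && (w \is a mxOver (idl K 1))))%:R * G (c + qeval w)) =
  distp M P G c + (~~ b)%:R * ((q ^+ rk P)^-1 * G c).
Proof.
move=> pP pG pG3 cR; have [uP eP _] := planes_props pP; have hP := unimod_symint uP.
case: b => /=; first by rewrite mul0r addr0.
rewrite mul1r (mean_ext M (F' := fun w : 'rV_(rk P) => G (c + qeval w))) => [|w _]; last by rewrite mul1r.
rewrite -[LHS]/(dist M P G c) (dist_split M2) //; congr (_ + _ * _).
by rewrite (_ : 4 = 2 ^+ 2 :> K) ?dist_even2X //; ring.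
Qed.

(* If [x + y] is a unit the value is a unit; otherwise [y = - x + 2 z] and the two squares
   contribute [(a + b) x^2 + 4 b (z^2 - x z)], an Artin-Schreier expression in [z / x]. *)
Lemma distp_type2 a b e P G w1 : planes e P -> one_mod2 a -> one_mod2 b -> per 3 G ->
  (forall c, c \in R -> c \notin idl K 1 -> G c = 1) ->
  (forall c, c \in idl K 1 -> unif M 1 G c = w1) ->
  (forall u c, valunit u -> c \in R -> G (u ^+ 2 * c) = G c) ->
  let al := sg e / q ^+ (rk P %/ 2) in
  distp M (qfadd (qf1 a) (qfadd (qf1 b) P)) G 0 =
  (1 - q^-1) + q^-1 * ((1 - al) * w1
    + (al - al ^+ 2) * mean1 M (fun x => unif M 2 G ((a + b) * x ^+ 2))
    + al ^+ 2 * (1 - q^-1) * mean1 M (fun z => G ((a + b) + 4 * (z ^+ 2 + z)))).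
Proof.
move=> pP a1 b1 pG3 G1 Gw1 Gsq al.
have [uP eP _] := planes_props pP; have hP := unimod_symint uP; have [_ PR] := hP.
have pG : per M G by apply: per_le pG3.
have aR := unit_ring (one_mod2_unit a1); have bR := unit_ring (one_mod2_unit b1).
have ab : a + b \in idl K 1.
  have -> : a + b = (a - 1) + (b - 1) + 2 * 1 by ring.
  by apply: rpredD; [apply: rpredD; exact: one_mod2P|exact/idl_two/valring1].
pose H x y : C := mean M (fun w : 'rV_(rk P) => (~~ ((x \in idl K 1) &&
   ((y \in idl K 1) && (w \is a mxOver (idl K 1)))))%:R * G (a * x ^+ 2 + b * y ^+ 2 + qeval w)).
have -> : distp M (qfadd (qf1 a) (qfadd (qf1 b) P)) G 0 =
    mean1 M (fun x => mean1 M (fun y => H x y)).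
  rewrite distp_add (qf1_mean a (fun c s => mean M (fun y : 'rV_(rk (qfadd (qf1 b) P)) =>
   (~~ (c && (y \is a mxOver (idl K 1))))%:R * G (0 + (s + qeval y))))).
  apply: mean1_ext => x xR; rewrite mean_cat.
  rewrite -(qf1_mean b (fun c s => mean M (fun w : 'rV_(rk P) => (~~ ((x \in idl K 1) &&
   (c && (w \is a mxOver (idl K 1)))))%:R * G (a * x ^+ 2 + s + qeval w)))).
  apply: mean_ext => y yR; apply: mean_ext => w wR.
  by rewrite qeval_add mxOver_row_mx add0r addrA.
pose c_ x z := a * x ^+ 2 + b * (- x + 2 * z) ^+ 2.
have cE x z : c_ x z = (a + b) * x ^+ 2 + 4 * (b * (z ^+ 2 - x * z)) by rewrite /c_; ring.
have cR x z : x \in R -> z \in R -> c_ x z \in R by move=> xR zR; rewrite /c_; inR.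
have HE x : x \in R -> mean1 M (fun y => H x y) = (1 - q^-1) + q^-1 * mean1 M (fun z =>
    distp M P G (c_ x z) + (x \notin idl K 1)%:R * ((q ^+ rk P)^-1 * G (c_ x z))).
  move=> xR; have pH : per M (H x).
    move=> y y' yR y'R yy; apply: mean_ext => w wR; rewrite (idl_cong (idl_le _ yy)) //.
    congr (_ * _); apply: pG.
    + by apply: valringD; [inR|apply: qeval_ring].
    + by apply: valringD; [inR|apply: qeval_ring].
    have -> : forall u v v' s : K, u + v + s - (u + v' + s) = v - v' by move=> *; ring.
    rewrite -mulrBr; apply: idlMl => //.
    by rewrite subr_sqr; apply: idlMr => //; inR.
  have xNR : - x \in R by inR.
  rewrite -(mean1_shift xNR pH) (mean1_cond M2 (a := 1)); first last.
  - move=> s sR hs; rewrite -[RHS](mean_cst K M (rk P)); apply: mean_ext => w wR.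
    have wE := qeval_even hP eP wR.
    have -> : (x \in idl K 1) && ((- x + s \in idl K 1) && (w \is a mxOver (idl K 1))) = false.
      apply/negbTE; apply: contra hs => /and3P[h1 h2 _].
      by have -> : s = x + (- x + s) by [ring]; rewrite rpredD.
    rewrite mul1r; apply: G1.
      by apply: valringD; [inR|apply: idl_ring wE].
    rewrite rpredDr //.
    have -> : a * x ^+ 2 + b * (- x + s) ^+ 2 = b * s ^+ 2 + ((a + b) * x ^+ 2 - 2 * (b * (x * s))) by ring.
    rewrite rpredDr; last by apply: rpredB; [apply: idlMr => //; inR | apply: idl_two; inR].
    by rewrite unit_idlM ?one_mod2_unit // expr2 idl_prime // negb_or hs.
  - by apply: perD.
  rewrite mulr1; congr (_ + _ * _); apply: mean1_ext => z zR.
  rewrite -(mean_pair_ind _ pP) //; last exact: cR.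
  apply: mean_ext => w wR; congr ((~~ _)%:R * _).
  rewrite rpredDr ?idl_two // rpredN; by case: (x \in _).
rewrite (mean1_ext M HE) mean1D mean1_cst mean1Z; congr (_ + _ * _).
set kap := mean1 M (fun z => G _).
rewrite (mean1_ext M (G' := fun x => (1 - al) * w1 + (al - al ^+ 2) * unif M 2 G ((a + b) * x ^+ 2)
   + (q ^+ rk P)^-1 * kap * (x \notin idl K 1)%:R)); last first.
  move=> x xR; rewrite mean1D; congr (_ + _).
    (* Primitive vectors of [P] see [G] averaged over 2 R, which is constant on even arguments, and
       over 4 R, where only (a + b) x^2 remains. *)
    rewrite -[RHS](mean1_cst K M); apply: mean1_ext => z zR.
    rewrite (planes_distp M2 pP pG (cR _ _ xR zR)) -/al Gw1; last first.
      rewrite cE; apply: rpredD; first by apply: idlMr => //; inR.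
      have -> : 4 * (b * (z ^+ 2 - x * z)) = 2 * (2 * (b * (z ^+ 2 - x * z))) by ring.
      by apply: idl_two; inR.
    congr (_ + _ * _); apply: (per_unif_level pG (ltnW M2)); rewrite ?cR //.
      by inR; apply: idl_ring ab.
    rewrite cE addrC addKr (_ : 4 = 2 ^+ 2 :> K); last by ring.
    by apply: idl2X; inR.
  rewrite mean1Z mulrC; case: (boolP (x \in _)) => hx /=; first by rewrite !mulr0.
  have ux : valunit x by rewrite valunitE xR.
  rewrite !mulr1 mean1Z; congr (_ * _).
  (* For a unit [x] replace z by x z: then x^2 factors out and is absorbed by [Gsq]. What remains is
     multiplied by 4, so modulo 8 both [b] and the sign of z may be replaced by 1. *)
  rewrite -(mean1_unit (u := x) (c := 0) (G := fun z => G (c_ x z))) ?valring0 //.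
    apply: mean1_ext => z zR; rewrite add0r.
    have -> : c_ x (x * z) = x ^+ 2 * (a + b + 4 * (b * (z ^+ 2 - z))) by rewrite cE; ring.
    have bzR : b * (z ^+ 2 - z) \in R by inR.
    rewrite Gsq //; last by apply: valringD; [exact: idl_ring ab|inR].
    apply: pG3.
    - by apply: valringD; [exact: idl_ring ab|inR].
    - by apply: valringD; [exact: idl_ring ab|inR].
    have -> : a + b + 4 * (b * (z ^+ 2 - z)) - (a + b + 4 * (z ^+ 2 + z)) =
      2 ^+ 2 * ((b - 1) * (z ^+ 2 - z) + 2 * (- z)) by ring.
    rewrite (idl_mul2X 2 1); apply: rpredD; last by apply: idl_two; inR.
    by apply: idlMr; [exact: one_mod2P|inR].
  move=> z z' zR z'R zz; apply: pG; rewrite ?cR // !cE.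
  have -> : forall u : K, u + 4 * (b * (z ^+ 2 - x * z)) - (u + 4 * (b * (z' ^+ 2 - x * z'))) =
    (4 * b * (z + z' - x)) * (z - z') by move=> *; ring.
  by apply: idlMl => //; inR.
rewrite !mean1D mean1_cst !mean1Z; congr (_ + _); rewrite planes_sq //.
suff -> : mean1 M (fun x : K => (x \notin idl K 1)%:R) = 1 - q^-1 :> C by rewrite mulrAC.
rewrite (mean1_cond M2 (a := 1)); first last.
- by move=> x _ ->.
- by move=> x y _ _ xy; rewrite (idl_cong (idl_le _ xy)).
rewrite mulr1 (mean1_ext M (G' := fun=> 0)) ?mean1_cst ?mulr0 ?addr0 // => x xR.
by rewrite idl_two.
Qed.

Lemma ztrunc_idl j c : c \in idl K j -> zt j c = t ^+ j * iot.
Proof.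
move=> /idlP[x xR ->]; elim: j => [|j IH]; first by rewrite /= expr0 mul1r.
by rewrite exprS -mulrA ztruncS2 ?IH ?exprS ?mulrA //; inR.
Qed.

Lemma ztrunc1_idl c : c \in idl K 1 -> zt 1 c = t * iot.
Proof. by move/ztrunc_idl; rewrite expr1. Qed.

Section InnerFunction.
Variables (Q1 : qform K) (j : nat).
Hypotheses (hQ : symint Q1) (j2 : (1 < j <= 3)%N).
Local Notation G := (dist M (qfscale (2 ^+ 1) Q1) (zt j)).

Let QR : qmx (qfscale (2 ^+ 1) Q1) \is a mxOver R.
Proof. by case: (symint_scale (valringX 1 (ring_two K)) hQ). Qed.

(** [G] is what Q_0 sees once 2 Q_1 has been integrated out, 4 Q_2 being accounted for by the level
    [j]. This lemma and the next ones supply the hypotheses of [distp_type1] and [distp_type2]. *)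
Lemma inner_per3 : per 3 G.
Proof.
case/andP: j2 => _ j3; apply: per_dist => //; exact: (per_le j3 (@ztrunc_per K C t j)).
Qed.
Lemma inner_perM : per M G. Proof. exact: per_le inner_per3. Qed.

Lemma inner_unit c : c \in R -> c \notin idl K 1 -> G c = 1.
Proof.
move=> cR hc; rewrite -[RHS](mean_cst K M (rk Q1)); apply: mean_ext => x xR.
case: j j2 => // i _; apply: ztrunc_unit; rewrite rpredDr // qeval_scale expr1.
by apply: idl_two; apply: qeval_ring => //; case: hQ.
Qed.

Lemma inner_unif i c : (i <= j)%N -> c \in R -> unif M i G c = dist M (qfscale (2 ^+ 1) Q1) (zt i) c.
Proof.
move=> ij cR; rewrite -dist_unif; apply: dist_ext => // x xR.
by rewrite unif_ztrunc // ij; case/andP: j2 => _ /leq_trans ->.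
Qed.

Lemma inner_unif1 c : c \in idl K 1 -> unif M 1 G c = t * iot.
Proof.
move=> c1; have cR := idl_ring c1.
rewrite inner_unif //; last by case/andP: j2 => /ltnW.
rewrite -(ztrunc1_idl c1); apply: (dist_id M QR (@ztrunc_per K C t 1)) => // x xR.
by rewrite qeval_scale expr1; apply: idl_two; apply: qeval_ring => //; case: hQ.
Qed.

(** Scale the vectors of [Q1] by [u]; the common factor u^2 is a unit and does not change
    valuations. *)
Lemma inner_sq u c : valunit u -> c \in R -> G (u ^+ 2 * c) = G c.
Proof.
move=> uu cR; have uR := unit_ring uu.
have hS := symint_scale (valringX 1 (ring_two K)) hQ.
have u2 : valunit (u ^+ 2) by rewrite expr2 unitM.
have pz : per M (zt j).
  by case/andP: j2 => _ j3; apply: (per_le _ (@ztrunc_per K C t j)); exact: leq_trans j3 _.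
rewrite /dist -[LHS](@mean_bij K C M _ (fun x => u *: x)); first last.
- by apply: perv_qeval => //; inR.
- move=> x y _ _ /mxOverP h; apply/mxOverP => i l; have := h i l.
  by rewrite !mxE -mulrBr unit_idlM.
- by move=> x xR; apply: mxOverZ.
apply: mean_ext => x xR; rewrite qevalZ -mulrDr ztrunc_mulu //.
by apply: valringD => //; apply: qeval_ring.
Qed.

End InnerFunction.

Lemma inner2_normR Q1 c : symint Q1 -> normR Q1 -> c \in R ->
  dist M (qfscale (2 ^+ 1) Q1) (zt 2) c = zt 1 c.
Proof.
move=> hQ nQ cR; rewrite dist_normR2X // ?unif_ztrunc //; last exact: ztrunc_per.
exact: ltnW.
Qed.

Lemma inner2_even Q1 c : symint Q1 -> evenform Q1 -> c \in R ->
  dist M (qfscale (2 ^+ 1) Q1) (zt 2) c = zt 2 c.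
Proof. by move=> hQ eQ cR; rewrite dist_even2X //; exact: ztrunc_per. Qed.

End LocalIntegral.

(** * The trace character and Artin-Schreier means *)

Definition trace_char (K : dyadicField) (C : pzRingType) (x : K) : C := signZ2 C (fieldTr x).
Arguments trace_char {K C} x.

Section Kappa.
Variables (K : dyadicField) (C : numFieldType) (M : nat) (t : C).
Hypothesis M2 : (2 < M)%N.
Implicit Types (P Q : qform K) (G : K -> C).
Local Notation R := (@valring K).
Local Notation k := (resF K).
Local Notation q := ((resq K)%:R : C).
Local Notation sg e := ((-1) ^+ (~~ e) : C).
Hypothesis tq : 1 - t / q != 0.
Local Notation iot := (iota_q K t).
Local Notation zt := (ztrunc (K := K) t).
Local Notation chi := (@trace_char K C).

(** These four properties of the character are established in [trace_char_props]; keeping them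
    abstract separates the computations modulo 8 from the study of the trace of K. *)
Hypothesis chiD : forall x y : K, x \in R -> y \in R -> chi (x + y) = chi x * chi y.
Hypothesis chi_sq : forall x : K, x \in R -> chi (x ^+ 2) = chi x.
Hypothesis chi_even : forall x : K, x \in idl K 1 -> chi x = 1.
Hypothesis chi_nt : exists2 x : K, x \in R & chi x = -1.

Let M0 : (0 < M)%N. Proof. exact: ltn_trans M2. Qed.

Lemma chi_cong x y : x \in R -> y \in R -> x - y \in idl K 1 -> chi x = chi y.
Proof.
by move=> xR yR xy; rewrite -[x in LHS](subrK y x) chiD ?(chi_even xy) ?mul1r //; inR.
Qed.

Lemma chi_per m : (0 < m)%N -> per m chi.
Proof. by move=> m0 x y xR yR xy; apply: chi_cong => //; apply: idl_le xy. Qed.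

Lemma chi_pm x : chi x = 1 \/ chi x = -1.
Proof. by rewrite /trace_char /signZ2; case: ifP; [left|right]. Qed.

Lemma mean_chi : mean1 M chi = 0.
Proof.
have [x0 x0R cx0] := chi_nt.
have : mean1 M chi = - mean1 M chi.
  rewrite -[in LHS](mean1_shift x0R (chi_per M0)) -mulN1r -mean1Z.
  by apply: mean1_ext => x xR; rewrite chiD // cx0.
by move/eqP; rewrite eq_sym eqNr => /eqP.
Qed.

Lemma sum_chi : \sum_(c : k) chi (rlift c) = 0.
Proof.
have := mean_chi; rewrite (mean1_ext M (G' := fun x => (fun c => chi (rlift c)) (redK x))).
  rewrite (mean1_res M0 (fun c => chi (rlift c))) => /eqP.
  by rewrite mulf_eq0 invr_eq0 (negbTE (q_neq0 K C)) => /eqP.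
by move=> x xR; apply: chi_cong; inR; apply/redP; inR; rewrite rliftK.
Qed.

(* Additive Hilbert 90 by counting: the fibre over [c] has at most [1 + chi c] elements, and
   both sides add up to [q]. *)
Lemma artin_schreier_count (c : k) :
  \sum_(z : k) ((z ^+ 2 + z == c)%:R : C) = 1 + chi (rlift c).
Proof.
pose n c := \sum_(z : k) ((z ^+ 2 + z == c)%:R : C); rewrite -/(n c).
have nge c' : 0 <= 1 + chi (rlift c') - n c'.
  case: (pselect (exists z, z ^+ 2 + z == c')) => [[z0 /eqP z0E]|hn].
    have -> : chi (rlift c') = 1.
      rewrite (@chi_cong _ (rlift z0 ^+ 2 + rlift z0)); inR.
        by rewrite chiD ?chi_sq; inR; case: (chi_pm (rlift z0)) => ->; rewrite ?mulrNN mulr1.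
      apply/redP; inR; rewrite rliftK redD ?redX ?rliftK //; inR.
    have -> : n c' = \sum_(z : k) ((z == z0)%:R : C) + \sum_(z : k) ((z == z0 + 1)%:R : C).
      rewrite -big_split /=; apply: eq_bigr => z _.
      have -> : (z ^+ 2 + z == c') = (z == z0) || (z == z0 + 1).
        rewrite -z0E -subr_eq0.
        have -> : z ^+ 2 + z - (z0 ^+ 2 + z0) = (z - z0) * (z - (z0 + 1)) + 2 * (z - z0) * (z0 + 1).
          by ring.
        rewrite (char_residue (dfieldP K)) !mul0r addr0 mulf_eq0 !subr_eq0 //.
      case: (eqVneq z z0) => [->|_]; last by rewrite add0r.
      have -> : (z0 == z0 + 1) = false; last by rewrite addr0.
      by rewrite -subr_eq0 opprD addrA subrr add0r oppr_eq0 oner_eq0.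
    have s1 (b : k) : \sum_(z : k) ((z == b)%:R : C) = 1.
      by rewrite (bigD1 b) //= eqxx big1 ?addr0 // => z /negbTE ->.
    by rewrite !s1 subrr.
  have -> : n c' = 0.
    by rewrite /n big1 // => z _; case: eqP => // h; case: hn; exists z; apply/eqP.
  by rewrite subr0; case: (chi_pm (rlift c')) => ->; rewrite ?subrr // addr_ge0 // ler01.
have s0 : \sum_(c' : k) (1 + chi (rlift c') - n c') = 0.
  rewrite big_split /= big_split /= sum_chi addr0 sumrN sumr_const /n exchange_big /=.
  rewrite (eq_bigr (fun=> 1)) => [|z _]; first by rewrite sumr_const subrr.
  by rewrite (bigD1 (z ^+ 2 + z)) //= eqxx big1 ?addr0 // => i; rewrite eq_sym => /negbTE ->.
have h : 1 + chi (rlift c) - n c = 0 by apply: (psumr_eq0P (fun c' _ => nge c') s0).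
by move/eqP: h; rewrite subr_eq0 => /eqP ->.
Qed.

(** A value e + z^2 + z is even with probability (1 + s) / q, where s is the sign of e, and then
    contributes t iota instead of 1. The case s = 0 occurs as an average over both signs. *)
Definition kap1 (s : C) : C := 1 + (t * iot - 1) * ((1 + s) / q).

Lemma mean_artin_schreier e : e \in R ->
  mean1 M (fun z => zt 1 (e + (z ^+ 2 + z))) = kap1 (chi e).
Proof.
move=> eR.
rewrite (mean1_ext M (G' := fun z => 1 + (t * iot - 1) *
   (fun c => (c ^+ 2 + c == redK e)%:R) (redK z))) => [|z zR].
  rewrite mean1D mean1_cst mean1Z (mean1_res M0 (fun c => (c ^+ 2 + c == redK e)%:R)).
  rewrite artin_schreier_count /kap1 (@chi_cong (rlift (redK e)) e) //.
  - by congr (_ + _ * _); rewrite mulrC.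
  - by inR.
  - by apply/redP; inR; rewrite rliftK.
have -> : ((redK z) ^+ 2 + redK z == redK e) = (e + (z ^+ 2 + z) \in idl K 1).
  have zzR : z ^+ 2 + z \in R by inR.
  apply/eqP/idP => [h|/red0P]; first by apply/red0P; inR; rewrite redD // redD ?redX ?h ?resF_char2; inR.
  rewrite redD //; inR => /(_ (valringD eR zzR))/eqP; rewrite addrC addr_eq0 resF_opp.
  by rewrite redD ?redX; inR => /eqP.
case: (boolP (_ \in _)) => h; first by rewrite ztrunc1_idl // mulr1 addrC subrK.
by rewrite ztrunc_unit // mulr0 addr0.
Qed.

Lemma kap3 c : c \in R -> mean1 M (fun z => zt 3 (2 * (c + 2 * (z ^+ 2 + z)))) =
  if c \in idl K 1 then t ^+ 2 * kap1 (chi (c / 2)) else t.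
Proof.
move=> cR; case: (boolP (c \in _)) => [/idlP[e eR ->]|hc].
  rewrite expr1 [2 * e]mulrC mulfK ?two_neq0 // -mean_artin_schreier // -mean1Z.
  apply: mean1_ext => z zR.
  by rewrite [e * 2]mulrC -mulrDr !ztruncS2 ?mulrA //; inR.
rewrite -[RHS](mean1_cst K M); apply: mean1_ext => z zR.
rewrite ztruncS2 ?ztrunc_unit ?mulr1 //; last by inR.
by rewrite rpredDr //; apply: idl_two; inR.
Qed.

(** The mixture law of [plane_like], doubled: its uniform part averages over 4 R and lowers level 3
    to level 2, its point mass leaves level 3. *)
Lemma inner3_planes e P c : planes e P -> c \in R ->
  dist M (qfscale (2 ^+ 1) P) (zt 3) c =
  (1 - sg e / q ^+ (rk P %/ 2)) * zt 2 c + sg e / q ^+ (rk P %/ 2) * zt 3 c.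
Proof.
move=> pP cR; rewrite dist_scale (planes_dist M2 pP) ?valring0 //; last first.
  by apply: per2X => //; exact: ztrunc_per.
rewrite mulr0 addr0 -(@unif_ztrunc K C M t M2 tq 2 3) //; congr (_ * _ + _).
apply: mean1_ext => y _; congr zt; ring.
Qed.

Lemma mean_sq_ztrunc a c : valunit a -> c \in R ->
  mean1 M (fun y => zt 2 (c + 2 ^+ 1 * (a * y ^+ 2))) = zt 1 c.
Proof.
move=> ua cR; rewrite -(@unif_ztrunc K C M t M2 tq 1 2) //; last exact: ltnW.
have pz : per 1 (fun s => zt 2 (c + 2 ^+ 1 * s)) by apply: per2X => //; exact: ztrunc_per.
rewrite /unif -(mean1_sq M2 ua (valring0 K) pz).
by apply: mean1_ext => y _; rewrite add0r.
Qed.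

(** This is the last mean of [distp_type2], with a + b = 2 c0 and 4 | a + b. In the mixture of
    [inner3_planes], level 2 gives t^2 iota and level 3 an Artin-Schreier mean. *)
Lemma kappa_type0 Q1 e1 c0 : type0 e1 Q1 -> c0 \in idl K 1 ->
  mean1 M (fun z => dist M (qfscale (2 ^+ 1) Q1) (zt 3) (2 * c0 + 4 * (z ^+ 2 + z))) =
  (1 - sg e1 / q ^+ (rk Q1 %/ 2)) * (t ^+ 2 * iot)
  + sg e1 / q ^+ (rk Q1 %/ 2) * (t ^+ 2 * kap1 (chi (c0 / 2))).
Proof.
move=> [P pP QP] hc; have c0R := idl_ring hc; have [uP _ _] := planes_props pP.
rewrite (rk_equiv QP); have := kap3 c0R; rewrite hc => <-.
rewrite -(mean1_cst K M ((1 - _) * _)) -mean1Z -mean1D; apply: mean1_ext => z zR.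
have xR : 2 * c0 + 4 * (z ^+ 2 + z) \in R by inR.
rewrite (dist_scale_equiv _ QP) //; first last.
- exact: per_le (@ztrunc_per K C t 3).
- exact: unimod_symint.
- exact: valringX (ring_two K).
rewrite (inner3_planes pP) // ztrunc_idl.
  by congr (_ + _ * zt _ _); ring.
have -> : 2 * c0 + 4 * (z ^+ 2 + z) = 2 * (c0 + 2 * (z ^+ 2 + z)) by ring.
by rewrite idl_mul2; apply: rpredD => //; apply: idl_two; inR.
Qed.

(** Squaring is bijective modulo 2, so c0 + a y^2 is even only for y congruent to y0, an event of
    mass 1/q. The root y0 is an argument because sigma and phi come from different choices of it. *)
Lemma kappa_type1 Q1 a e1 c0 y0 : type1 a e1 Q1 -> c0 \in R -> y0 \in R ->
  c0 + a * y0 ^+ 2 \in idl K 1 ->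
  mean1 M (fun z => dist M (qfscale (2 ^+ 1) Q1) (zt 3) (2 * c0 + 4 * (z ^+ 2 + z))) =
  (1 - sg e1 / q ^+ ((rk Q1).-1 %/ 2)) * (t * iot)
  + sg e1 / q ^+ ((rk Q1).-1 %/ 2) *
    ((1 - q^-1) * t + q^-1 * (t ^+ 2 * kap1 (chi ((c0 + a * y0 ^+ 2) / 2)))).
Proof.
move=> [a1 [P pP QP]] c0R y0R hy0; have [uP _ _] := planes_props pP.
have ua := one_mod2_unit a1; have aR := unit_ring ua; have hP := unimod_symint uP.
have [_ PR] := hP.
rewrite (rk_equiv QP) /=; set al := sg e1 / _.
transitivity (mean1 M (fun z => (1 - al) * (t * iot) + al *
   mean1 M (fun y => zt 3 (2 * (c0 + a * y ^+ 2 + 2 * (z ^+ 2 + z)))))).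
  apply: mean1_ext => z zR.
  have xR : 2 * c0 + 4 * (z ^+ 2 + z) \in R by inR.
  have x1 : 2 * c0 + 4 * (z ^+ 2 + z) \in idl K 1.
    have -> : 2 * c0 + 4 * (z ^+ 2 + z) = 2 * (c0 + 2 * (z ^+ 2 + z)) by ring.
    by apply: idl_two; inR.
  rewrite (dist_scale_equiv _ QP) //; first last.
  - exact: per_le (@ztrunc_per K C t 3).
  - by apply: symint_add => //; apply: symint_qf1.
  - exact: valringX (ring_two K).
  rewrite dist_scale_add dist_scale dist_qf1.
  rewrite -[X in _ = _ * X + _](ztrunc1_idl t x1) -(mean_sq_ztrunc ua xR) -!mean1Z -mean1D.
  apply: mean1_ext => y yR; rewrite add0r (inner3_planes pP) -/al; last by inR.
  by congr (_ + _ * zt _ _); ring.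
rewrite mean1D mean1_cst mean1Z; congr (_ + _ * _); rewrite mean1_exchange.
rewrite (mean1_ext M (G' := fun y => t + (t ^+ 2 * kap1 (chi ((c0 + a * y0 ^+ 2) / 2)) - t)
   * (y - y0 \in idl K 1)%:R)) => [|y yR].
  by rewrite mean1D mean1_cst mean1Z (mean1_ind_shift _ M2) //; ring.
rewrite kap3; last by inR.
have dE : c0 + a * y ^+ 2 - (c0 + a * y0 ^+ 2) = a * ((y - y0) * (y + y0)) by ring.
have -> : (c0 + a * y ^+ 2 \in idl K 1) = (y - y0 \in idl K 1).
  rewrite -[LHS](rpredDr _ (_ : - (c0 + a * y0 ^+ 2) \in _)) ?rpredN // dE unit_idlM //.
  rewrite idl_prime; inR; rewrite -[X in _ || X](rpredDr _ (_ : - (2 * y0) \in _)) ?rpredN ?idl_two //.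
  by have -> : y + y0 - 2 * y0 = y - y0 by [ring]; rewrite orbb.
case: (boolP (_ \in _)) => hy; last by rewrite mulr0 addr0.
rewrite mulr1 [RHS]addrC subrK; congr (_ * kap1 _).
have h0 : c0 + a * y ^+ 2 \in idl K 1.
  rewrite -(subrK (c0 + a * y0 ^+ 2) (c0 + a * y ^+ 2)) dE rpredD //.
  by apply: idlMl => //; apply: idlMr => //; inR.
move: hy0 h0 => /idlP[e0 e0R E0] /idlP[e eR E]; rewrite !expr1 in E0 E.
(* Here y^2 - y0^2 is divisible by 4, so the argument of the character changes by an even
   element. *)
rewrite E0 E ![2 * _]mulrC !mulfK ?two_neq0 //; apply: chi_cong => //.
rewrite -idl_mul2 mulrBr -E -E0 dE; apply: idlMl => //.
apply: (idlM (m := 1) (n := 1)) => //.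
have -> : y + y0 = (y - y0) + 2 * y0 by ring.
by apply: rpredD => //; apply: idl_two.
Qed.

(** The character is invariant under squaring, which turns y y0 into y^2 y0^2, and y0^2 is c0 modulo
    2. The linear term is thus absorbed into (c0 + c1) y^2, whose character has mean 0 unless c0 +
    c1 is even: this is the condition 4 | a + b + c + d. *)
Lemma mean_chi_quad c0 c1 d y0 : c0 \in R -> c1 \in R -> one_mod2 d -> y0 \in R ->
  c0 + d * y0 ^+ 2 \in idl K 1 ->
  mean1 M (fun y => chi (c1 * y ^+ 2 + d * (y * y0))) = (c0 + c1 \in idl K 1)%:R.
Proof.
move=> c0R c1R d1 y0R hy0; have dR := unit_ring (one_mod2_unit d1).
rewrite (mean1_ext M (G' := fun y => chi (0 + (c0 + c1) * y ^+ 2))) => [|y yR]; last first.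
  rewrite chiD; inR.
  have -> : chi (d * (y * y0)) = chi (c0 * y ^+ 2).
    rewrite (@chi_cong (d * (y * y0)) (y * y0)); inR; last first.
      have -> : d * (y * y0) - y * y0 = (d - 1) * (y * y0) by ring.
      by apply: idlMr; [exact: one_mod2P|inR].
    rewrite -chi_sq; inR; apply: chi_cong; inR.
    have -> : (y * y0) ^+ 2 - c0 * y ^+ 2 =
       y ^+ 2 * (- (c0 + d * y0 ^+ 2) + (d - 1) * y0 ^+ 2 + 2 * y0 ^+ 2) by ring.
    apply: idlMl; inR; apply: rpredD; last by apply: idl_two; inR.
    by apply: rpredD; [rewrite rpredN|apply: idlMr; [exact: one_mod2P|inR]].
  by rewrite -chiD; inR; congr chi; ring.
case: (boolP (_ \in _)) => h.
  rewrite -[RHS](mean1_cst K M); apply: mean1_ext => y yR; apply: chi_even.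
  by rewrite add0r idlMr //; inR.
have u : valunit (c0 + c1) by rewrite valunitE h andbT; inR.
by rewrite (mean1_sq M2 u (valring0 K) (@chi_per 1 _)) // mean_chi.
Qed.

(** Of the two odd squares in [Q1], one fixes a coordinate modulo 2 as in [kappa_type1]; the other
    is free and averages the character, which either survives unchanged or disappears. *)
Lemma kappa_type2 Q1 a d e1 c0 c1 y0 : type2 a d e1 Q1 -> c0 \in R -> c1 \in R ->
  a + d = 2 * c1 -> y0 \in R -> c0 + d * y0 ^+ 2 \in idl K 1 ->
  mean1 M (fun z => dist M (qfscale (2 ^+ 1) Q1) (zt 3) (2 * c0 + 4 * (z ^+ 2 + z))) =
  (1 - sg e1 / q ^+ ((rk Q1).-2 %/ 2)) * (t * iot)
  + sg e1 / q ^+ ((rk Q1).-2 %/ 2) *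
    ((1 - q^-1) * t + q^-1 * (t ^+ 2 *
      kap1 ((c0 + c1 \in idl K 1)%:R * chi ((c0 + d * y0 ^+ 2) / 2)))).
Proof.
move=> [a1 d1 [P pP QP]] c0R c1R adE y0R hy0; have [uP _ _] := planes_props pP.
have ua := one_mod2_unit a1; have aR := unit_ring ua; have hP := unimod_symint uP.
have ud := one_mod2_unit d1; have dR := unit_ring ud.
have [_ PR] := hP.
rewrite (rk_equiv QP) /= -/(rk P); set al := sg e1 / _.
transitivity (mean1 M (fun z => (1 - al) * (t * iot) + al *
   mean1 M (fun y => mean1 M (fun y' =>
     zt 3 (2 * (c0 + a * y ^+ 2 + d * y' ^+ 2 + 2 * (z ^+ 2 + z))))))).
  apply: mean1_ext => z zR.
  have xR : 2 * c0 + 4 * (z ^+ 2 + z) \in R by inR.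
  have x1 y : y \in R -> 2 * c0 + 4 * (z ^+ 2 + z) + 2 ^+ 1 * (a * y ^+ 2) \in idl K 1.
    move=> yR; have -> : 2 * c0 + 4 * (z ^+ 2 + z) + 2 ^+ 1 * (a * y ^+ 2) =
      2 * (c0 + 2 * (z ^+ 2 + z) + a * y ^+ 2) by ring.
    by apply: idl_two; inR.
  rewrite (dist_scale_equiv _ QP) //; first last.
  - exact: per_le (@ztrunc_per K C t 3).
  - by apply: symint_add; [apply: symint_qf1|apply: symint_add => //; apply: symint_qf1].
  - exact: valringX (ring_two K).
  rewrite dist_scale_add dist_scale dist_qf1 -(mean1_cst K M ((1 - al) * _)) -mean1Z -mean1D.
  apply: mean1_ext => y yR; rewrite add0r dist_scale_add dist_scale dist_qf1.
  have x1R := idl_ring (x1 y yR).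
  rewrite -[X in _ = _ * X + _](ztrunc1_idl t (x1 y yR)) -(mean_sq_ztrunc ud x1R) -!mean1Z -mean1D.
  apply: mean1_ext => y' y'R; rewrite add0r (inner3_planes pP) -/al; last by inR.
  by congr (_ + _ * zt _ _); ring.
rewrite mean1D mean1_cst mean1Z; congr (_ + _ * _).
rewrite mean1_exchange.
transitivity (mean1 M (fun y => t + (t ^+ 2 *
   kap1 (chi ((c0 + d * y0 ^+ 2) / 2) * chi (c1 * y ^+ 2 + d * (y * y0))) - t) * q^-1)).
  apply: mean1_ext => y yR; rewrite mean1_exchange -(mean1_ind_shift C M2 y0R).
  have pG y' : y' \in R -> per M (fun y' => mean1 M (fun z => zt 3 (2 * (c0 + a * y ^+ 2 + d * y' ^+ 2 + 2 * (z ^+ 2 + z))))).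
    move=> _ u v uR vR uv; apply: mean1_ext => z zR.
    apply: (per_le M2 (@ztrunc_per K C t 3)); inR.
    have -> : 2 * (c0 + a * y ^+ 2 + d * u ^+ 2 + 2 * (z ^+ 2 + z)) -
        2 * (c0 + a * y ^+ 2 + d * v ^+ 2 + 2 * (z ^+ 2 + z)) = (2 * d * (u + v)) * (u - v) by ring.
    by apply: idlMl => //; inR.
  (* Substitute y' = y + w: since a + d = 2 c1, the two squares become d w^2 + 2 (c1 y^2 + d y w),
     and evenness forces w to be y0 modulo 2. *)
  rewrite -(mean1_shift yR (pG y yR)) -mean1Z -[X in _ = X + _](mean1_cst K M) -mean1D; apply: mean1_ext => w wR.
  rewrite kap3; last by inR.
  have dE : c0 + a * y ^+ 2 + d * (y + w) ^+ 2 =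
    2 * (c1 * y ^+ 2 + d * (y * w)) + (c0 + d * w ^+ 2).
    by transitivity (c0 + (a + d) * y ^+ 2 + 2 * d * (y * w) + d * w ^+ 2); [ring|rewrite adE; ring].
  have wE : c0 + d * w ^+ 2 - (c0 + d * y0 ^+ 2) = d * ((w - y0) * (w + y0)) by ring.
  have -> : (c0 + a * y ^+ 2 + d * (y + w) ^+ 2 \in idl K 1) = (w - y0 \in idl K 1).
    rewrite dE rpredDl; last by apply: idl_two; inR.
    rewrite -[LHS](rpredDr _ (_ : - (c0 + d * y0 ^+ 2) \in _)) ?rpredN // wE unit_idlM //.
    rewrite idl_prime; inR; rewrite -[X in _ || X](rpredDr _ (_ : - (2 * y0) \in _)) ?rpredN ?idl_two //.
    by have -> : w + y0 - 2 * y0 = w - y0 by [ring]; rewrite orbb.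
  case: (boolP (_ \in _)) => hw; last by rewrite mulr0 addr0.
  rewrite mulr1 [RHS]addrC subrK; congr (_ * kap1 _).
  have h0 : c0 + d * w ^+ 2 \in idl K 1.
    rewrite -(subrK (c0 + d * y0 ^+ 2) (c0 + d * w ^+ 2)) wE rpredD //.
    by apply: idlMl => //; apply: idlMr => //; inR.
  rewrite dE; move: hy0 h0 => /idlP[e0 e0R E0] /idlP[e eR E]; rewrite !expr1 in E0 E.
  rewrite E0 E -mulrDr ![2 * _]mulrC !mulfK ?two_neq0 // -chiD; inR; apply: chi_cong; inR.
  have -> : c1 * y ^+ 2 + d * (y * w) + e - (e0 + (c1 * y ^+ 2 + d * (y * y0))) =
    d * y * (w - y0) + (e - e0) by ring.
  apply: rpredD; first by apply: idlMl => //; inR.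
  rewrite -idl_mul2 mulrBr -E -E0 wE; apply: idlMl => //.
  apply: (idlM (m := 1) (n := 1)) => //.
  have -> : w + y0 = (w - y0) + 2 * y0 by ring.
  by apply: rpredD => //; apply: idl_two.
(* [kap1] is affine in the sign, so the mean over y acts on the character alone. *)
rewrite (mean1_ext M (G' := fun y => (t + (t ^+ 2 * kap1 0 - t) * q^-1) +
   (t ^+ 2 * (t * iot - 1) / q * chi ((c0 + d * y0 ^+ 2) / 2) * q^-1) *
    chi (c1 * y ^+ 2 + d * (y * y0)))) => [|y _]; last by rewrite /kap1; ring.
rewrite mean1D mean1_cst mean1Z (mean_chi_quad c0R c1R d1 y0R hy0) /kap1; ring.
Qed.

End Kappa.

(** * Types of forms under equivalence, and square roots as powers *)

Section EquivalenceFacts.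
Variable K : dyadicField.
Implicit Types (P Q : qform K).
Local Notation R := (@valring K).

Lemma qequiv_sym P Q : qequiv P Q -> qequiv Q P.
Proof.
move=> [U [V [UR VR UV VU e]]]; exists V, U; split=> //.
by rewrite -e !mulmxA VU mul1mx -mulmxA -trmx_mul VU trmx1 mulmx1.
Qed.

Lemma even_equiv P Q : qequiv P Q -> symint Q -> evenform Q -> evenform P.
Proof.
move=> [U [V [UR _ _ _ e]]] hQ eQ i.
have -> : qmx P i i = qeval (row i U).
  by rewrite -e /qeval -row_mul !mxE; apply: eq_bigr => j _; rewrite !mxE.
by apply: qeval_even => //; apply/mxOverP => a b; rewrite mxE; apply/mxOverP.
Qed.

Lemma type0_even e Q : type0 e Q -> evenform Q.
Proof.
move=> [P pP QP]; have [uP eP _] := planes_props pP.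
exact: even_equiv QP (unimod_symint uP) eP.
Qed.

Lemma type1_normR a e Q : unimodular Q -> type1 a e Q -> normR Q.
Proof.
move=> uQ [a1 [P pP QP]]; have hQ := unimod_symint uQ; apply: contrapT => /(not_normRP hQ) eQ.
have := even_equiv (qequiv_sym QP) hQ eQ (lshift _ 0); rewrite /= block_mxEul mxE eqxx.
by have := one_mod2_unit a1; rewrite valunitE => /andP[_ /negbTE ->].
Qed.

Lemma type2_normR a b e Q : unimodular Q -> type2 a b e Q -> normR Q.
Proof.
move=> uQ [a1 b1 [P pP QP]]; have hQ := unimod_symint uQ; apply: contrapT => /(not_normRP hQ) eQ.
have := even_equiv (qequiv_sym QP) hQ eQ (lshift _ 0); rewrite /= block_mxEul mxE eqxx.
by have := one_mod2_unit a1; rewrite valunitE => /andP[_ /negbTE ->].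
Qed.

Lemma type0_rk e Q : type0 e Q -> exists m, rk Q = m.*2.
Proof. by move=> [P pP /rk_equiv ->]; have [_ _ ->] := planes_props pP; eexists. Qed.
Lemma type1_rk a e Q : type1 a e Q -> exists m, rk Q = m.*2.+1.
Proof. by move=> [_ [P pP /rk_equiv ->]]; have [_ _ /= ->] := planes_props pP; eexists. Qed.
Lemma type2_rk a b e Q : type2 a b e Q -> exists m, rk Q = m.*2.+2.
Proof. by move=> [_ _ [P pP /rk_equiv ->]]; have [_ _ /= ->] := planes_props pP; eexists. Qed.

(** Translating the sum of all residues by 1 shows q = 0 in the residue field; as 2 = 0 there, an
    odd q would give 1 = 0. *)
Lemma resq_even : (resq K = (resq K %/ 2) * 2)%N.
Proof.
have h : ((resq K)%:R : resF K) = 0.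
  have : \sum_(x : resF K) x = \sum_(x : resF K) (x + 1).
    by rewrite (reindex_inj (addIr 1)).
  rewrite big_split /= sumr_const => /eqP; rewrite -subr_eq0 opprD addrA subrr add0r.
  by rewrite oppr_eq0 => /eqP.
have odd0 : odd (resq K) = false.
  apply/negbTE/negP => o; move: h; rewrite -[resq K]odd_double_half o -muln2 natrD natrM.
  by rewrite (char_residue (dfieldP K)) mulr0 addr0 => /eqP; rewrite oner_eq0.
by rewrite muln2 divn2 -[LHS]odd_double_half odd0.
Qed.

(** z^(q/2) is an explicit square root of z modulo 2 whose square is z^q on the nose: the origin of
    the q-th powers in phi and psi. *)
Lemma power_resq (z : K) : z \in R ->
  [/\ z ^+ (resq K %/ 2) \in R, (z ^+ (resq K %/ 2)) ^+ 2 = z ^+ resq K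
    & z ^+ resq K - z \in idl K 1].
Proof.
move=> zR; split; [by inR|by rewrite -exprM -resq_even|].
by apply/redP; inR; rewrite redX // expf_card.
Qed.

End EquivalenceFacts.

(** * Rational identities behind the values of I *)

Section RationalIdentities.
Variables (F : fieldType) (q t X Y s0 s1 s : F).
Hypotheses (q0 : q != 0) (qt : q - t != 0) (X0 : X != 0) (Y0 : Y != 0).
Let io := (1 - q^-1) / (1 - t / q).
(** The right-hand side of [local_type2] with al = s0 / X. Here X = q^m and Y = q^m' when the plane
    parts of Q_0 and Q_1 have ranks 2m and 2m', so that q^(r_0) is q (q X^2). *)
Let W g k := (1 - q^-1) + q^-1 * ((1 - s0 / X) * (t * io)
    + (s0 / X - (X ^+ 2)^-1) * g + (X ^+ 2)^-1 * (1 - q^-1) * k).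

(** Rewriting 1 - 1/q in this way makes both sides of each identity multiples of [io], which can
    then be cleared and treated as an indeterminate by [field]. *)
Let ioE : 1 - q^-1 = io * (1 - t / q).
Proof.
have h : 1 - t / q != 0.
  have -> : 1 - t / q = (q - t) / q by field.
  by rewrite mulf_neq0 ?invr_eq0.
by rewrite /io divfK.
Qed.

Let k1E : (1 - q^-1) * (1 + (t * io - 1) * ((1 + s) / q)) =
  io * (1 - q^-1 + s / q * (t - 1)).
Proof.
transitivity ((1 - q^-1) + ((1 - q^-1) * (t * io) - (1 - q^-1)) * ((1 + s) / q)); first by ring.
by rewrite {1 3}ioE; ring.
Qed.

Lemma alg_C1 : W (t ^+ 2 * io) ((1 - s1 / Y) * (t ^+ 2 * io)
      + s1 / Y * (t ^+ 2 * (1 + (t * io - 1) * ((1 + s) / q)))) =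
  (1 - t ^+ 2 / (q * (q * X ^+ 2)) + s0 * ((t ^+ 2 - t) / (q * X))
   + s1 * (s * (t ^+ 3 - t ^+ 2) / (q * (q * X ^+ 2) * Y))) * io.
Proof.
transitivity (io * (1 - t / q) + q^-1 * ((1 - s0 / X) * (t * io)
    + (s0 / X - (X ^+ 2)^-1) * (t ^+ 2 * io) + (X ^+ 2)^-1 * ((1 - q^-1) * (1 - s1 / Y) * (t ^+ 2 * io)
  + s1 / Y * t ^+ 2 * (io * (1 - q^-1 + s / q * (t - 1)))))).
  by rewrite -k1E -ioE /W; ring.
by clearbody io; field; rewrite ?q0 ?X0 ?Y0.
Qed.

Lemma alg_C2 : W (t ^+ 2 * io) (t ^+ 2 * io) =
  (1 - t ^+ 2 / (q * (q * X ^+ 2)) + s0 * ((t ^+ 2 - t) / (q * X))) * io.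
Proof. by rewrite /W {1}ioE; clearbody io; field; rewrite ?q0 ?X0. Qed.

(** Serves all cases with Q_1 of norm R and Q_2 not, the absence of a sign being s = 0. Both (r_1 +
    1)/2 for one odd square and r_1/2 for two are m' + 1, whence q Y. *)
Lemma alg_C3 : W (t * io) ((1 - s1 / Y) * (t * io) + s1 / Y * ((1 - q^-1) * t
    + q^-1 * (t ^+ 2 * (1 + (t * io - 1) * ((1 + s) / q))))) =
  (1 - t / (q * (q * X ^+ 2)) + s1 * (s * (t ^+ 3 - t ^+ 2) / (q * (q * X ^+ 2) * (q * Y)))) * io.
Proof.
transitivity (io * (1 - t / q) + q^-1 * ((1 - s0 / X) * (t * io)
    + (s0 / X - (X ^+ 2)^-1) * (t * io) + (X ^+ 2)^-1 * ((1 - q^-1) * (1 - s1 / Y) * (t * io)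
  + s1 / Y * ((1 - q^-1) * (io * (1 - t / q)) * t + q^-1 * t ^+ 2 * (io * (1 - q^-1 + s / q * (t - 1))))))).
  by rewrite -k1E -ioE /W; ring.
by clearbody io; field; rewrite ?q0 ?X0 ?Y0.
Qed.

Lemma alg_C6 : W (t * io) (t * io) = (1 - t / (q * (q * X ^+ 2))) * io.
Proof. by rewrite /W {1}ioE; clearbody io; field; rewrite ?q0 ?X0. Qed.

Lemma alg_D1 : W (t * io) t = (1 - t ^+ 2 / (q * (q * X ^+ 2))) * io.
Proof.
transitivity (io * (1 - t / q) + q^-1 * ((1 - s0 / X) * (t * io)
    + (s0 / X - (X ^+ 2)^-1) * (t * io) + (X ^+ 2)^-1 * (io * (1 - t / q) * t))).
  by rewrite -ioE /W; ring.
by clearbody io; field; rewrite ?q0 ?X0.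
Qed.

End RationalIdentities.

Lemma half_double m : (m.*2 %/ 2 = m)%N.
Proof. by rewrite -muln2 mulnK. Qed.
Lemma half_doubleS m : (m.*2.+1.-1 %/ 2 = m)%N.
Proof. exact: half_double. Qed.
Lemma half_doubleSS m : (m.*2.+2.-2 %/ 2 = m)%N.
Proof. exact: half_double. Qed.
Lemma half_double2 m : (m.*2.+2 %/ 2 = m.+1)%N.
Proof. exact: (half_double m.+1). Qed.
Definition halfE := (half_doubleSS, half_doubleS, half_double2, half_double).

(** * Evaluation of I, case by case *)

Section Core.
Variables (K : dyadicField) (C : numFieldType) (M : nat) (t : C).
Hypothesis M2 : (2 < M)%N.
Implicit Types (P Q : qform K) (G : K -> C).
Local Notation R := (@valring K).
Local Notation k := (resF K).
Local Notation q := ((resq K)%:R : C).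
Local Notation sg e := ((-1) ^+ (~~ e) : C).
Hypothesis tq : 1 - t / q != 0.
Local Notation iot := (iota_q K t).
Local Notation zt := (ztrunc (K := K) t).
Local Notation chi := (@trace_char K C).

Hypothesis chiD : forall x y : K, x \in R -> y \in R -> chi (x + y) = chi x * chi y.
Hypothesis chi_sq : forall x : K, x \in R -> chi (x ^+ 2) = chi x.
Hypothesis chi_even : forall x : K, x \in idl K 1 -> chi x = 1.
Hypothesis chi_nt : exists2 x : K, x \in R & chi x = -1.

Local Notation chi_cong := (chi_cong chiD chi_even).

Section Fixed.
Variables (Q0 Q1 : qform K) (i : nat).
Hypotheses (hQ1 : symint Q1) (i2 : (1 < i <= 3)%N).
Local Notation G j := (dist M (qfscale (2 ^+ 1) Q1) (zt j)).

Let unif2 c : c \in R -> unif M 2 (G i) c = G 2 c.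
Proof. by move=> cR; rewrite inner_unif //; case/andP: i2. Qed.

Lemma local_type0 e : type0 e Q0 ->
  let al := sg e / q ^+ (rk Q0 %/ 2) in
  distp M Q0 (G i) 0 = (1 - al) * (t * iot) + (al - al ^+ 2) * G 2 0.
Proof.
move=> [P pP QP] /=; have [uP _ _] := planes_props pP; have pG := inner_perM t M2 hQ1 i2.
rewrite (rk_equiv QP) (distp_equiv M2 QP) ?valring0 //; last exact: unimod_symint.
by rewrite (planes_distp M2 pP) ?valring0 // inner_unif1 // ?unif2 ?valring0 // rpred0.
Qed.

Lemma local_type1 a e : type1 a e Q0 ->
  let al := sg e / q ^+ ((rk Q0).-1 %/ 2) in
  distp M Q0 (G i) 0 = (1 - q^-1) + q^-1 * ((1 - al) * (t * iot) + (al - al ^+ 2) * G 2 0).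
Proof.
move=> [a1 [P pP QP]] /=; have [uP _ _] := planes_props pP; have pG := inner_perM t M2 hQ1 i2.
have ua := one_mod2_unit a1; have aR := unit_ring ua.
rewrite (rk_equiv QP) /= (distp_equiv M2 QP) ?valring0 //; last first.
  by apply: symint_add; [exact: symint_qf1|exact: unimod_symint].
rewrite (distp_type1 M2 pP ua pG (inner_unit M t hQ1 i2)); congr (_ + _ * _).
rewrite -[RHS](mean1_cst K M); apply: mean1_ext => z zR.
have c2 : 4 * (a * z ^+ 2) \in idl K 2.
  by rewrite (_ : 4 = 2 ^+ 2 :> K); [apply: idl2X; inR|ring].
rewrite (planes_distp M2 pP pG) ?(idl_ring c2) // (inner_unif1 M2 tq hQ1 i2) ?(idl_le _ c2) //.
congr (_ + _ * _); rewrite -unif2 ?valring0 //.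
by apply: (per_unif_level pG (ltnW M2)); rewrite ?valring0 ?(idl_ring c2) // subr0.
Qed.

Lemma local_type2 a b e : type2 a b e Q0 ->
  let al := sg e / q ^+ ((rk Q0).-2 %/ 2) in
  distp M Q0 (G i) 0 = (1 - q^-1) + q^-1 * ((1 - al) * (t * iot)
    + (al - al ^+ 2) * mean1 M (fun x => G 2 ((a + b) * x ^+ 2))
    + al ^+ 2 * (1 - q^-1) * mean1 M (fun z => G i ((a + b) + 4 * (z ^+ 2 + z)))).
Proof.
move=> [a1 b1 [P pP QP]] /=; have [uP _ _] := planes_props pP; have pG := inner_perM t M2 hQ1 i2.
have ua := one_mod2_unit a1; have aR := unit_ring ua.
have ub := one_mod2_unit b1; have bR := unit_ring ub.
rewrite (rk_equiv QP) /= (distp_equiv M2 QP) ?valring0 //; last first.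
  by apply: symint_add; [exact: symint_qf1|apply: symint_add; [exact: symint_qf1|exact: unimod_symint]].
rewrite (distp_type2 (w1 := t * iot) M2 pP a1 b1 (inner_per3 M t hQ1 i2) (inner_unit M t hQ1 i2)
  (inner_unif1 M2 tq hQ1 i2)); last by move=> u c; exact: inner_sq.
congr (_ + _ * (_ + _ * _ + _)); apply: mean1_ext => x xR; rewrite unif2 //; inR.
Qed.

Lemma half_sum a b e : type2 a b e Q0 ->
  exists2 c0, c0 \in R & a + b = 2 * c0.
Proof.
move=> [a1 b1 _]; have h : a + b \in idl K 1.
  have -> : a + b = (a - 1) + (b - 1) + 2 * 1 by ring.
  by apply: rpredD; [apply: rpredD; exact: one_mod2P|exact/idl_two/valring1].
by have [c cR ->] := idlP _ _ h; exists c; rewrite ?expr1.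
Qed.

End Fixed.

Lemma zt2_zero : zt 2 0 = t ^+ 2 * iot. Proof. by apply: ztrunc_idl; rewrite rpred0. Qed.

(** With c0 = 2 e the argument of sigma is e / a, congruent to e because a is 1 modulo 2. *)
Lemma sigmaE a b c0 : one_mod2 a -> a + b = 2 * c0 -> c0 \in idl K 1 ->
  sigma_sign C a b = chi (c0 / 2).
Proof.
move=> a1 abE /idlP[e eR cE]; have ua := one_mod2_unit a1; rewrite expr1 in cE.
have a0 := unit_neq0 ua; have n2 := two_neq0 K.
rewrite /sigma_sign -[LHS]/(chi _) abE cE.
have -> : 2 * (2 * e) / (4 * a) = e / a.
  by field; rewrite a0 (_ : 4 = 2 * 2 :> K) ?mulf_neq0 //; ring.
have -> : 2 * e / 2 = e by field.
have aV := unitVring ua.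
apply: chi_cong; inR; have -> : e / a - e = - (e / a * (a - 1)) by field.
by rewrite rpredN; apply: idlMl; [inR|exact: one_mod2P].
Qed.

(** Eliminating d by c + d = 2 c1, the two arguments differ by (c - c1) c1^q, which is c1^2 + c1
    modulo 2; the character is 1 there, being invariant under squaring. *)
Lemma psiE a b c d c0 c1 : one_mod2 c -> one_mod2 d -> a + b = 2 * c0 -> c + d = 2 * c1 ->
  c0 \in R -> c1 \in R -> c0 + d * c1 ^+ resq K \in idl K 1 ->
  psi_sign C a b c d = chi ((c0 + d * c1 ^+ resq K) / 2).
Proof.
move=> h1 d1 abE cdE c0R c1R /idlP[X XR XE]; rewrite expr1 in XE.
have uc := one_mod2_unit h1; have cn0 := unit_neq0 uc; have n2 := two_neq0 K.
have cR := unit_ring uc; have dR := unit_ring (one_mod2_unit d1).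
have [_ _ hq] := power_resq c1R.
rewrite /psi_sign -[LHS]/(chi _) abE cdE XE.
have -> : 2 * X / 2 = X by field.
have -> : 2 * c1 / 2 = c1 by field.
have dE : d = 2 * c1 - c by rewrite -cdE; ring.
have -> : c / 2 * (c1 ^+ resq K + 2 * c0 / (2 * c)) = X + (c - c1) * c1 ^+ resq K.
  have -> : X = (c0 + d * c1 ^+ resq K) / 2 by rewrite XE; field.
  by rewrite dE; field; rewrite ?cn0 ?n2.
rewrite chiD; inR; rewrite (_ : chi ((c - c1) * _) = 1) ?mulr1 //.
have <- : chi (c1 ^+ 2 + c1) = 1.
  by rewrite chiD ?chi_sq; inR; case: (chi_pm C c1) => ->; rewrite ?mulrNN mulr1.
apply: chi_cong; inR.
have -> : (c - c1) * c1 ^+ resq K - (c1 ^+ 2 + c1) =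
  (c - c1) * (c1 ^+ resq K - c1) + (c - 1) * c1 + 2 * (- c1 ^+ 2) by ring.
apply: rpredD; last by apply: idl_two; inR.
by apply: rpredD; [apply: idlMl => //; inR|apply: idlMr => //; exact: one_mod2P].
Qed.

(** The level [i] is what 4 Q_2 leaves of level 3. The left side does not mention the presentation
    recorded in [Ival], so all presentations share one value. The bullets follow the order of the
    constructors. *)
Lemma local_integral Q0 Q1 Q2 z i : unimodular Q0 -> unimodular Q1 -> Ival t Q0 Q1 Q2 z ->
  (normR Q2 /\ i = 2%N) \/ (~ normR Q2 /\ i = 3%N) ->
  distp M Q0 (dist M (qfscale (2 ^+ 1) Q1) (zt i)) 0 = z.
Proof.
move=> u0 u1 Iz hi; have hQ1 := unimod_symint u1.
have i2 : (1 < i <= 3)%N by case: hi => -[_ ->].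
have q0 := q_neq0 K C; have Xn0 m : q ^+ m != 0 by rewrite expf_neq0.
have qt : q - t != 0.
  apply: contraNneq tq => h; have -> : 1 - t / q = (q - t) / q by field.
  by rewrite h mul0r.
have dbl m : q ^+ m.*2 = (q ^+ m) ^+ 2 by rewrite -muln2 exprM.
have E1 m : q ^+ m.+1 = q * q ^+ m by rewrite exprS.
have E2 m : q ^+ m.*2.+2 = q * (q * (q ^+ m) ^+ 2) by rewrite !E1 dbl.
(* The names in G are level 2 means of the inner function; those in k are the last means of
   [distp_type2] in the cases without a character. *)
have G0n : normR Q1 -> dist M (qfscale (2 ^+ 1) Q1) (zt 2) 0 = t * iot.
  by move=> n1; rewrite inner2_normR ?valring0 // ztrunc1_idl // rpred0.
have G0e : evenform Q1 -> dist M (qfscale (2 ^+ 1) Q1) (zt 2) 0 = t ^+ 2 * iot.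
  by move=> n1; rewrite inner2_even ?valring0 // zt2_zero.
have Gxn a b e : type2 a b e Q0 -> normR Q1 ->
    mean1 M (fun x => dist M (qfscale (2 ^+ 1) Q1) (zt 2) ((a + b) * x ^+ 2)) = t * iot.
  move=> t2 n1; have [c0 c0R ->] := half_sum t2; rewrite -[RHS](mean1_cst K M).
  apply: mean1_ext => x xR; rewrite inner2_normR ?ztrunc1_idl //; inR.
  by rewrite -mulrA; apply: idl_two; inR.
have Gxe4 a b : a + b \in idl K 2 -> evenform Q1 ->
    mean1 M (fun x => dist M (qfscale (2 ^+ 1) Q1) (zt 2) ((a + b) * x ^+ 2)) = t ^+ 2 * iot.
  move=> ab e1; rewrite -[RHS](mean1_cst K M); apply: mean1_ext => x xR.
  have h : (a + b) * x ^+ 2 \in idl K 2 by apply: idlMr => //; inR.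
  by rewrite inner2_even ?ztrunc_idl ?(idl_ring h).
(* Here a + b is twice a unit, so (a + b) x^2 equidistributes on 2 R modulo 4. *)
have Gxe2 a b e : type2 a b e Q0 -> a + b \notin idl K 2 -> evenform Q1 ->
    mean1 M (fun x => dist M (qfscale (2 ^+ 1) Q1) (zt 2) ((a + b) * x ^+ 2)) = t * iot.
  move=> t2; have [c0 c0R ->] := half_sum t2; rewrite idl_mul2 => hc e1.
  have uc : valunit c0 by rewrite valunitE c0R.
  rewrite -(ztrunc1_idl t (rpred0 (idl K 1))) -(mean_sq_ztrunc M2 tq uc (valring0 K)).
  by apply: mean1_ext => x xR; rewrite add0r expr1 -mulrA inner2_even //; inR.
have k2n a b e : type2 a b e Q0 -> normR Q1 -> i = 2%N ->
    mean1 M (fun z => dist M (qfscale (2 ^+ 1) Q1) (zt i) (a + b + 4 * (z ^+ 2 + z))) = t * iot.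
  move=> t2 n1 ->; have [c0 c0R ->] := half_sum t2; rewrite -[RHS](mean1_cst K M).
  apply: mean1_ext => x xR.
  have h : 2 * c0 + 4 * (x ^+ 2 + x) \in idl K 1.
    rewrite (_ : _ + _ = 2 * (c0 + 2 * (x ^+ 2 + x))); last by ring.
    by apply: idl_two; inR.
  by rewrite inner2_normR ?ztrunc1_idl ?(idl_ring h).
have k2e a b : a + b \in idl K 2 -> evenform Q1 -> i = 2%N ->
    mean1 M (fun z => dist M (qfscale (2 ^+ 1) Q1) (zt i) (a + b + 4 * (z ^+ 2 + z))) = t ^+ 2 * iot.
  move=> ab e1 ->; rewrite -[RHS](mean1_cst K M); apply: mean1_ext => x xR.
  have h : a + b + 4 * (x ^+ 2 + x) \in idl K 2.
    by apply: rpredD => //; rewrite (_ : 4 = 2 ^+ 2 :> K); [apply: idl2X; inR|ring].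
  by rewrite inner2_even ?ztrunc_idl ?(idl_ring h).
(* Twice a unit plus multiples of 4: the valuation is 1 at either level. *)
have kodd a b e : type2 a b e Q0 -> a + b \notin idl K 2 -> evenform Q1 ->
    mean1 M (fun z => dist M (qfscale (2 ^+ 1) Q1) (zt i) (a + b + 4 * (z ^+ 2 + z))) = t.
  move=> t2; have [c0 c0R ->] := half_sum t2; rewrite idl_mul2 => hc e1.
  rewrite -[RHS](mean1_cst K M); apply: mean1_ext => x xR.
  rewrite -[RHS](mean_cst K M (rk Q1)); apply: mean_ext => y yR.
  rewrite qeval_scale expr1; move: (qeval _) (qeval_even hQ1 e1 yR) => h yE.
  have hR := idl_ring yE.
  have -> : 2 * c0 + 4 * (x ^+ 2 + x) + 2 * h = 2 * (c0 + (2 * (x ^+ 2 + x) + h)) by ring.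
  have [j ->] : exists j, i = j.+2 by case/andP: i2; case: (i) => [|[|j]] // _ _; exists j.
  rewrite ztruncS2; last by inR.
  rewrite ztrunc_unit ?mulr1 // rpredDr // rpredD //; apply: idl_two; inR.
have iE (j : nat) : j = i -> i = j by [].
have not2 : normR Q2 -> i = 2%N by case: hi => -[].
have not3 : ~ normR Q2 -> i = 3%N by case: hi => -[].
case: Iz => {z}.
- move=> e0 t0 n1; rewrite (local_type0 hQ1 i2 t0).
  rewrite (G0e (proj1 (not_normRP hQ1) n1)); ring.
- move=> e0 t0 n1; rewrite (local_type0 hQ1 i2 t0) G0n //; have [m ->] := type0_rk t0.
  rewrite -muln2 mulnK // exprM !exprMn sqrr_sign; field; exact: Xn0.
- move=> a e0 t0 n1; rewrite (local_type1 hQ1 i2 t0) (G0e (proj1 (not_normRP hQ1) n1)).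
  have [m ->] := type1_rk t0; rewrite ?halfE ?exprMn ?sqrr_sign ?exprS ?dbl /iota_q.
  by field; rewrite ?q0 ?qt ?Xn0.
- move=> a e0 t0 n1; rewrite (local_type1 hQ1 i2 t0) G0n //.
  have [m ->] := type1_rk t0; rewrite ?halfE ?exprMn ?sqrr_sign ?exprS ?dbl /iota_q.
  by field; rewrite ?q0 ?qt ?Xn0.
- move=> a b e0 e1 t0 d4 t1 n2; have a1 : one_mod2 a by case: t0.
  have [c0 c0R abE] := half_sum t0; rewrite dvdR4 in d4.
  have hc : c0 \in idl K 1 by move: d4; rewrite abE idl_mul2.
  have ev := type0_even t1; rewrite (local_type2 hQ1 i2 t0) Gxe4 // (not3 n2) abE.
  rewrite (kappa_type0 M2 tq chiD chi_sq chi_even chi_nt t1 hc) (sigmaE a1 abE hc).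
  have [m ->] := type2_rk t0; have [m' ->] := type0_rk t1.
  rewrite ?halfE ?exprMn ?sqrr_sign ?mul1r ?exprVn ?exprD ?E2 ?E1 /kap1.
  exact: alg_C1.
- move=> a b e0 t0 d4 n1 n2; rewrite dvdR4 in d4; have e1 := proj1 (not_normRP hQ1) n1.
  rewrite (local_type2 hQ1 i2 t0) Gxe4 // k2e ?not2 //.
  have [m ->] := type2_rk t0; rewrite ?halfE ?exprMn ?sqrr_sign ?mul1r ?exprVn ?exprD ?E2 ?E1 /kap1.
  exact: alg_C2.
- move=> a b e0 c e1 t0 d4 t1 n2; have a1 : one_mod2 a by case: t0.
  have [c0 c0R abE] := half_sum t0; rewrite dvdR4 in d4.
  have hc : c0 \in idl K 1 by move: d4; rewrite abE idl_mul2.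
  (* As 4 divides a + b, c0 is even and y0 = 0 solves the congruence; the resulting sign is
     sigma. *)
  have h0 : c0 + c * 0 ^+ 2 = c0 by rewrite expr0n mulr0 addr0.
  have n1 := type1_normR u1 t1; rewrite (local_type2 hQ1 i2 t0) (Gxn _ _ _ t0) // (not3 n2) abE.
  rewrite (kappa_type1 (y0 := 0) M2 tq chiD chi_sq chi_even chi_nt t1) ?h0 ?valring0 //.
  rewrite (sigmaE a1 abE hc).
  have [m ->] := type2_rk t0; have [m' ->] := type1_rk t1.
  rewrite ?halfE ?exprMn ?sqrr_sign ?mul1r ?exprVn ?exprD ?E2 ?E1 /kap1.
  exact: alg_C3.
- move=> a b e0 c d e1 t0 d4 t1 d4' n2; have a1 : one_mod2 a by case: t0.
  have [c0 c0R abE] := half_sum t0; have [c1 c1R cdE] := half_sum t1; rewrite dvdR4 in d4.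
  have hc : c0 \in idl K 1 by move: d4; rewrite abE idl_mul2.
  have h0 : c0 + d * 0 ^+ 2 = c0 by rewrite expr0n mulr0 addr0.
  rewrite dvdR4 -addrA abE cdE -mulrDr idl_mul2 in d4'.
  have n1 := type2_normR u1 t1; rewrite (local_type2 hQ1 i2 t0) (Gxn _ _ _ t0) // (not3 n2) abE.
  rewrite (kappa_type2 (y0 := 0) M2 tq chiD chi_sq chi_even chi_nt t1 c0R c1R cdE) ?h0 ?valring0 //.
  rewrite (sigmaE a1 abE hc) d4' mul1r.
  have [m ->] := type2_rk t0; have [m' ->] := type2_rk t1.
  rewrite ?halfE ?exprMn ?sqrr_sign ?mul1r ?exprVn ?exprD ?E2 ?E1 /kap1.
  exact: alg_C3.
- move=> a b e0 c d e1 t0 d4 t1 d4' n2.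
  have [c0 c0R abE] := half_sum t0; have [c1 c1R cdE] := half_sum t1; rewrite dvdR4 in d4.
  have hc : c0 \in idl K 1 by move: d4; rewrite abE idl_mul2.
  have h0 : c0 + d * 0 ^+ 2 = c0 by rewrite expr0n mulr0 addr0.
  rewrite dvdR4 -addrA abE cdE -mulrDr idl_mul2 in d4'.
  have n1 := type2_normR u1 t1; rewrite (local_type2 hQ1 i2 t0) (Gxn _ _ _ t0) // (not3 n2) abE.
  rewrite (kappa_type2 (y0 := 0) M2 tq chiD chi_sq chi_even chi_nt t1 c0R c1R cdE) ?h0 ?valring0 //.
  rewrite (negbTE d4') mul0r.
  have [m ->] := type2_rk t0; have [m' ->] := type2_rk t1.
  rewrite ?halfE ?exprMn ?sqrr_sign ?mul1r ?exprVn ?exprD ?E2 ?E1 /kap1.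
  by rewrite alg_C3 // !(mul0r, mulr0) addr0.
- move=> a b e0 t0 d4 n1 n2; rewrite (local_type2 hQ1 i2 t0) (Gxn _ _ _ t0) // (k2n _ _ _ t0) ?not2 //.
  have [m ->] := type2_rk t0; rewrite ?halfE ?exprMn ?sqrr_sign ?mul1r ?exprVn ?exprD ?E2 ?E1 /kap1.
  exact: alg_C6.
- move=> a b e0 t0 d4 n1; rewrite dvdR4 in d4; have e1 := proj1 (not_normRP hQ1) n1.
  rewrite (local_type2 hQ1 i2 t0) (Gxe2 _ _ _ t0) // (kodd _ _ _ t0) //.
  have [m ->] := type2_rk t0; rewrite ?halfE ?exprMn ?sqrr_sign ?mul1r ?exprVn ?exprD ?E2 ?E1 /kap1.
  exact: alg_D1.
- move=> a b e0 c e1 t0 d4 t1 n2; have c1 : one_mod2 c by case: t1.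
  have [c0 c0R abE] := half_sum t0.
  have uc := one_mod2_unit c1; have cn0 := unit_neq0 uc; have n2' := two_neq0 K.
  have cR := unit_ring uc; have cV := unitVring uc.
  (* Take y0 = (c0 / c)^(q/2): its square is exactly the q-th power occurring in phi. *)
  have [yR yE yq] := power_resq (valringM c0R cV).
  have hE : c0 + c * ((c0 / c) ^+ (resq K %/ 2)) ^+ 2 =
     c * ((c0 / c) ^+ resq K - c0 / c) + 2 * c0 by rewrite yE; field.
  have n1 := type1_normR u1 t1; rewrite (local_type2 hQ1 i2 t0) (Gxn _ _ _ t0) // (not3 n2) abE.
  rewrite (kappa_type1 M2 tq chiD chi_sq chi_even chi_nt t1 c0R yR); last first.
    by rewrite hE; apply: rpredD; [apply: idlMl|apply: idl_two].
  have -> : phi_sign C a b c = chi ((c0 + c * ((c0 / c) ^+ (resq K %/ 2)) ^+ 2) / 2).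
    rewrite /phi_sign -[LHS]/(chi _) abE yE; congr chi.
    have -> : 2 * c0 / (2 * c) = c0 / c by field; rewrite n2' cn0.
    by field; rewrite n2' cn0.
  move: (trace_char _) => s; have [m ->] := type2_rk t0; have [m' ->] := type1_rk t1.
  rewrite ?halfE ?exprMn ?sqrr_sign ?mul1r ?exprVn ?exprD ?E2 ?E1 /kap1.
  exact: alg_C3.
- move=> a b e0 c d e1 t0 d4 t1 d4' n2; have h1 : one_mod2 c by case: t1.
  have d1 : one_mod2 d by case: t1.
  have [c0 c0R abE] := half_sum t0; have [c1 c1R cdE] := half_sum t1.
  rewrite dvdR4 -addrA abE cdE -mulrDr idl_mul2 in d4'.
  (* Take y0 = c1^(q/2): c0 and c1 agree modulo 2 because 4 divides a + b + c + d, and y0^2 = c1^q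
     is the power occurring in psi. *)
  have [yR yE yq] := power_resq c1R.
  have hE : c0 + d * c1 ^+ resq K \in idl K 1.
    have -> : c0 + d * c1 ^+ resq K = (c0 + c1) + (d - 1) * c1 ^+ resq K + (c1 ^+ resq K - c1) by ring.
    apply: rpredD => //; apply: rpredD => //.
    by apply: idlMr; [exact: one_mod2P|inR].
  have n1 := type2_normR u1 t1; rewrite (local_type2 hQ1 i2 t0) (Gxn _ _ _ t0) // (not3 n2) abE.
  rewrite (kappa_type2 M2 tq chiD chi_sq chi_even chi_nt t1 c0R c1R cdE yR) yE //.
  rewrite (psiE h1 d1 abE cdE) // d4' mul1r.
  move: (trace_char _) => s; have [m ->] := type2_rk t0; have [m' ->] := type2_rk t1.
  rewrite ?halfE ?exprMn ?sqrr_sign ?mul1r ?exprVn ?exprD ?E2 ?E1 /kap1.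
  exact: alg_C3.
- move=> a b e0 c d e1 t0 d4 t1 d4' n2; have d1 : one_mod2 d by case: t1.
  have [c0 c0R abE] := half_sum t0; have [c1 c1R cdE] := half_sum t1.
  rewrite dvdR4 -addrA abE cdE -mulrDr idl_mul2 in d4'.
  (* The character averages to 0 here, so any square root of c0 modulo 2 will do. *)
  have [y0 yR yE] := sqrt_mod2 c0R.
  have hE : c0 + d * y0 ^+ 2 \in idl K 1.
    have -> : c0 + d * y0 ^+ 2 = (y0 ^+ 2 - c0) + (d - 1) * y0 ^+ 2 + 2 * c0 by ring.
    apply: rpredD; last by apply: idl_two.
    by apply: rpredD => //; apply: idlMr; [exact: one_mod2P|inR].
  have n1 := type2_normR u1 t1; rewrite (local_type2 hQ1 i2 t0) (Gxn _ _ _ t0) // (not3 n2) abE.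
  rewrite (kappa_type2 M2 tq chiD chi_sq chi_even chi_nt t1 c0R c1R cdE yR) //.
  rewrite (negbTE d4') mul0r.
  have [m ->] := type2_rk t0; have [m' ->] := type2_rk t1.
  rewrite ?halfE ?exprMn ?sqrr_sign ?mul1r ?exprVn ?exprD ?E2 ?E1 /kap1.
  by rewrite alg_C3 // !(mul0r, mulr0) addr0.
- move=> a b e0 t0 d4 n1 n2; rewrite (local_type2 hQ1 i2 t0) (Gxn _ _ _ t0) // (k2n _ _ _ t0) ?not2 //.
  have [m ->] := type2_rk t0; rewrite ?halfE ?exprMn ?sqrr_sign ?mul1r ?exprVn ?exprD ?E2 ?E1 /kap1.
  exact: alg_C6.
Qed.

End Core.

(** * The trace modulo 2 as a Frobenius sum *)

Section ResidueField.
Variable K : dyadicField.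
Local Notation k := (resF K).

Lemma resF_pchar : 2%N \in [pchar k].
Proof. by rewrite inE /= (char_residue (dfieldP K)) eqxx. Qed.

(** A basis over F_2 with boolean coefficients, so that the same digits can be read in the residue
    field, in [Q2] and in K. *)
Lemma resF_basis : exists (d : nat) (e : 'I_d -> k), [/\ #|k| = (2 ^ d)%N,
   forall y, exists c : 'I_d -> bool, y = \sum_i (c i)%:R * e i
   & forall c : 'I_d -> bool, \sum_i (c i)%:R * e i = 0 -> forall i, c i = false].
Proof.
pose k' : vectType 'F_2 := pPrimeCharType resF_pchar.
pose X : (\dim {:k'}).-tuple k' := vbasis {:k'}.
have fX : free X := basis_free (vbasisP {:k'}).
have scaleE (a : 'F_2) (y : k') : a *: y = ((a != 0)%:R : k) * (y : k).
  rewrite -[LHS]/((a%:R : k) * (y : k)); congr (_ * _).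
  by case: a => [[|[|[]]]].
exists (\dim {:k'}), (fun i => X`_i); split.
- by rewrite pprimeChar_dimf -(card_pprimeChar resF_pchar).
- move=> y; exists (fun i => coord X i (y : k') != 0).
  rewrite [LHS](coord_vbasis (memvf (y : k'))); apply: eq_bigr => i _.
  exact: scaleE.
move=> c h i; have /freeP := fX.
move=> /(_ (fun i => (c i)%:R)) H0; have : (c i)%:R = 0 :> 'F_2.
  apply: H0; rewrite -[RHS]h; apply: eq_bigr => j _; rewrite scaleE.
  by congr (_%:R * _); case: (c j).
by case: (c i) => // /eqP; rewrite oner_eq0.
Qed.

Lemma red_sum (I : finType) (f : I -> K) : (forall i, f i \in valring (K := K)) ->
  redK (\sum_i f i) = \sum_i redK (f i).
Proof.
move=> fR; suff [] : (\sum_i f i \in valring (K := K)) /\ redK (\sum_i f i) = \sum_i redK (f i) by [].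
elim/big_rec2: _ => [|i y1 y2 _ [IR <-]]; first by split; [exact: valring0|exact: red0].
by split; [apply: valringD|rewrite redD].
Qed.

Lemma frobD n (x y : k) : (x + y) ^+ (2 ^ n) = x ^+ (2 ^ n) + y ^+ (2 ^ n).
Proof.
elim: n => [|n IH]; first by rewrite !expr1.
rewrite !expnSr !exprM IH sqrrD -[_ *+ 2]mulr_natr (char_residue (dfieldP K)) mulr0 addr0 //.
Qed.

Lemma frob_sum n (I : finType) (f : I -> k) :
  (\sum_i f i) ^+ (2 ^ n) = \sum_i f i ^+ (2 ^ n).
Proof.
elim/big_rec2: _ => [|i y1 y2 _ <-]; last exact: frobD.
by rewrite expr0n expn_eq0.
Qed.

Lemma bool_exp n (b : bool) : (b%:R : k) ^+ (2 ^ n) = b%:R.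
Proof. by case: b; rewrite ?expr1n // expr0n expn_eq0. Qed.

End ResidueField.

Section Trace.
Variable K : dyadicField.
Local Notation k := (resF K).
Local Notation F := (Q2 K).
Local Notation R := (@valring K).
Local Notation V2 := (val_ge (@val2 K)).
Local Notation H2 := (Q2P K).
Variables (d : nat) (e : 'I_d -> k).
Hypotheses (e_card : #|k| = (2 ^ d)%N)
  (e_span : forall y, exists c : 'I_d -> bool, y = \sum_i (c i)%:R * e i)
  (e_free : forall c : 'I_d -> bool, \sum_i (c i)%:R * e i = 0 -> forall i, c i = false).

Lemma V2_0 m : 0 \in V2 m. Proof. exact: val_ge0. Qed.
Lemma V2_1 : 1 \in V2 0. Proof. by rewrite val_geE (val1 H2) lexx orbT. Qed.
Lemma V2_bool (b : bool) : b%:R \in V2 0.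
Proof. by case: b; [exact: V2_1|exact: V2_0]. Qed.
Lemma V2_sum m (I : finType) (f : I -> F) : (forall i, f i \in V2 m) -> \sum_i f i \in V2 m.
Proof. by move=> h; apply: (big_ind (fun x => x \in V2 m)) => // [|x y]; [exact: V2_0|exact: (dv_D H2)]. Qed.

Lemma scale_val (m : nat) c (b : K) : c \in V2 m%:Z -> b \in R -> c *: b \in idl K m.
Proof.
move=> cm bR; rewrite -mulr_algl; apply: idlMr => //; move: cm; rewrite !val_geE.
case: (eqVneq c 0) => [->|c0] /=; first by rewrite scale0r eqxx.
by move=> h; rewrite vK_ext // h orbT.
Qed.

Lemma red2_cases (c : F) : red2 c = (red2 c != 0)%:R.
Proof. by case: (red2 c) => [[|[|[]]]] //= i; apply: val_inj. Qed.

Lemma red_scale c (b : K) : c \in V2 0 -> b \in R ->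
  redK (c *: b) = (red2 c != 0)%:R * redK b.
Proof.
move=> cR bR; case: (eqVneq (red2 c) 0) => h /=.
  rewrite mul0r; apply/red0P; first exact: (scale_val (m := 0)).
  by apply: (scale_val (m := 1)) => //; rewrite -(dv_red_eq0 H2) // h.
rewrite mul1r -[c](subrK 1) scalerDl scale1r redD //; last first.
  by apply: (scale_val (m := 0)) => //; apply: (val_geB H2) => //; exact: V2_1.
rewrite (_ : redK _ = 0) ?add0r //; apply/red0P.
  by apply: (scale_val (m := 0)) => //; apply: (val_geB H2) => //; exact: V2_1.
apply: (scale_val (m := 1)) => //; rewrite -(red_eq H2) ?V2_1 // (dv_red1 H2).
by rewrite red2_cases h.
Qed.

Let b_ i : K := rlift (e i).
Let bR i : b_ i \in R. Proof. exact: rlift_ring. Qed.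

Let digit (y : k) : 'I_d -> bool := projT1 (cid (e_span y)).
Let digitP y : y = \sum_i (digit y i)%:R * e i.
Proof. exact: projT2 (cid (e_span y)). Qed.

Let step (y : K) : K := (y - \sum_i ((digit (redK y) i)%:R : F) *: b_ i) / 2.

Let red2_bool (b : bool) : (red2 (b%:R : F) != 0) = b.
Proof.
case: b; first by rewrite (dv_red1 H2) oner_eq0.
have /eqP -> // : red2 (0 : F) == 0 by rewrite (dv_red_eq0 H2) ?V2_0.
Qed.

Let step_ring y : y \in R -> step y \in R.
Proof.
move=> yR; have sR : \sum_i ((digit (redK y) i)%:R : F) *: b_ i \in R.
  by apply: rpred_sum => i _; apply: (scale_val (m := 0)) => //; exact: V2_bool.
have : y - \sum_i ((digit (redK y) i)%:R : F) *: b_ i \in idl K 1.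
  apply/redP => //; rewrite [LHS]digitP red_sum => [|i]; last first.
    by apply: (scale_val (m := 0)) => //; exact: V2_bool.
  apply: eq_bigr => i _; rewrite red_scale ?V2_bool // red2_bool; by rewrite rliftK.
by rewrite /step => /idlP[z zR ->]; rewrite expr1 mulrC mulKf ?two_neq0.
Qed.

Let iter_ring y n : y \in R -> iter n step y \in R.
Proof. by move=> yR; elim: n => //= n IH; apply: step_ring. Qed.

Let coef (x : K) n i : F := \sum_(m < n) 2 ^+ m * (digit (redK (iter m step x)) i)%:R.

Let coefE x n : x = \sum_i coef x n i *: b_ i + 2 ^+ n * iter n step x.
Proof.
elim: n => [|n IH].
  rewrite mul1r big1 ?add0r // => i _; by rewrite /coef big_ord0 scale0r.
rewrite [LHS]IH; under [in RHS]eq_bigr do rewrite /coef big_ord_recr /= scalerDl.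
rewrite big_split /= -addrA; congr (_ + _).
have yE : iter n step x = \sum_i ((digit (redK (iter n step x)) i)%:R : F) *: b_ i
    + 2 * step (iter n step x).
  by rewrite /step mulrC divfK ?two_neq0 // addrC subrK.
rewrite {1}yE mulrDr mulrA -exprSr; congr (_ + _); rewrite mulr_sumr; apply: eq_bigr => i _.
rewrite -[in RHS]scalerA -[in RHS]mulr_algl; congr (_ * _).
by rewrite -[2 ^+ n in RHS]natrX scaler_nat natrX.
Qed.

Let coef_cauchy x i N n : (N <= n)%N -> coef x n i - coef x N i \in V2 N%:Z.
Proof.
move=> /subnK <-; elim: (n - N)%N => [|p IH]; first by rewrite subrr V2_0.
rewrite addSn /coef big_ord_recr /= -/(coef x _ i) addrAC; apply: (dv_D H2) => //.
apply: (val_ge_le (n := (p + N)%:Z)); first by rewrite lez_nat leq_addl.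
by rewrite -[_%:Z]addr0 (val_ge_mul2 H2) V2_bool.
Qed.

(** Iterating [step] produces 2-adic digits of all coordinates in the lifted basis [b_]; the partial
    sums [coef] are Cauchy and converge because [Q2] is complete. *)
Lemma integral_coords x : x \in R ->
  exists2 c : 'I_d -> F, (forall i, c i \in V2 0) & x = \sum_i c i *: b_ i.
Proof.
move=> xR.
have lim i : exists l, forall m : int, exists N : nat, forall n, (N <= n)%N -> coef x n i - l \in V2 m.
  apply: (dv_complete H2) => m; exists `|m|%N => n n' hn hn'.
  apply: (val_ge_le (n := `|m|%N%:Z)); first by lia.
  rewrite -(subrKA (coef x `|m| i)) -[X in _ + X]opprB; apply: (val_geB H2); exact: coef_cauchy.
have [l hl] := choice lim; exists l.
  move=> i; have [N hN] := hl i 0; rewrite -[l i](subKr (coef x N i)).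
  apply: (val_geB H2); last exact: hN.
  apply: V2_sum => m; apply: (val_ge_le (n := m%:Z)); first by [].
  by rewrite -[_%:Z]addr0 (val_ge_mul2 H2) V2_bool.
apply/eqP; rewrite -subr_eq0; apply/eqP/(val_ge_eq0 (v := vK)) => m; rewrite -/(idl K m).
have [N hN] := choice (fun i => hl i m%:Z).
pose n := maxn m (\max_i N i).
rewrite [x in x - _](coefE x n) addrAC -sumrB; apply: rpredD.
  apply: rpred_sum => i _; rewrite -scalerBl; apply: scale_val => //; apply: hN.
  by rewrite /n leq_max (leq_bigmax i) orbT.
by apply: (idl_le (n := n)); [exact: leq_maxl|apply/idl2X/iter_ring].
Qed.

(** Dividing a relation by a coefficient of least valuation and reducing gives a relation among the
    [e i] with a coefficient 1. *)
Lemma coords_free (c : 'I_d -> F) : \sum_i c i *: b_ i = 0 -> forall i, c i = 0.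
Proof.
move=> h i; apply/eqP/negPn/negP => ci.
have [i0 ci0 hmin] : exists2 i0, c i0 != 0 & forall j, c j != 0 -> val2 (c i0) <= val2 (c j).
  pose P := [pred j | c j != 0]; have Pi : P i by [].
  by case: (arg_minP (fun j => val2 (c j)) Pi) => i0 P0 hm; exists i0.
have cR j : c j / c i0 \in V2 0.
  case: (eqVneq (c j) 0) => [->|cj]; first by rewrite mul0r V2_0.
  rewrite val_geE (dv_M H2) ?invr_neq0 // (valV H2) // subr_ge0 hmin //.
  by rewrite orbT.
have : \sum_j (c j / c i0) *: b_ j = 0.
  transitivity ((c i0)^-1 *: (\sum_j c j *: b_ j)); last by rewrite h scaler0.
  by rewrite scaler_sumr; apply: eq_bigr => j _; rewrite scalerA mulrC.
move=> /(congr1 redK); rewrite red0 red_sum => [|j]; last exact: (scale_val (m := 0)).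
under eq_bigr do rewrite red_scale // rliftK.
move=> /e_free /(_ i0); rewrite divff // (dv_red1 H2) oner_eq0 //.
Qed.

Lemma coords_span x : exists c : 'I_d -> F, x = \sum_i c i *: b_ i.
Proof.
pose n := `|vK x|%N; have hx : 2 ^+ n * x \in R.
  case: (eqVneq x 0) => [->|x0]; first by rewrite mulr0 valring0.
  rewrite val_geE (dv_M (dfieldP K)) ?expf_neq0 ?two_neq0 // (val2X (dfieldP K)).
  by apply/orP; right; rewrite /n; lia.
have [c _ hc] := integral_coords hx.
have n2 : (2 : F) ^+ n != 0 by rewrite expf_neq0 // (dv_two_neq0 H2).
exists (fun i => (2 ^+ n)^-1 * c i).
transitivity ((2 ^+ n : F)^-1 *: (2 ^+ n * x)).
  by rewrite -!natrX mulr_natl -scaler_nat scalerA mulVf ?natrX // scale1r.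
by rewrite hc scaler_sumr; apply: eq_bigr => i _; rewrite scalerA.
Qed.

Let frob_trace (c : k) : k := \sum_(j < d) c ^+ (2 ^ j).

(** The left side is a polynomial of degree below 2^d with 2^d roots, hence zero, and the exponents
    2^j are distinct. *)
Lemma frob_indep (u : 'I_d -> k) :
  (forall y : k, \sum_(j < d) u j * y ^+ (2 ^ j) = 0) -> forall j, u j = 0.
Proof.
move=> h j; pose p : {poly k} := \sum_(j < d) u j *: 'X^(2 ^ j).
have d0 : (0 < d)%N by exact: leq_ltn_trans (ltn_ord j).
have p0 : p = 0.
  apply/eqP/negPn/negP => pn0.
  have := @max_poly_roots _ p (enum k) pn0; rewrite enum_uniq => /(_ _ isT).
  rewrite -cardT e_card => hs; have : (2 ^ d < size p)%N.
    apply: hs; apply/allP => y _; apply/rootP; rewrite -[RHS](h y) /p horner_sum.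
    by apply: eq_bigr => i _; rewrite hornerZ hornerXn.
  apply/negP; rewrite -leqNgt; apply: (leq_trans (size_sum _ _ _)); apply/bigmax_leqP => i _.
  apply: (leq_trans (size_scale_leq _ _)); rewrite size_polyXn ltn_exp2l //.
have : p`_(2 ^ j) = 0 by rewrite p0 coef0.
rewrite /p coef_sum (bigD1 j) //= coefZ coefXn eqxx mulr1 big1 ?addr0 // => i ij.
rewrite coefZ coefXn; case: eqP => [/eqP|_]; last by rewrite mulr0.
by rewrite eqn_exp2l // => /eqP/val_inj e0; rewrite e0 eqxx in ij.
Qed.

(** The Moore matrix of the basis. Its columns are Frobenius conjugates, so it diagonalises
    multiplication on the residue field. *)
Let FM : 'M[k]_d := \matrix_(i, j) e i ^+ (2 ^ j).

Let FM_unit : FM \in unitmx.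
Proof.
rewrite -unitmx_tr -row_free_unit; apply: inj_row_free => u hu; apply/rowP => j; rewrite [RHS]mxE.
apply: (frob_indep (u := fun j => u 0 j)) => y.
have [c ->] := e_span y.
transitivity (\sum_i (c i)%:R * (u *m FM^T) 0 i); last first.
  by rewrite hu big1 // => i _; rewrite mxE mulr0.
under eq_bigr do rewrite frob_sum mulr_sumr.
rewrite exchange_big /=; apply: eq_bigr => i _; rewrite mxE mulr_sumr.
by apply: eq_bigr => l _; rewrite !mxE exprMn bool_exp mulrCA.
Qed.

(** Multiplication by [x] has an integral matrix in the lifted basis. Its reduction is conjugate
    through [FM] to the diagonal matrix of the Frobenius conjugates of [redK x], so the trace
    reduces to their sum. *)
Lemma fieldTr_red x : x \in R -> fieldTr x \in V2 0 /\
  ((red2 (fieldTr x) != 0)%:R : k) = frob_trace (redK x).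
Proof.
move=> xR.
have hM i : exists c : 'I_d -> F, (forall j, c j \in V2 0) /\ x * b_ i = \sum_j c j *: b_ j.
  by have [c c1 c2] := integral_coords (valringM xR (bR i)); exists c.
have [m hm] := choice hM.
pose A := passmx.mxof (vbasis {:K}) (vbasis {:K}) (amull x).
pose MX : 'M[F]_d := \matrix_(i, j) m i j.
(* [fieldTr] is computed in [vbasis]. Since [d] and the dimension are different terms, [B] is
   rectangular; a two-sided inverse [B'] and cyclicity of the trace carry out the change of
   basis. *)
pose B : 'M[F]_(d, \dim {:K}) := \matrix_i passmx.rVof (vbasis {:K}) (b_ i).
have vb := vbasisP {:K}.
have rowB i : row i B = passmx.rVof (vbasis {:K}) (b_ i) by rewrite rowK.
have rVsum (c : 'I_d -> F) : passmx.rVof (vbasis {:K}) (\sum_j c j *: b_ j) = \row_j c j *m B.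
  apply/rowP => l; rewrite !mxE linear_sum; apply: eq_bigr => j _.
  by rewrite linearZ /= !mxE.
have BA : B *m A = MX *m B.
  apply/row_matrixP => i; rewrite !row_mul rowB passmx.mul_mxof passmx.rVofK // lfunE /=.
  rewrite (proj2 (hm i)) rVsum; congr (_ *m _); by apply/rowP => j; rewrite !mxE.
have [b' hb'] := choice (fun j => coords_span (vbasis {:K})`_j).
pose B' : 'M[F]_(\dim {:K}, d) := \matrix_(i, j) b' i j.
have B'B : B' *m B = 1%:M.
  apply/row_matrixP => i; rewrite row_mul row1 -(passmx.rVofE vb) [X in passmx.rVof _ X]hb' rVsum.
  by congr (_ *m _); apply/rowP => j; rewrite !mxE.
have BB' : B *m B' = 1%:M.
  have BI (c : 'I_d -> F) : \row_j c j *m B = 0 -> forall j, c j = 0.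
    move=> h; apply: coords_free; apply/eqP; rewrite -(passmx.rVof_eq0 vb) rVsum h eqxx //.
  apply/eqP; rewrite -subr_eq0; apply/eqP/matrixP => i j; rewrite [RHS]mxE.
  apply: (BI (fun j => (B *m B' - 1%:M) i j)).
  have -> : \row_j (B *m B' - 1%:M) i j = row i (B *m B' - 1%:M) by apply/rowP => l; rewrite !mxE.
  by rewrite -row_mul mulmxBl -mulmxA B'B mulmx1 mul1mx subrr row0.
have trE : fieldTr x = \tr MX.
  rewrite /fieldTr -/A -[A]mul1mx -B'B -mulmxA BA mxtrace_mulC -mulmxA BB' mulmx1 //.
have mR i j : m i j \in V2 0 by have [] := hm i.
have trR : \tr MX \in V2 0 by apply: V2_sum => i; rewrite mxE.
split; first by rewrite trE.
pose N : 'M[k]_d := \matrix_(i, j) (red2 (m i j) != 0)%:R.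
have NF : N *m FM = FM *m diag_mx (\row_j redK x ^+ (2 ^ j)).
  apply/matrixP => i j; rewrite mul_mx_diag !mxE -exprMn [e i * _]mulrC.
  have -> : redK x * e i = redK (x * b_ i) by rewrite redM // rliftK.
  rewrite (proj2 (hm i)) red_sum => [|l]; last exact: (scale_val (m := 0)).
  rewrite frob_sum; apply: eq_bigr => l _; rewrite !mxE red_scale // rliftK exprMn bool_exp //.
have trN : \tr N = frob_trace (redK x).
  rewrite -[N](mulmxK FM_unit) NF mxtrace_mulC mulmxA mulVmx // mul1mx mxtrace_diag.
  by apply: eq_bigr => j _; rewrite mxE.
rewrite -trN trE; pose nat2 (a : 'F_2) : k := (a != 0)%:R.
have nat2D a a' : nat2 (a + a') = nat2 a + nat2 a'.
  case: a a' => [[|[|[]]] //= ?] [[|[|[]]] //= ?]; rewrite /nat2 /= ?addr0 ?add0r //.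
  by rewrite resF_char2.
suff [] : (\sum_i MX i i \in V2 0) /\ nat2 (red2 (\sum_i MX i i)) = \sum_i N i i by [].
elim/big_rec2: _ => [|i y1 y2 _ [IR IH]].
  by split; [exact: V2_0|rewrite /nat2 (red2_bool false)].
rewrite !mxE; split; first by apply: (dv_D H2).
by rewrite (dv_redD H2) // nat2D IH.
Qed.

Lemma frob_trace_bool x : x \in R -> frob_trace (redK x) = (frob_trace (redK x) != 0)%:R.
Proof. by move=> /fieldTr_red[_ <-]; case: (_ != 0); rewrite ?oner_eq0 ?eqxx. Qed.

Lemma frob_trace_char (C : pzRingType) x : x \in R ->
  trace_char x = (if frob_trace (redK x) == 0 then 1 else -1) :> C.
Proof.
move=> xR; have [TR <-] := fieldTr_red xR; rewrite /trace_char /signZ2 -(dv_red_eq0 H2) //.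
by case: eqP => _; rewrite ?eqxx ?oner_eq0.
Qed.

Lemma frob_traceD a b : frob_trace (a + b) = frob_trace a + frob_trace b.
Proof. by rewrite /frob_trace -big_split; apply: eq_bigr => j _; rewrite frobD. Qed.

(** The Frobenius sum is additive, takes only the values 0 and 1 and is therefore invariant under
    squaring, and is not identically 0 by [frob_indep]. *)
Lemma trace_char_props (C : numFieldType) :
  [/\ forall x y : K, x \in R -> y \in R -> trace_char (x + y) = trace_char x * trace_char y :> C,
      forall x : K, x \in R -> trace_char (x ^+ 2) = trace_char x :> C,
      forall x : K, x \in idl K 1 -> trace_char x = 1 :> C
    & exists2 x : K, x \in R & trace_char x = -1 :> C].
Proof.
split.
- move=> x y xR yR; rewrite !frob_trace_char ?redD ?frob_traceD //; last by inR.
  rewrite (frob_trace_bool xR) (frob_trace_bool yR).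
  case: (_ != 0); case: (_ != 0); rewrite ?addr0 ?add0r ?resF_char2 ?eqxx ?oner_eq0 ?mulr1 ?mul1r //.
  by rewrite mulrNN mulr1.
- move=> x xR; rewrite !frob_trace_char ?redX //; last by inR.
  congr (if _ then _ else _); rewrite -[RHS]sqrf_eq0; congr (_ == 0).
  rewrite /frob_trace -[in RHS](expn1 2) frob_sum.
  by apply: eq_bigr => j _; rewrite -!exprM mulnC.
- move=> x x1; rewrite frob_trace_char ?(idl_ring x1) // (red0P _ x1) ?(idl_ring x1) //.
  by rewrite /frob_trace big1 ?eqxx // => j _; rewrite expr0n expn_eq0.
have [c hc] : exists c, frob_trace c != 0.
  apply: contrapT => hn; have d0 : (0 < d)%N.
    by rewrite lt0n; apply/eqP => d0; have := resq_gt1 K; rewrite /resq e_card d0.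
  have := @frob_indep (fun=> 1) _ (Ordinal d0); move=> h.
  suff /h/eqP : forall y : k, \sum_(j < d) 1 * y ^+ (2 ^ j) = 0 by rewrite oner_eq0.
  move=> y; apply/eqP/negPn/negP => hy; apply: hn; exists y.
  by rewrite /frob_trace; under eq_bigr do rewrite -[_ ^+ _]mul1r.
exists (rlift c); first exact: rlift_ring.
by rewrite frob_trace_char ?rlift_ring // rliftK (negbTE hc).
Qed.

End Trace.

(** * Equivalence over R and orthogonal splitting *)

Section Equivalence.
Variable K : dyadicField.
Implicit Types (P Q S : qform K).
Local Notation R := (@valring K).

Lemma qequiv_refl Q : qequiv Q Q.
Proof.
have h : (1%:M : 'M[K]_(rk Q)) \is a mxOver R.
  by apply: mxOver_scalar; [exact: valring0|exact: valring1].
by exists 1%:M, 1%:M; split; rewrite ?mulmx1 ?trmx1 ?mul1mx ?mulmx1.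
Qed.

Lemma qequiv_trans P Q S : qequiv P Q -> qequiv Q S -> qequiv P S.
Proof.
move=> [U [V [UR VR UV VU e]]] [U' [V' [UR' VR' UV' VU' e']]].
exists (U *m U'), (V' *m V); split; try exact: mxOverM.
- by rewrite mulmxA -(mulmxA U) UV' mulmx1.
- by rewrite mulmxA -(mulmxA V') VU mulmx1.
by rewrite trmx_mul !mulmxA -e -e' !mulmxA.
Qed.

Lemma mxOver_tr (T : {pred K}) m n (A : 'M[K]_(m, n)) :
  A \is a mxOver T -> A^T \is a mxOver T.
Proof. by move=> /mxOverP h; apply/mxOverP => i j; rewrite mxE. Qed.

Lemma mxOver_ulsub (T : {pred K}) m1 m2 n1 n2 (A : 'M[K]_(m1 + m2, n1 + n2)) :
  A \is a mxOver T -> ulsubmx A \is a mxOver T.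
Proof. by move=> /mxOverP h; apply/mxOverP => i j; rewrite !mxE. Qed.

Lemma mxOver_scalar_ring n a : a \in R -> (a%:M : 'M[K]_n) \is a mxOver R.
Proof. by move=> aR; apply: mxOver_scalar => //; exact: valring0. Qed.

Lemma qequiv_mx n (A U : 'M[K]_n) : U \is a mxOver R -> valunit (\det U) ->
  qequiv (QForm (U *m A *m U^T)) (QForm A).
Proof.
move=> UR dU; have uU : U \in unitmx by rewrite unitmxE unitfE unit_neq0.
by exists U, (invmx U); split; rewrite ?invmx_ring ?mulmxV ?mulVmx.
Qed.

Lemma qequiv_add P P' Q Q' : qequiv P P' -> qequiv Q Q' -> qequiv (qfadd P Q) (qfadd P' Q').
Proof.
move=> [U [V [UR VR UV VU e]]] [U' [V' [UR' VR' UV' VU' e']]].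
exists (block_mx U 0 0 U'), (block_mx V 0 0 V'); split.
- by apply: mxOver_block; rewrite ?rpred0.
- by apply: mxOver_block; rewrite ?rpred0.
- by rewrite mulmx_block !mulmx0 !mul0mx !addr0 !add0r UV UV' -scalar_mx_block.
- by rewrite mulmx_block !mulmx0 !mul0mx !addr0 !add0r VU VU' -scalar_mx_block.
by rewrite tr_block_mx !trmx0 /= !mulmx_block !(mulmx0, mul0mx, addr0, add0r) e e'.
Qed.

Lemma qequiv_index P Q (f : 'I_(rk P) -> 'I_(rk Q)) (g : 'I_(rk Q) -> 'I_(rk P)) :
  cancel f g -> cancel g f -> (forall i j, qmx P i j = qmx Q (f i) (f j)) -> qequiv P Q.
Proof.
move=> fK gK h.
have mulE a b c (u : 'I_a -> 'I_b) (X : 'M[K]_(b, c)) :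
    (\matrix_(i, j) (u i == j)%:R) *m X = \matrix_(i, j) X (u i) j.
  apply/matrixP => i j; rewrite !mxE (bigD1 (u i)) //= !mxE eqxx mul1r big1 ?addr0 // => l.
  by rewrite !mxE eq_sym => /negbTE ->; rewrite mul0r.
exists (\matrix_(i, j) (f i == j)%:R), (\matrix_(i, j) (g i == j)%:R); split.
- by apply/mxOverP => i j; rewrite mxE ring_nat.
- by apply/mxOverP => i j; rewrite mxE ring_nat.
- by rewrite mulE; apply/matrixP => i j; rewrite !mxE fK.
- by rewrite mulE; apply/matrixP => i j; rewrite !mxE gK.
rewrite mulE -[LHS]trmxK trmx_mul trmxK mulE; apply/matrixP => i j.
by rewrite !mxE -h.
Qed.

Lemma qequiv_comm P Q : qequiv (qfadd P Q) (qfadd Q P).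
Proof.
pose f (a b : nat) (i : 'I_(a + b)) : 'I_(b + a) :=
  match fintype.split i with inl x => rshift _ x | inr x => lshift _ x end.
have fl a b x : @f a b (lshift _ x) = rshift _ x.
  by rewrite /f; case: split_ordP => y /eqP; rewrite ?eq_lshift ?eq_lrshift // => /eqP ->.
have fr a b x : @f a b (rshift _ x) = lshift _ x.
  by rewrite /f; case: split_ordP => y /eqP; rewrite ?eq_rshift ?eq_rlshift // => /eqP ->.
apply: (@qequiv_index (qfadd P Q) (qfadd Q P) (@f _ _) (@f _ _)) => [i|i|i j].
- by case: (@split_ordP (rk P) (rk Q) i) => x ->; rewrite ?fl ?fr ?fl.
- by case: (@split_ordP (rk Q) (rk P) i) => x ->; rewrite ?fl ?fr ?fl.
case: (@split_ordP (rk P) (rk Q) i) => x ->; case: (@split_ordP (rk P) (rk Q) j) => y ->;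
rewrite ?fl ?fr /=;
by rewrite ?block_mxEul ?block_mxEur ?block_mxEdl ?block_mxEdr ?mxE.
Qed.

Lemma qequiv_assoc P Q S : qequiv (qfadd (qfadd P Q) S) (qfadd P (qfadd Q S)).
Proof.
pose n := (rk P + (rk Q + rk S))%N; have e : (rk P + rk Q + rk S = n)%N by rewrite /n addnA.
pose f (i : 'I_(rk P + rk Q + rk S)) : 'I_n := cast_ord e i.
pose g (i : 'I_n) : 'I_(rk P + rk Q + rk S) := cast_ord (esym e) i.
have f1 x : f (lshift _ (lshift _ x)) = lshift _ x by apply: val_inj.
have f2 x : f (lshift _ (rshift _ x)) = rshift _ (lshift _ x) by apply: val_inj.
have f3 x : f (rshift _ x) = rshift _ (rshift _ x) by apply: val_inj; rewrite /= addnA.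
apply: (@qequiv_index (qfadd (qfadd P Q) S) (qfadd P (qfadd Q S)) f g) => [i|i|i j].
- exact: cast_ordK.
- exact: cast_ordKV.
case: (@split_ordP (rk P + rk Q) (rk S) i) => x ->; [case: (@split_ordP (rk P) (rk Q) x) => x' ->|];
(case: (@split_ordP (rk P + rk Q) (rk S) j) => y ->; [case: (@split_ordP (rk P) (rk Q) y) => y' ->|]); rewrite ?f1 ?f2 ?f3 /=;
by do ?rewrite ?block_mxEul ?block_mxEur ?block_mxEdl ?block_mxEdr; rewrite ?mxE.
Qed.

Lemma qequiv_swap P Q S : qequiv (qfadd P (qfadd Q S)) (qfadd Q (qfadd P S)).
Proof.
apply: (qequiv_trans (qequiv_sym (qequiv_assoc _ _ _))).
apply: (qequiv_trans (qequiv_add (qequiv_comm _ _) (qequiv_refl S))); exact: qequiv_assoc.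
Qed.

Lemma unitM_l (x y : K) : x \in R -> y \in R -> valunit (x * y) -> valunit x /\ valunit y.
Proof.
move=> xR yR; rewrite !valunitE xR yR /= => /andP[_].
by rewrite idl_prime // negb_or => /andP[].
Qed.

Lemma unimod_equiv P Q : qequiv P Q -> unimodular P -> unimodular Q.
Proof.
move=> /qequiv_sym PQ [sP PR dP]; have := rk_equiv PQ; move: PQ.
case: P sP PR dP => n A; case: Q => n' B /= sA AR dA [U [V /= [UR VR UV VU e]]] nn.
subst n'; rewrite /= in U V UR VR UV VU e.
split=> /=.
- by rewrite -e !trmx_mul trmxK sA mulmxA.
- by rewrite -e; apply: mxOverM; [apply: mxOverM|apply: mxOver_tr].
have uU : valunit (\det U).
  have := unit1 K; rewrite -(det1 K n) -UV det_mulmx => /unitM_l [] //; exact: det_ring.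
by rewrite -e !det_mulmx det_tr; apply: unitM => //; apply: unitM.
Qed.

Lemma unimod_addr P Q : unimodular (qfadd P Q) -> unimodular P /\ unimodular Q.
Proof.
move=> [/= s i d]; rewrite det_ublock in d.
have PR : qmx P \is a mxOver R.
  by apply/mxOverP => a b; have := mxOverP i (lshift _ a) (lshift _ b); rewrite block_mxEul.
have QR : qmx Q \is a mxOver R.
  by apply/mxOverP => a b; have := mxOverP i (rshift _ a) (rshift _ b); rewrite block_mxEdr.
have [dP dQ] := unitM_l (det_ring PR) (det_ring QR) d.
by move: s; rewrite tr_block_mx => /eq_block_mx[sP _ _ sQ]; split.
Qed.

Definition schur a b (A : 'M[K]_(a + b)) : 'M[K]_b :=
  drsubmx A - dlsubmx A *m invmx (ulsubmx A) *m ursubmx A.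

(** Block elimination: the multiplier X is integral because the upper left block is invertible over
    R, and the Schur complement inherits unimodularity from the determinant. *)
Lemma split_block a b (A : 'M[K]_(a + b)) : unimodular (QForm A) -> valunit (\det (ulsubmx A)) ->
  qequiv (QForm A) (qfadd (QForm (ulsubmx A)) (QForm (schur A))) /\ unimodular (QForm (schur A)).
Proof.
move=> uA du; have [/= sA AR _] := uA.
have [s1 s2 s3 s4] : [/\ (ulsubmx A)^T = ulsubmx A, (dlsubmx A)^T = ursubmx A,
    (ursubmx A)^T = dlsubmx A & (drsubmx A)^T = drsubmx A].
  by rewrite trmx_ulsub trmx_dlsub trmx_ursub trmx_drsub sA.
have uu : ulsubmx A \in unitmx by rewrite unitmxE unitfE unit_neq0.
have ulR : ulsubmx A \is a mxOver R by apply: mxOver_ulsub.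
have dlR : dlsubmx A \is a mxOver R by apply/mxOverP => i j; rewrite !mxE; apply/mxOverP.
pose X := dlsubmx A *m invmx (ulsubmx A).
have XR : X \is a mxOver R by apply: mxOverM => //; apply: invmx_ring.
have XT : X^T = invmx (ulsubmx A) *m ursubmx A by rewrite trmx_mul trmx_inv s1 s2.
have e : qequiv (QForm A) (qfadd (QForm (ulsubmx A)) (QForm (schur A))).
  exists (block_mx 1%:M 0 X 1%:M), (block_mx 1%:M 0 (- X) 1%:M); split.
  - by apply: mxOver_block; rewrite ?rpred0 ?mxOver_scalar_ring ?valring1.
  - by apply: mxOver_block; rewrite ?rpredN ?rpred0 ?mxOver_scalar_ring ?valring1.
  - by rewrite mulmx_block !(mulmx0, mul0mx, mulmx1, mul1mx, addr0, add0r) subrr -scalar_mx_block.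
  - by rewrite mulmx_block !(mulmx0, mul0mx, mulmx1, mul1mx, addr0, add0r) addNr -scalar_mx_block.
  rewrite /= tr_block_mx !trmx1 trmx0 XT !mulmx_block.
  rewrite !(mulmx0, mul0mx, mulmx1, mul1mx, addr0, add0r) mulKVmx // /X mulmxKV //.
  by rewrite mulmxA /schur addrC subrK submxK.
by split=> //; have [] := unimod_addr (unimod_equiv e uA).
Qed.

End Equivalence.

(** * Normal forms of unimodular forms *)

Section EvenClassification.
Variable K : dyadicField.
Implicit Types (P Q S : qform K).
Local Notation R := (@valring K).
Local Notation k := (resF K).

(** The root is the fixed point of s -> -(c + g s^2) / b, a contraction of 2 R: differences are
    multiplied by a sum of two even elements. The iteration starts at 0. *)
Lemma hensel_quadratic (b c g : K) : valunit b -> c \in idl K 1 -> g \in R ->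
  exists2 s, s \in idl K 1 & c + b * s + g * s ^+ 2 = 0.
Proof.
move=> ub c1 gR; have b0 := unit_neq0 ub; have bV := unitVring ub.
have bR := unit_ring ub.
pose u := fix u n : K := if n is n'.+1 then - (c + g * u n' ^+ 2) / b else 0.
have u1 n : u n \in idl K 1.
  elim: n => [|n IH] /=; first by rewrite rpred0.
  apply: idlMr => //; rewrite rpredN; apply: rpredD => //; apply: idlMl => //.
  by rewrite expr2; apply: idlMr => //; apply: idl_ring IH.
have uR n := idl_ring (u1 n).
have uS n : u n.+1 - u n \in idl K n.
  elim: n => [|n IH]; first by rewrite idl0 -[_ - _]/(_ + - _); apply: valringD; rewrite ?valringN.
  have -> : u n.+2 - u n.+1 = - (g / b) * ((u n.+1 - u n) * (u n.+1 + u n)).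
    transitivity ((- (c + g * u n.+1 ^+ 2) / b) - (- (c + g * u n ^+ 2) / b)); first by [].
    by move: (u n.+1) (u n) => y z; field.
  apply: idlMl; first by inR.
  by rewrite -[X in idl K X]addn1; apply: idlM => //; apply: rpredD.
have uC N n : (N <= n)%N -> u n - u N \in idl K N.
  move=> /subnK <-; elim: (n - N)%N => [|p IH]; first by rewrite subrr rpred0.
  rewrite addSn -(subrKA (u (p + N)%N)); apply: rpredD => //.
  by apply: idl_le (uS _); exact: leq_addl.
have [s hs] : exists s, forall m : int, exists N : nat, forall n, (N <= n)%N -> u n - s \in val_ge vK m.
  apply: (dv_complete (dfieldP K)) => m; exists `|m|%N => n n' hn hn'.
  apply: (val_ge_le (n := `|m|%N%:Z)); first by lia.
  rewrite -(subrKA (u `|m|%N)) -[X in _ + X]opprB; apply: (val_geB (dfieldP K)); exact: uC.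
have s1 : s \in idl K 1.
  have [N hN] := hs 1; rewrite -[s](subKr (u N)); apply: rpredB => //.
  exact: hN.
exists s => //; apply: (val_ge_eq0 (v := vK)) => m; rewrite -/(idl K m).
have [N hN] := hs m%:Z; have sR := idl_ring s1.
have h1 := hN N (leqnn _); have h2 := hN N.+1 (leqnSn _).
have uE : c + b * u N.+1 + g * u N ^+ 2 = 0 by rewrite /=; field.
have -> : c + b * s + g * s ^+ 2 = - (b * (u N.+1 - s)) - g * (u N + s) * (u N - s)
   + (c + b * u N.+1 + g * u N ^+ 2) by ring.
rewrite uE addr0; apply: rpredB; first by rewrite rpredN; apply: idlMl.
by apply: idlMl => //; inR.
Qed.

Lemma mul2E m n (A : 'M[K]_(m, 2)) (B : 'M[K]_(2, n)) i j :
  (A *m B) i j = A i 0 * B 0 j + A i 1 * B 1 j.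
Proof.
rewrite mxE !big_ord_recl big_ord0 addr0.
by have -> : lift ord0 ord0 = 1 :> 'I_2 by apply: val_inj.
Qed.

Definition mx2 (a b c d : K) : 'M[K]_2 :=
  \matrix_(i, j) if i == 0 then (if j == 0 then a else b) else (if j == 0 then c else d).

Lemma mx2_ring a b c d : a \in R -> b \in R -> c \in R -> d \in R -> mx2 a b c d \is a mxOver R.
Proof. by move=> *; apply/mxOverP => i j; rewrite mxE; do 2?case: ifP. Qed.

Lemma mx2P (A B : 'M[K]_2) : A 0 0 = B 0 0 -> A 0 1 = B 0 1 -> A 1 0 = B 1 0 -> A 1 1 = B 1 1 -> A = B.
Proof. by move=> h1 h2 h3 h4; apply/matrixP; apply: ord2P; apply: ord2P. Qed.

Lemma symint2 (X : 'M[K]_2) : symint (QForm X) -> X 1 0 = X 0 1.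
Proof. by move=> [/= s _]; rewrite -{1}s mxE. Qed.

Lemma hyperbolic_plane (X : 'M[K]_2) : symint (QForm X) -> X 0 0 \in idl K 2 ->
  valunit (X 0 1) -> X 1 1 \in idl K 1 -> qequiv (QForm X) (qfH K).
Proof.
move=> hX /idlP[dl dR X00] ub /idlP[g gR X11]; have X10 := symint2 hX.
rewrite expr1 in X11; move: ub; move: X10 => X10; set b := X 0 1 in X10 * => ub.
have [s s1 hs] := hensel_quadratic ub (idl_two dR) gR.
have sR := idl_ring s1; pose b' := b + 2 * (g * s).
have ub' : valunit b'.
  by apply: (unit_cong ub); rewrite addrC addKr; apply: idl_two; inR.
have b0 := unit_neq0 ub'; have bV := unitVring ub'; have bR := unit_ring ub.
apply: qequiv_sym.
(* The first row v = (1, s) is isotropic and pairs to [b'] with the second basis vector e. The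
   second row is e / b' - (g / b'^2) v, corrected to be isotropic and pairing to 1 with v. *)
pose U := mx2 1 s (- (g * b'^-1 ^+ 2)) ((1 - g * s * b'^-1) * b'^-1).
have -> : qfH K = QForm (U *m X *m U^T).
  rewrite /qfH; congr QForm; apply: mx2P; rewrite !mul2E !mxE /= X10 X11 X00 -/b.
  - transitivity (2 * (2 * dl + b * s + g * s ^+ 2)); last by ring.
    by rewrite hs mulr0.
  - transitivity (1 + (- g / b' ^+ 2) * (2 * (2 * dl + b * s + g * s ^+ 2))).
      by rewrite hs !mulr0 addr0.
    by rewrite /b' in b0 *; field.
  - transitivity (1 + (- g / b' ^+ 2) * (2 * (2 * dl + b * s + g * s ^+ 2))).
      by rewrite hs !mulr0 addr0.
    by rewrite /b' in b0 *; field.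
  - transitivity ((g / b' ^+ 2) ^+ 2 * (2 * (2 * dl + b * s + g * s ^+ 2))).
      by rewrite hs !mulr0.
    by rewrite /b' in b0 *; field.
apply: qequiv_mx; first by apply: mx2_ring; inR.
rewrite det2 !mxE /=.
have -> : 1 * ((1 - g * s * b'^-1) * b'^-1) - s * - (g * b'^-1 ^+ 2) = b'^-1 by field.
exact: unitV.
Qed.

Lemma even2_unit (X : 'M[K]_2) : unimodular (QForm X) -> evenform (QForm X) -> valunit (X 0 1).
Proof.
move=> uX eX; have [_ /= XR d] := uX; have X10 := symint2 (unimod_symint uX).
have bR : X 0 1 \in R by apply/mxOverP.
have h : valunit (X 0 1 * X 0 1).
  apply: (unit_cong (unitN d)).
  have -> : X 0 1 * X 0 1 - - \det X = X 0 0 * X 1 1 by rewrite det2 X10; ring.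
  by apply: idlMr; [exact: (eX 0)|apply/mxOverP].
by have [] := unitM_l bR bR h.
Qed.

(** The plane is twice al x^2 + b x y + g y^2 with b a unit. A zero of the reduction, moved to the
    first basis vector, gives a hyperbolic plane; without one the reduced quadratic is
    irreducible. *)
Lemma plane_class (X : 'M[K]_2) : unimodular (QForm X) -> evenform (QForm X) ->
  qequiv (QForm X) (qfH K) \/ exists2 f, elliptic_poly f & QForm X = qfE f.
Proof.
move=> uX eX; have ub := even2_unit uX eX; have hX := unimod_symint uX.
have X10 := symint2 hX; have [_ /= XR] := hX.
have /idlP[al alR X00] := eX 0; have /idlP[g gR X11] := eX 1; rewrite /= expr1 in X00 X11.
set b := X 0 1 in ub X10; have bR := unit_ring ub.
case: (pselect (redK al = 0)) => [/(red0P alR) al1|al0].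
  by left; apply: hyperbolic_plane; rewrite ?X00 ?X11 ?idl_mul2.
case: (pselect (exists x, redK al * x ^+ 2 + redK b * x + redK g = 0)) => [[x hx]|noroot].
  left; pose y := rlift x; have yR : y \in R by inR.
  have h0 : al * y ^+ 2 + b * y + g \in idl K 1.
    by apply/red0P; inR; rewrite !redD ?redM ?redX ?rliftK; inR.
  pose U := mx2 y 1 1 0.
  apply: (qequiv_trans (qequiv_sym (qequiv_mx (U := U) X _ _))).
  - by apply: mx2_ring; inR.
  - by rewrite det2 !mxE /= mulr0 sub0r mulr1; apply: unitN; apply: unit1.
  apply: hyperbolic_plane.
  - split; first by rewrite /= !trmx_mul trmxK (proj1 hX) mulmxA.
    by do 2?apply: mxOverM => //; rewrite ?mxOver_tr //; apply: mx2_ring; inR.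
  - rewrite !mul2E !mxE /= X10 X00 X11 -/b.
    have -> : (y * (2 * al) + 1 * b) * y + (y * b + 1 * (2 * g)) * 1 =
      2 * (al * y ^+ 2 + b * y + g) by ring.
    by rewrite idl_mul2.
  - rewrite !mul2E !mxE /= X10 X00 X11 -/b.
    have -> : (y * (2 * al) + 1 * b) * 1 + (y * b + 1 * (2 * g)) * 0 = b + 2 * (al * y) by ring.
    by apply: (unit_cong ub); rewrite addrC addKr; apply: idl_two; inR.
  - rewrite !mul2E !mxE /= X10 X00 X11 -/b.
    have -> : (1 * (2 * al) + 0 * b) * 1 + (1 * b + 0 * (2 * g)) * 0 = 2 * al by ring.
    exact: idl_two.
right; pose f : {poly K} := Poly [:: g; b; al].
have aln0 : al != 0 by apply: contra_notN al0 => /eqP ->; exact: red0.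
have fE : f = [:: g; b; al] :> seq K.
  by apply: (@PolyK _ 0); rewrite /= aln0.
have f0 : f`_0 = g by rewrite fE.
have f1 : f`_1 = b by rewrite fE.
have f2 : f`_2 = al by rewrite fE.
have sf : size f = 3%N by rewrite fE.
exists f.
  have sm : size (map_poly redK f) = 3%N.
    by rewrite size_map_poly_id0 ?sf // lead_coefE sf f2; apply/eqP.
  split=> //.
    apply/polyOverP => -[|[|[|i]]]; rewrite ?f0 ?f1 ?f2 //.
    by rewrite nth_default ?sf //; exact: valring0.
  apply: cubic_irreducible; first by rewrite sm.
  move=> x; apply/negP => /rootP hx; apply: noroot; exists x; rewrite -[RHS]hx horner3 //.
  by rewrite !coef_map_id0 ?red0 // f0 f1 f2; ring.
rewrite /qfE; congr QForm; apply: mx2P; rewrite !mxE /= ?f0 ?f1 ?f2 //.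
Qed.

(** Add [s] times the first vector of the second plane to that of the first, with s^2 close to f_2 /
    f'_2: its value 2 (f_2 + s^2 f'_2) becomes divisible by 4 while its pairing f_1 stays a unit.
    The plane so obtained is hyperbolic and splits off. *)
Lemma elliptic_pair f f' : elliptic_poly f -> elliptic_poly f' ->
  exists Y : 'M[K]_2, [/\ unimodular (QForm Y), evenform (QForm Y)
    & qequiv (qfadd (qfE f) (qfE f')) (qfadd (qfH K) (QForm Y))].
Proof.
move=> ef ef'; have uE := unimodE ef; have uE' := unimodE ef'.
have f2R := elliptic_coef ef 2; have f2R' := elliptic_coef ef' 2.
have u2' : valunit f'`_2.
  rewrite valunitE f2R' /=; apply/negP => /(red0P f2R') h.
  have := @elliptic_aniso K f' ef' 1 0; rewrite h mul0r mulr0 mulr0 expr0n mulr0 !addr0.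
  by move=> /(_ erefl); rewrite oner_eq0.
have [s sR hs] := sqrt_mod2 (valringM f2R (unitVring u2')).
pose X := qmx (qfE f); pose X' := qmx (qfE f'); pose S := mx2 s 0 0 0.
pose W : 'M[K]_(2 + 2) := block_mx 1%:M S 0 1%:M.
pose A : 'M[K]_(2 + 2) := block_mx X 0 0 X'.
pose B := W *m A *m W^T.
have SR : S \is a mxOver R by apply: mx2_ring; inR.
have WR : W \is a mxOver R.
  by apply: mxOver_block; rewrite ?rpred0 ?mxOver_scalar_ring ?valring1.
have dW : valunit (\det W) by rewrite det_ublock !det1 mulr1 unit1.
have BA : qequiv (QForm B) (QForm A) by apply: qequiv_mx.
have eA : QForm A = qfadd (qfE f) (qfE f') by [].
have uA : unimodular (QForm A) by rewrite eA; apply: unimod_add.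
have uB := unimod_equiv (qequiv_sym BA) uA.
have evA : evenform (QForm A) by rewrite eA; apply: even_add; apply: evenE.
have evB : evenform (QForm B) := even_equiv BA (unimod_symint uA) evA.
have BE : B = block_mx (X + S *m X' *m S^T) (S *m X') (X' *m S^T) X'.
  rewrite /B /W /A tr_block_mx !trmx1 trmx0 !mulmx_block.
  by rewrite !(mulmx0, mul0mx, mulmx1, mul1mx, addr0, add0r).
have ulE : ulsubmx B = X + S *m X' *m S^T by rewrite BE block_mxKul.
have e00 : (ulsubmx B) 0 0 = 2 * (f`_2 + s ^+ 2 * f'`_2).
  by rewrite ulE mxE !mul2E !mxE /=; ring.
have e01 : (ulsubmx B) 0 1 = f`_1 by rewrite ulE mxE !mul2E !mxE /=; ring.
have e10 : (ulsubmx B) 1 0 = f`_1 by rewrite ulE mxE !mul2E !mxE /=; ring.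
have e11 : (ulsubmx B) 1 1 = 2 * f`_0 by rewrite ulE mxE !mul2E !mxE /=; ring.
have h00 : (ulsubmx B) 0 0 \in idl K 2.
  rewrite e00 idl_mul2.
  have -> : f`_2 + s ^+ 2 * f'`_2 = (s ^+ 2 - f`_2 / f'`_2) * f'`_2 + 2 * f`_2.
    by field; exact: unit_neq0.
  by apply: rpredD; [apply: idlMr|apply: idl_two].
have u1 := elliptic_unit ef.
have du : valunit (\det (ulsubmx B)).
  apply: (unit_cong (unitN (unitM u1 u1))); rewrite det2 e01 e10 opprK subrK.
  by apply: idlMr; [apply: idl_le h00|rewrite e11; apply: valringM; [exact: ring_two|exact: elliptic_coef]].
have [eq uS] := split_block uB du; exists (schur B); split=> //.
  have ev := even_equiv (qequiv_sym eq) (unimod_symint uB) evB.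
  by move=> i; have := ev (rshift _ i); rewrite /= block_mxEdr.
rewrite -eA; apply: (qequiv_trans (qequiv_sym BA)); apply: (qequiv_trans eq).
apply: qequiv_add (qequiv_refl _); apply: hyperbolic_plane; rewrite ?e01 ?e11 //.
  have [/= sB BR _] := uB; split=> /=; first by rewrite trmx_ulsub sB.
  exact: mxOver_ulsub.
by apply/idl_two/elliptic_coef.
Qed.

Lemma plane_add (X : 'M[K]_2) e P : unimodular (QForm X) -> evenform (QForm X) -> planes e P ->
  exists e', type0 e' (qfadd (QForm X) P).
Proof.
move=> uX eX pP; case: (plane_class uX eX) => [XH|[f ef ->]].
  case: pP => [m|f m ef].
    exists true; exists (qfHs K m.+1); first by constructor.
    exact: qequiv_add XH (qequiv_refl _).
  exists false; exists (qfadd (qfE f) (qfHs K m.+1)); first by constructor.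
  apply: (qequiv_trans (qequiv_add XH (qequiv_refl _))); exact: qequiv_swap.
case: pP => [m|f' m ef'].
  exists false; exists (qfadd (qfE f) (qfHs K m)); first by constructor.
  exact: qequiv_refl.
have [Y [uY eY hY]] := elliptic_pair ef ef'.
have h : qequiv (qfadd (qfE f) (qfadd (qfE f') (qfHs K m))) (qfadd (qfH K) (qfadd (QForm Y) (qfHs K m))).
  apply: (qequiv_trans (qequiv_sym (qequiv_assoc _ _ _))).
  by apply: (qequiv_trans (qequiv_add hY (qequiv_refl _))); exact: qequiv_assoc.
case: (plane_class uY eY) => [YH|[f'' ef'' eYf]].
  exists true; exists (qfHs K m.+2); first by constructor.
  apply: (qequiv_trans h); apply: qequiv_add (qequiv_refl _) _.
  exact: qequiv_add YH (qequiv_refl _).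
exists false; exists (qfadd (qfE f'') (qfHs K m.+1)); first by constructor.
by apply: (qequiv_trans h); rewrite eYf; exact: qequiv_swap.
Qed.

Lemma type0_equiv e P Q : qequiv P Q -> type0 e Q -> type0 e P.
Proof. by move=> PQ [S pS QS]; exists S => //; apply: qequiv_trans QS. Qed.

Lemma qequiv_tperm n (A : 'M[K]_n) (a b : 'I_n) :
  qequiv (QForm (\matrix_(i, j) A (tperm a b i) (tperm a b j))) (QForm A).
Proof.
apply: (@qequiv_index K (QForm _) (QForm A) (tperm a b) (tperm a b)) => [i|i|i j];
  by rewrite ?tpermK //= mxE.
Qed.

Lemma even_class n (A : 'M[K]_n) : unimodular (QForm A) -> evenform (QForm A) ->
  exists e, type0 e (QForm A).
Proof.
elim/ltn_ind: n A => -[|[|m]] IH A uA eA.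
- exists true; exists (qf0 K); first exact: (PlanesP K 0).
  have -> : QForm A = qf0 K by congr QForm; apply/matrixP => -[].
  exact: qequiv_refl.
- have [_ _ /=] := uA; rewrite det_mx11 valunitE.
  by have := eA 0; rewrite /= => ->; rewrite andbF.
have [/= sA AR dA] := uA.
(* A unit determinant forces a unit in the first row. It is off the even diagonal, so with its
   mirror entry it spans a unimodular block of size 2. *)
have [j uj] : exists j, valunit (A 0 j).
  apply: contrapT => hn; move: dA; rewrite (expand_det_row _ 0) valunitE => /andP[_ /negP]; apply.
  apply: rpred_sum => j _; apply: idlMr.
    apply/negPn/negP => h; apply: hn; exists j; rewrite valunitE h andbT; exact/mxOverP.
  rewrite /cofactor; apply: valringM; first by apply: valringX; apply: valringN; exact: valring1.
  by apply: det_ring; apply/mxOverP => a b; rewrite !mxE; apply/mxOverP.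
have j0 : j != 0.
  by apply: contraTneq uj => ->; have := eA 0; rewrite valunitE /= => ->; rewrite andbF.
pose s := tperm (1 : 'I_m.+2) j.
pose B : 'M[K]_(2 + m) := \matrix_(i, j) A (s i) (s j).
have BA : qequiv (QForm B) (QForm A) by exact: qequiv_tperm.
have uB := unimod_equiv (qequiv_sym BA) uA.
have evB : evenform (QForm B) := even_equiv BA (unimod_symint uA) eA.
have s0 : s 0 = 0 by rewrite /s tpermD // eq_sym.
have s1 : s 1 = j by rewrite /s tpermL.
have l0 : lshift m (0 : 'I_2) = 0 :> 'I_(2 + m) by apply: val_inj.
have l1 : lshift m (1 : 'I_2) = 1 :> 'I_(2 + m) by apply: val_inj.
have e01 : (ulsubmx B) 0 1 = A 0 j by rewrite !mxE l0 l1 s0 s1.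
have e10 : (ulsubmx B) 1 0 = A 0 j by rewrite !mxE l0 l1 s0 s1 -{1}sA mxE.
have ulR : ulsubmx B \is a mxOver R by apply/mxOverP => i i'; rewrite !mxE; apply/mxOverP.
have evul : evenform (QForm (ulsubmx B)).
  by move=> i; have := evB (lshift m i); rewrite /= !mxE.
have du : valunit (\det (ulsubmx B)).
  apply: (unit_cong (unitN (unitM uj uj))); rewrite det2 e01 e10 opprK subrK.
  by apply: idlMr; [exact: (evul 0)|apply/mxOverP].
have [eq uS] := split_block uB du.
have evS : evenform (QForm (schur B)).
  have ev := even_equiv (qequiv_sym eq) (unimod_symint uB) evB.
  by move=> i; have := ev (rshift _ i); rewrite /= block_mxEdr.
have [e [P pP SP]] : exists e, type0 e (QForm (schur B)).
  by apply: IH => //; apply: leqnSn.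
have uul : unimodular (QForm (ulsubmx B)) by have [] := unimod_addr (unimod_equiv eq uB).
have [e' h'] := plane_add uul evul pP.
exists e'; apply: type0_equiv h'; apply: (qequiv_trans (qequiv_sym BA)).
exact: qequiv_trans eq (qequiv_add (qequiv_refl _) SP).
Qed.

End EvenClassification.

Section Classification.
Variable K : dyadicField.
Implicit Types (P Q S : qform K).
Local Notation R := (@valring K).

(** Units are squares modulo 2, so rescaling the variable brings the coefficient to 1 modulo 2. *)
Lemma qf1_scale (u : K) : valunit u -> exists2 a, one_mod2 a & qequiv (qf1 u) (qf1 a).
Proof.
move=> uu; have uR := unit_ring uu; have [s sR hs] := sqrt_mod2 (unitVring uu).
have us : valunit s.
  rewrite valunitE sR; apply/negP => s1.
  have := unitV uu; rewrite valunitE => /andP[_ /negP]; apply.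
  rewrite -(subKr (s ^+ 2) u^-1); apply: rpredB => //.
  by rewrite expr2; apply: idlMr.
exists (s ^+ 2 * u).
  rewrite /one_mod2 dvdR2.
  have -> : s ^+ 2 * u - 1 = (s ^+ 2 - u^-1) * u by field; exact: unit_neq0.
  exact: idlMr.
apply: qequiv_sym; rewrite /qf1.
have -> : (s ^+ 2 * u)%:M = (s%:M : 'M[K]_1) *m u%:M *m (s%:M)^T.
  by rewrite tr_scalar_mx -!scalar_mxM; congr (_%:M); ring.
by apply: qequiv_mx; [exact: mxOver_scalar_ring|rewrite det_scalar1].
Qed.

Lemma one_mod2D (a b c : K) : one_mod2 a -> one_mod2 b -> one_mod2 c -> one_mod2 (a + b + c).
Proof.
move=> /one_mod2P a1 /one_mod2P b1 /one_mod2P c1; rewrite /one_mod2 dvdR2.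
have -> : a + b + c - 1 = (a - 1) + (b - 1) + (c - 1) + 2 * 1 by ring.
by do ?apply: rpredD => //; apply: idl_two; exact: valring1.
Qed.

(* The vector (1, 1, 1) has odd norm, and its orthogonal complement is an even plane. *)
Lemma three_squares (a b c : K) : one_mod2 a -> one_mod2 b -> one_mod2 c ->
  exists Y : 'M[K]_2, [/\ unimodular (QForm Y), evenform (QForm Y)
   & qequiv (qfadd (qf1 a) (qfadd (qf1 b) (qf1 c))) (qfadd (qf1 (a + b + c)) (QForm Y))].
Proof.
move=> a1 b1 c1.
have ua := one_mod2_unit a1; have ub := one_mod2_unit b1; have uc := one_mod2_unit c1.
have aR := unit_ring ua; have bR := unit_ring ub; have cR := unit_ring uc.
pose d := a + b + c; have d1 : one_mod2 d by exact: one_mod2D.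
have ud := one_mod2_unit d1; have dR := unit_ring ud.
pose D := mx2 b 0 0 c; pose r : 'M[K]_(1, 2) := const_mx 1.
pose A : 'M[K]_(1 + 2) := block_mx a%:M 0 0 D.
have uf1 (x : K) : valunit x -> unimodular (qf1 x).
  move=> ux; have [s i] := symint_qf1 (unit_ring ux).
  by split => //=; rewrite det_scalar1.
have DE : qfadd (qf1 b) (qf1 c) = QForm D.
  have h0 : (0 : 'I_2) = lshift 1 (0 : 'I_1) :> 'I_(1 + 1) by apply: val_inj.
  have h1 : (1 : 'I_2) = rshift 1 (0 : 'I_1) :> 'I_(1 + 1) by apply: val_inj.
  rewrite /qfadd /=; congr QForm; apply: mx2P; rewrite [RHS]mxE /= ?h0 ?h1.
  - by apply: (etrans (@block_mxEul _ 1 1 1 1 b%:M 0 0 c%:M 0 0)); rewrite mxE.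
  - by apply: (etrans (@block_mxEur _ 1 1 1 1 b%:M 0 0 c%:M 0 0)); rewrite mxE.
  - by apply: (etrans (@block_mxEdl _ 1 1 1 1 b%:M 0 0 c%:M 0 0)); rewrite mxE.
  - by apply: (etrans (@block_mxEdr _ 1 1 1 1 b%:M 0 0 c%:M 0 0)); rewrite mxE.
have eA : QForm A = qfadd (qf1 a) (qfadd (qf1 b) (qf1 c)) by rewrite DE.
pose W : 'M[K]_(1 + 2) := block_mx 1%:M r 0 1%:M.
pose B := W *m A *m W^T.
have rR : r \is a mxOver R by apply: mxOver_const; exact: valring1.
have WR : W \is a mxOver R.
  by apply: mxOver_block; rewrite ?rpred0 ?mxOver_scalar_ring ?valring1.
have dW : valunit (\det W) by rewrite det_ublock !det1 mulr1 unit1.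
have BA : qequiv (QForm B) (QForm A) by apply: qequiv_mx.
have uA : unimodular (QForm A) by rewrite eA; do ?apply: unimod_add; apply: uf1.
have uB := unimod_equiv (qequiv_sym BA) uA.
have BE : B = block_mx (a%:M + r *m D *m r^T) (r *m D) (D *m r^T) D.
  rewrite /B /W /A tr_block_mx !trmx1 trmx0 !mulmx_block.
  by rewrite !(mulmx0, mul0mx, mulmx1, mul1mx, addr0, add0r).
have ulE : ulsubmx B = d%:M.
  rewrite BE block_mxKul; apply/matrixP => i j; rewrite !ord1 mxE !mul2E !mxE /= ?eqxx ?mulr1n /d; ring.
have du : valunit (\det (ulsubmx B)) by rewrite ulE det_scalar1.
have [eq uS] := split_block uB du; exists (schur B); split=> //.
  have sE i : schur B i i = D i i - (D *m r^T) i 0 * d^-1 * (r *m D) 0 i.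
    rewrite /schur ulE invmx_scalar BE block_mxKdr block_mxKdl block_mxKur mxE; congr (_ + _).
    move: (D *m r^T) (r *m D) => X Y; rewrite mul_mx_scalar -scalemxAl [LHS]mxE; congr (- _).
    by rewrite [LHS]mxE [X in _ * X]mxE big_ord1; ring.
  have d0 := unit_neq0 ud; have dV := unitVring ud.
  have ab2 (x y : K) : one_mod2 x -> one_mod2 y -> x + y \in idl K 1.
    move=> /one_mod2P x1 /one_mod2P y1; have -> : x + y = (x - 1) + (y - 1) + 2 * 1 by ring.
    by do ?apply: rpredD => //; apply: idl_two; exact: valring1.
  apply: ord2P; rewrite /= sE !mul2E !mxE /=.
  - have -> : b - (b * 1 + 0 * 1) * d^-1 * (1 * b + 1 * 0) = b / d * (a + c).
      by rewrite /d in d0 *; field.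
    by apply: idlMl; [inR|exact: ab2].
  - have -> : c - (0 * 1 + c * 1) * d^-1 * (1 * 0 + 1 * c) = c / d * (a + b).
      by rewrite /d in d0 *; field.
    by apply: idlMl; [inR|exact: ab2].
by rewrite -eA; apply: (qequiv_trans (qequiv_sym BA)); rewrite -/d /qf1 -ulE.
Qed.

(** Peel off a unit diagonal entry and classify the complement; should three odd squares accumulate,
    [three_squares] trades two of them for an even plane. *)
Lemma unimod_class n (A : 'M[K]_n) : unimodular (QForm A) ->
  [\/ exists e, type0 e (QForm A), exists a e, type1 a e (QForm A)
    | exists a b e, type2 a b e (QForm A)].
Proof.
elim: n A => [|n IH] A uA.
  by constructor 1; apply: even_class => //; case.
case: (pselect (evenform (QForm A))) => [eA|nA].
  by constructor 1; apply: even_class.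
have [/= sA AR dA] := uA.
have [j uj] : exists j, valunit (A j j).
  apply: contrapT => hn; apply: nA => i; apply/negPn/negP => h; apply: hn; exists i.
  by rewrite valunitE h andbT; exact/mxOverP.
pose B : 'M[K]_(1 + n) := \matrix_(i, l) A (tperm 0 j i) (tperm 0 j l).
have BA : qequiv (QForm B) (QForm A) by exact: qequiv_tperm.
have uB := unimod_equiv (qequiv_sym BA) uA.
have ulE : ulsubmx B = (A j j)%:M.
  apply/matrixP => i l; rewrite !ord1 !mxE eqxx mulr1n.
  have -> : lshift n (0 : 'I_1) = 0 :> 'I_(1 + n) by apply: val_inj.
  by rewrite tpermL.
have du : valunit (\det (ulsubmx B)) by rewrite ulE det_scalar1.
have [eq uS] := split_block uB du.
have [a a1 ua] := qf1_scale uj.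
have h S : qequiv (QForm (schur B)) S -> qequiv (QForm A) (qfadd (qf1 a) S).
  move=> hS; apply: (qequiv_trans (qequiv_sym BA)); apply: (qequiv_trans eq).
  by apply: qequiv_add hS; rewrite ulE.
case: (IH _ uS) => [[e [P pP SP]]|[b [e [b1 [P pP SP]]]]|[b [c [e [b1 c1 [P pP SP]]]]]].
- by constructor 2; exists a, e; split=> //; exists P => //; apply: h.
- by constructor 3; exists a, b, e; split=> //; exists P => //; apply: h.
have [Y [uY eY hY]] := three_squares a1 b1 c1.
have [uP eP _] := planes_props pP.
have [e' [P' pP' YP]] : exists e', type0 e' (qfadd (QForm Y) P) by apply: plane_add pP.
constructor 2; exists (a + b + c), e'; split; first exact: one_mod2D.
exists P' => //; apply: (qequiv_trans (h _ SP)).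
apply: (qequiv_trans (Q := qfadd (qfadd (qf1 (a + b + c)) (QForm Y)) P)).
  apply: qequiv_trans (qequiv_add hY (qequiv_refl P)).
  apply: qequiv_sym; apply: (qequiv_trans (qequiv_assoc _ _ _)).
  by apply: qequiv_add (qequiv_refl _) _; exact: qequiv_assoc.
by apply: (qequiv_trans (qequiv_assoc _ _ _)); exact: qequiv_add (qequiv_refl _) YP.
Qed.

Lemma Ival_ex (C : fieldType) (t : C) Q0 Q1 Q2 : unimodular Q0 -> unimodular Q1 ->
  exists z, Ival t Q0 Q1 Q2 z.
Proof.
case: Q0 Q1 => n0 A0 [n1 A1] u0 u1.
have cl1 : [\/ exists e, type0 e (QForm A1), exists a e, type1 a e (QForm A1)
    | exists a b e, type2 a b e (QForm A1)] by apply: unimod_class.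
case: (unimod_class u0) => [[e t0]|[a [e t0]]|[a [b [e t0]]]].
- case: (pselect (normR (QForm A1))) => h; eexists; [exact: IvalA2 t0 h|exact: IvalA1 t0 h].
- case: (pselect (normR (QForm A1))) => h; eexists; [exact: IvalB2 t0 h|exact: IvalB1 t0 h].
case: (boolP (dvdR 4 (a + b))) => h4.
  case: (pselect (normR Q2)) => n2.
    case: (pselect (normR (QForm A1))) => h; eexists; [exact: IvalC6 t0 h4 h n2|exact: IvalC2 t0 h4 h n2].
  case: cl1 => [[e1 t1]|[c [e1 t1]]|[c [d [e1 t1]]]].
  - by eexists; exact: IvalC1 t0 h4 t1 n2.
  - by eexists; exact: IvalC3 t0 h4 t1 n2.
  case: (boolP (dvdR 4 (a + b + c + d))) => h4'.
  - by eexists; exact: IvalC4 t0 h4 t1 h4' n2.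
  - by eexists; exact: IvalC5 t0 h4 t1 h4' n2.
case: (pselect (normR (QForm A1))) => n1'; last by eexists; exact: IvalD1 t0 h4 n1'.
case: (pselect (normR Q2)) => n2; first by eexists; exact: IvalD5 t0 h4 n1' n2.
case: cl1 => [[e1 t1]|[c [e1 t1]]|[c [d [e1 t1]]]].
- by case/(not_normRP (unimod_symint u1)): (type0_even t1).
- by eexists; exact: IvalD2 t0 h4 t1 n2.
case: (boolP (dvdR 4 (a + b + c + d))) => h4'.
- by eexists; exact: IvalD3 t0 h4 t1 h4' n2.
- by eexists; exact: IvalD4 t0 h4 t1 h4' n2.
Qed.

Lemma Iq_Ival (C : fieldType) (t : C) Q0 Q1 Q2 : unimodular Q0 -> unimodular Q1 ->
  Ival t Q0 Q1 Q2 (Iq t Q0 Q1 Q2).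
Proof. by move=> u0 u1; have [z hz] := Ival_ex t Q2 u0 u1; apply: (xgetPex 0); exists z. Qed.

End Classification.

(** * The recursion by halving *)

Section Recursion.
Variables (K : dyadicField) (C : numFieldType) (M : nat) (t : C).
Hypothesis M2 : (2 < M)%N.
Implicit Types (P S A B : qform K) (G : K -> C).
Local Notation R := (@valring K).
Local Notation q := ((resq K)%:R : C).
Hypothesis tq : 1 - t / q != 0.
Local Notation iot := (iota_q K t).
Local Notation zt := (ztrunc (K := K) t).

Lemma local_Iq A B Q2 i : unimodular A -> unimodular B ->
  (normR Q2 /\ i = 2%N) \/ (~ normR Q2 /\ i = 3%N) ->
  distp M A (dist M (qfscale (2 ^+ 1) B) (zt i)) 0 = Iq t A B Q2.
Proof.
move=> uA uB; have [d [e [h1 h2 h3]]] := resF_basis K.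
have [c1 c2 c3 c4] := trace_char_props h1 h2 h3 C.
exact: (local_integral M2 tq c1 c2 c3 c4 uA uB (Iq_Ival t Q2 uA uB)).
Qed.

Lemma scale_ring j S : symint S -> qmx (qfscale (2 ^+ j) S) \is a mxOver R.
Proof. by move=> hS; case: (symint_scale (valringX j (ring_two K)) hS). Qed.

(** By [distp_unif] with e = 1 the primitive vectors of [A] see the function only through its
    average over 8 R, that is level 2 or 3 according to the norm of Q_2. The other vectors form the
    second term. *)
Lemma state_step A B Q2 G i : unimodular A -> unimodular B -> per M G ->
  (forall x, x \in R -> unif M 3 G x = zt i x) ->
  (normR Q2 /\ i = 2%N) \/ (~ normR Q2 /\ i = 3%N) ->
  dist M A (dist M (qfscale (2 ^+ 1) B) G) 0 = Iq t A B Q2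
   + (q ^+ rk A)^-1 * dist M (qfscale 4 A) (dist M (qfscale (2 ^+ 1) B) G) 0.
Proof.
move=> uA uB pG hG hi; have hA := unimod_symint uA; have BR := scale_ring 1 (unimod_symint uB).
have pD : per M (dist M (qfscale (2 ^+ 1) B) G) by apply: per_dist.
rewrite (dist_split M2 hA pD) ?valring0 //; congr (_ + _).
rewrite (distp_unif M2 (e := 1) uA) ?valring0 //; last first.
  by move=> j; rewrite expr1; apply: idl_two; case: hA => _ /mxOverP.
rewrite -(local_Iq uA uB hi); apply: distp_ext; rewrite ?valring0 //; first by case: hA.
by move=> x xR; rewrite -dist_unif; apply: dist_ext.
Qed.

(** The effect of one halving on the function. The relation survives convolution when the form on
    the left is scaled twice as much ([doubles_dist]). *)
Definition doubles G G' := forall x, x \in R -> G (2 * x) = t * G' x.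

Lemma doubles_dist a S G G' : a \in R -> qmx S \is a mxOver R -> doubles G G' ->
  doubles (dist M (qfscale (2 * a) S) G) (dist M (qfscale a S) G').
Proof.
move=> aR SR h x xR; rewrite /dist -meanZ; apply: mean_ext => y yR.
rewrite !qeval_scale -mulrA -mulrDr h //; apply: valringD => //; apply: valringM => //.
exact: qeval_ring.
Qed.

Lemma doubles_zt j : doubles (zt j.+1) (zt j).
Proof. by move=> x xR; rewrite ztruncS2. Qed.

Lemma dist_scale1 S G c : dist M (qfscale 1 S) G c = dist M S G c.
Proof. by rewrite dist_scale /dist; apply: mean_ext => x _; rewrite add0r mul1r. Qed.

Lemma dist_scale0 a G c : dist M (qfscale a (qf0 K)) G c = G c.
Proof. by rewrite dist_scale dist0 mulr0 addr0. Qed.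

Lemma dist_big a (Q : nat -> qform K) (r : seq nat) (p : pred nat) G c :
  dist M (qfscale a (\big[@qfadd K/qf0 K]_(i <- r | p i) Q i)) G c =
  foldr (fun i H => dist M (qfscale a (Q i)) H) G [seq i <- r | p i] c.
Proof.
elim: r c => [|i r IH] c; first by rewrite big_nil dist_scale0.
rewrite big_cons /=; case: (p i) => //=.
by rewrite dist_scale_add; apply: mean_ext => x _; rewrite IH.
Qed.

Lemma dist_big1 (Q : nat -> qform K) (r : seq nat) G c :
  dist M (\big[@qfadd K/qf0 K]_(i <- r) Q i) G c = foldr (fun i H => dist M (Q i) H) G r c.
Proof.
elim: r c => [|i r IH] c; first by rewrite big_nil dist0.
by rewrite big_cons /= dist_add; apply: mean_ext => x _; rewrite IH.
Qed.

Section Family.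
Variable Q : nat -> qform K.
Hypothesis uQ : forall i, unimodular (Q i).

Lemma unimod_par j : unimodular (Qpar Q j).
Proof. by apply: big_ind => //; [exact: unimod0|exact: unimod_add]. Qed.

Lemma parS j : [seq i <- index_iota 0 j.+3 | odd i == odd j.+2] =
  [seq i <- index_iota 0 j.+1 | odd i == odd j] ++ [:: j.+2].
Proof.
rewrite /index_iota !subn0 -[j.+3]addn2 -[(j.+1 + 2)%N]/(j.+1 + 2)%N iotaD filter_cat add0n /=.
rewrite negbK eqxx; have -> : (~~ odd j == odd j) = false by case: (odd j).
by [].
Qed.

Lemma dist_par a j G c : dist M (qfscale a (Qpar Q j.+2)) G c =
  dist M (qfscale a (Qpar Q j)) (dist M (qfscale a (Q j.+2)) G) c.
Proof. by rewrite !dist_big parS foldr_cat. Qed.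

Definition tail i n G : K -> C :=
  foldr (fun j H => dist M (qfscale (2 ^+ (j - i)) (Q j)) H) G (iota i.+2 n).

(* The form left after [i] halvings, [Q_(i) + 2 Q_(i+1) + sum_(j >= i+2) 2^(j-i) Q_j]; the
   parameter [n] only bounds the number of summands kept. *)
Definition state i n G : C :=
  dist M (Qpar Q i) (dist M (qfscale (2 ^+ 1) (Qpar Q i.+1)) (tail i n G)) 0.

Lemma tail_per i n G : per M G -> per M (tail i n G).
Proof.
move=> pG; rewrite /tail; elim: (iota _ _) => //= j r IH; apply: per_dist => //.
exact/scale_ring/unimod_symint.
Qed.

Lemma tail_unif i n j G c : unif M j (tail i n G) c = tail i n (unif M j G) c.
Proof.
rewrite /tail; elim: (iota _ _) c => //= l r IH c.
by rewrite -dist_unif; apply: mean_ext => x _; rewrite IH.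
Qed.

Lemma tail_ext i n G G' c : c \in R -> (forall x, x \in R -> G x = G' x) ->
  tail i n G c = tail i n G' c.
Proof.
move=> cR h; rewrite /tail; elim: (iota _ _) c cR => [|l r IH] c cR /=; first exact: h.
by apply: dist_ext => //; exact/scale_ring/unimod_symint.
Qed.

Lemma dist_scale_id m j S G c : symint S -> (m <= j)%N -> per m G -> c \in R ->
  dist M (qfscale (2 ^+ j) S) G c = G c.
Proof.
move=> hS mj pG cR; apply: (dist_id M _ pG) => //; first exact: scale_ring.
move=> x xR; rewrite qeval_scale; apply: (idl_le mj); apply: idl2X.
by apply: qeval_ring => //; case: hS.
Qed.

Lemma tail_id i n m G c : per m G -> (m <= 2)%N -> c \in R -> tail i n G c = G c.
Proof.
move=> pG m2 cR; rewrite /tail.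
have : all (fun j => i.+2 <= j)%N (iota i.+2 n) by apply/allP => j; rewrite mem_iota => /andP[].
elim: (iota _ _) c cR => [|l r IH] c cR //= /andP[hl hr].
rewrite (dist_ext _ (G' := G)) //; last by move=> x xR; apply: IH.
  apply: (dist_scale_id (m := m)) => //; first exact: unimod_symint.
  by rewrite (leq_trans m2) // leq_subRL ?addn2 // (leq_trans _ hl) // -addn2 leq_addr.
exact/scale_ring/unimod_symint.
Qed.

(** Runs over the indices of [tail i.+1 n], but with scales twice as large. The summand i + 2 is
    left out because after halving it joins the main part of the form. *)
Definition tailS i n G : K -> C :=
  foldr (fun j H => dist M (qfscale (2 ^+ (j - i)) (Q j)) H) G (iota i.+3 n).

Lemma tailE i n G c : tail i n.+1 G c = dist M (qfscale (2 ^+ 2) (Q i.+2)) (tailS i n G) c.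
Proof. by rewrite /tail /= (_ : (i.+2 - i)%N = 2%N) //; lia. Qed.

Lemma tailS_id i n c : c \in R -> tailS i n (zt 3) c = zt 3 c.
Proof.
move=> cR; rewrite /tailS.
have : all (fun j => i.+3 <= j)%N (iota i.+3 n) by apply/allP => j; rewrite mem_iota => /andP[].
elim: (iota _ _) c cR => [|l r IH] c cR //= /andP[hl hr].
rewrite (dist_ext _ (G' := zt 3)) //; last by move=> x xR; apply: IH.
  apply: (dist_scale_id (m := 3)) => //; [exact: unimod_symint| |exact: ztrunc_per].
  by rewrite leq_subRL ?addn3 // (leq_trans _ hl) // -addn3 leq_addr.
exact/scale_ring/unimod_symint.
Qed.

(** At level 3 the summands beyond i + 2 are multiples of 8 and vanish; 4 Q_(i+2) is visible through
    its norm alone. *)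
Lemma tail_zt3 i n c : c \in R ->
  exists2 l, (normR (Q i.+2) /\ l = 2%N) \/ (~ normR (Q i.+2) /\ l = 3%N)
   & tail i n.+1 (zt 3) c = zt l c.
Proof.
move=> cR; have hQ := unimod_symint (uQ i.+2).
rewrite tailE (dist_ext _ (G' := zt 3)) //; [|exact: scale_ring|by move=> x; exact: tailS_id].
case: (pselect (normR (Q i.+2))) => h.
  exists 2%N; first by left.
  by rewrite dist_normR2X //; [rewrite unif_ztrunc|exact: ztrunc_per].
exists 3%N; first by right.
by rewrite dist_even2X //; [exact: (proj1 (not_normRP hQ) h)|exact: ztrunc_per].
Qed.

Lemma tail_doubles i n G G' : doubles G G' -> doubles (tailS i n G) (tail i.+1 n G').
Proof.
rewrite /tailS /tail => h.
have : all (fun j => i < j)%N (iota i.+3 n).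
  by apply/allP => j; rewrite mem_iota => /andP[/ltnW/ltnW].
elim: (iota _ _) => //= j r IH /andP[ij hr].
rewrite (_ : 2 ^+ (j - i) = 2 * 2 ^+ (j - i.+1) :> K); last by rewrite -exprS subnSK.
apply: doubles_dist; [exact: valringX (ring_two K)|by case: (unimod_symint (uQ j))|exact: IH].
Qed.

Lemma state_double i n G G' : doubles G G' ->
  dist M (qfscale 4 (Qpar Q i)) (dist M (qfscale (2 ^+ 1) (Qpar Q i.+1)) (tail i n.+1 G)) 0 =
  t * state i.+1 n G'.
Proof.
move=> h; have [_ A_R] := unimod_symint (unimod_par i).
have [_ B_R] := unimod_symint (unimod_par i.+1); have [_ QR] := unimod_symint (uQ i.+2).
have tE : tail i n.+1 G = dist M (qfscale (2 * 2) (Q i.+2)) (tailS i n G).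
  by apply: funext => x; rewrite tailE; congr (dist M (qfscale _ _) _ _); rewrite expr2.
have h2 := doubles_dist (ring_two K) QR (tail_doubles i n h).
have h1 := doubles_dist (valring1 K) B_R h2.
have h0 := doubles_dist (ring_two K) A_R h1.
have := h0 0 (valring0 K); rewrite mulr0 -tE => e.
transitivity (t * dist M (qfscale 2 (Qpar Q i)) (dist M (qfscale 1 (Qpar Q i.+1))
   (dist M (qfscale 2 (Q i.+2)) (tail i.+1 n G'))) 0).
  rewrite -e (_ : 4 = 2 * 2 :> K); last by ring.
  by rewrite expr1 mulr1.
(* After halving, 2 Q_(i) and 2 Q_(i+2) are regrouped as twice [Qpar Q i.+2], and the two main forms
   exchange roles. *)
congr (_ * _); rewrite dist_comm dist_scale1 /state.
by apply: mean_ext => x _; rewrite expr1 -dist_par.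
Qed.

Lemma state_zt3 i n j : (j.+3 <= M)%N -> state i n.+1 (zt j.+3) =
  Iq t (Qpar Q i) (Qpar Q i.+1) (Q i.+2)
  + (q ^+ rk (Qpar Q i))^-1 * (t * state i.+1 n (zt j.+2)).
Proof.
move=> jM; rewrite -(state_double i n (@doubles_zt j.+2)).
have pG : per M (tail i n.+1 (zt j.+3)).
  by apply: tail_per; exact: per_le jM (@ztrunc_per K C t j.+3).
have hl x : x \in R -> unif M 3 (tail i n.+1 (zt j.+3)) x = tail i n.+1 (zt 3) x.
  move=> xR; rewrite tail_unif; apply: tail_ext => // y yR; rewrite unif_ztrunc //.
case: (pselect (normR (Q i.+2))) => h.
  apply: (state_step (i := 2)) => //; [exact: unimod_par|exact: unimod_par| |by left].
  move=> x xR; rewrite hl //; have [l [[_ ->]|[]]] := tail_zt3 i n xR => //.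
apply: (state_step (i := 3)) => //; [exact: unimod_par|exact: unimod_par| |by right].
by move=> x xR; rewrite hl //; have [l [[]|[_ ->]]] := tail_zt3 i n xR.
Qed.

Lemma unimod_qf1 (a : K) : valunit a -> unimodular (qf1 a).
Proof.
move=> ua; have [s h] := symint_qf1 (unit_ring ua).
by split=> //=; rewrite det_scalar1.
Qed.

Lemma normR_qf1 : normR (qf1 (1 : K)).
Proof.
apply/(normRP (symint_qf1 (valring1 K))); exists 0.
by rewrite mxE eqxx mulr1n unit1.
Qed.

(** Truncation at level 2 hides the whole tail, exactly as a form 4 Q_2 of norm R would do at level
    3; the rank-one form of coefficient 1 stands for it. *)
Lemma state_zt2 i n : state i n.+1 (zt 2) =
  Iq t (Qpar Q i) (Qpar Q i.+1) (qf1 1)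
  + (q ^+ rk (Qpar Q i))^-1 * (t * state i.+1 n (zt 1)).
Proof.
rewrite -(state_double i n (@doubles_zt 1)).
have p2 : per 2 (zt 2) := @ztrunc_per K C t 2.
have pG : per M (tail i n.+1 (zt 2)) by apply: tail_per; apply: per_le p2; exact: ltnW.
apply: (state_step (i := 2)) => //; [exact: unimod_par|exact: unimod_par| |left; split=> //; exact: normR_qf1].
move=> x xR; rewrite tail_unif (tail_ext _ _ (G' := zt 2)) ?(tail_id _ _ (m := 2)) // => y yR.
by apply: unif_id => //; apply: per_le p2.
Qed.

(** At level 1 the form 2 Q_(i+1) is hidden as well. A rank-one form in its place has the same
    effect, since doubling it lowers level 2 to level 1 ([inner2_normR]). *)
Lemma state_zt1 i n : state i n (zt 1) =
  Iq t (Qpar Q i) (qf1 1) (qf1 1) + (q ^+ rk (Qpar Q i))^-1 * (t * iot).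
Proof.
have uA := unimod_par i; have hA := unimod_symint uA; have [_ A_R] := hA.
have p1 : per 1 (zt 1) := @ztrunc_per K C t 1.
have hB := unimod_symint (unimod_par i.+1).
transitivity (dist M (Qpar Q i) (zt 1) 0).
  apply: dist_ext => //; first exact: valring0.
  move=> x xR; rewrite (dist_ext _ (G' := zt 1)) //; first last.
  - by move=> y yR; apply: (tail_id _ _ (m := 1)).
  - exact: scale_ring.
  by apply: (dist_scale_id (m := 1)).
rewrite (dist_split M2 hA) ?valring0 //; last by apply: per_le p1; exact: ltn_trans M2.
congr (_ + _ * _); last first.
  rewrite (_ : 4 = 2 ^+ 2 :> K); last by ring.
  by rewrite (dist_scale_id (m := 1)) ?valring0 // ztrunc1_idl // rpred0.
rewrite -(local_Iq uA (unimod_qf1 (unit1 K)) (i := 2)); last by left; split=> //; exact: normR_qf1.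
apply: distp_ext; rewrite ?valring0 // => x xR; rewrite inner2_normR //.
  exact/symint_qf1/valring1.
exact: normR_qf1.
Qed.

Lemma state_zt0 i n : state i n (zt 0) = iot.
Proof.
rewrite /state /dist -[RHS](mean_cst K M (rk (Qpar Q i))); apply: mean_ext => x _.
rewrite -[RHS](mean_cst K M (rk (Qpar Q i.+1))); apply: mean_ext => y _.
rewrite /tail; elim: (iota _ _) (_ + _ + _) => //= l r IH z.
by rewrite -[RHS](mean_cst K M (rk (Q l))); apply: mean_ext => w _; rewrite IH.
Qed.

Definition weight i : C := t ^+ i / (qpar Q i)%:R.

Lemma weightS i : weight i.+1 = weight i * ((q ^+ rk (Qpar Q i))^-1 * t).
Proof.
rewrite /weight /qpar big_nat_recr //= expnD natrM invfM exprS !natrX.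
by rewrite mulrCA mulrA [in RHS]mulrC; ring.
Qed.

Lemma weight0 : weight 0 = 1.
Proof. by rewrite /weight /qpar big_geq // expn0 invr1 mulr1. Qed.

(** Each step consumes one tail summand and one truncation level; stopping at [j.+2] leaves a level
    of at least 2 for the terminal formulas. *)
Lemma state_unroll m n j : (m + j.+2 <= M)%N -> state 0 (m + n) (zt (m + j.+2)) =
  \sum_(0 <= i < m) weight i * Iq t (Qpar Q i) (Qpar Q i.+1) (Q i.+2)
  + weight m * state m n (zt j.+2).
Proof.
elim: m n j => [|m IH] n j mM; first by rewrite big_geq // weight0 mul1r add0r.
have e : (m.+1 + j.+2 = m + j.+3)%N by rewrite addSnnS.
rewrite e in mM *; rewrite addSnnS IH //.
rewrite big_nat_recr //= state_zt3; last by apply: leq_trans mM; rewrite leq_addl.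
by rewrite weightS; ring.
Qed.

(** The tail starts at index 2, so [w.-1] summands reach Q_w. The further [n] ones are zero forms,
    padding that lets the recursion run past omega. *)
Lemma dist_qftotal n w G : (0 < w)%N -> (forall i, (w < i)%N -> Q i = qf0 K) ->
  dist M (qftotal Q w) G 0 = state 0 (w.-1 + n) G.
Proof.
move=> w0 Qw; rewrite /qftotal dist_big1 /index_iota subn0.
rewrite -[w in iota 0 w.+1](prednK w0) /= /state.
have p0 (H : K -> C) c : dist M (Qpar Q 0) H c = dist M (qfscale (2 ^+ 0) (Q 0%N)) H c.
  by rewrite -dist_scale1 dist_big.
have p1 (H : K -> C) c : dist M (qfscale (2 ^+ 1) (Qpar Q 1)) H c = dist M (qfscale (2 ^+ 1) (Q 1%N)) H c.
  by rewrite dist_big.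
rewrite p0; apply: mean_ext => x _; rewrite p1; apply: mean_ext => y _.
rewrite /tail iotaD foldr_cat; move: (_ + _ + _) => z.
have -> : foldr (fun j H => dist M (qfscale (2 ^+ (j - 0)) (Q j)) H) G (iota (2 + w.-1) n) = G.
  have : all (fun j => w < j)%N (iota (2 + w.-1) n).
    by apply/allP => j; rewrite mem_iota add2n prednK // => /andP[].
  elim: (iota _ _) => //= j r IH /andP[wj /IH ->].
  by apply: funext => u; rewrite Qw // dist_scale0.
elim: (iota _ _) z => //= j r IH z; rewrite subn0; apply: mean_ext => u _; exact: IH.
Qed.

(** The state once the tail is exhausted: two forms are left and merely alternate, which produces
    the period 2. *)
Definition pairsum A B j : C := dist M A (dist M (qfscale (2 ^+ 1) B) (zt j)) 0.

Lemma not_normR_qf0 : ~ normR (qf0 K).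
Proof. by apply/(not_normRP (unimod_symint (unimod0 K))); case. Qed.

Lemma pairsum_step A B j : unimodular A -> unimodular B -> (j.+3 <= M)%N ->
  pairsum A B j.+3 = Iq t A B (qf0 K) + (q ^+ rk A)^-1 * (t * pairsum B A j.+2).
Proof.
move=> uA uB jM; have [_ A_R] := unimod_symint uA; have [_ B_R] := unimod_symint uB.
rewrite /pairsum (@state_step A B (qf0 K) _ 3) //; first last.
- by right; split=> //; exact: not_normR_qf0.
- by move=> x xR; rewrite unif_ztrunc.
- exact: per_le jM (@ztrunc_per K C t j.+3).
congr (_ + _ * _).
have h1 := doubles_dist (valring1 K) B_R (@doubles_zt j.+2).
have h0 := doubles_dist (ring_two K) A_R h1.
have := h0 0 (valring0 K); rewrite mulr0 => e.
transitivity (t * dist M (qfscale 2 A) (dist M (qfscale 1 B) (zt j.+2)) 0).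
  rewrite -e (_ : 4 = 2 * 2 :> K); last by ring.
  by rewrite expr1 mulr1.
by congr (_ * _); rewrite dist_comm dist_scale1 expr1.
Qed.

Lemma state_pairsum w n j : (forall i, (w < i)%N -> Q i = qf0 K) -> (0 < w)%N ->
  state w.-1 n (zt j) = pairsum (Qpar Q w.-1) (Qpar Q w) j.
Proof.
move=> Qw w0; rewrite /state prednK // /pairsum; congr (dist M _ (dist M _ _) _).
rewrite /tail.
have : all (fun j => w < j)%N (iota w.-1.+2 n).
  by apply/allP => l; rewrite mem_iota prednK // => /andP[].
elim: (iota _ _) => //= l r IH /andP[wl /IH ->].
by apply: funext => u; rewrite Qw // dist_scale0.
Qed.

Lemma rk_par j : rk (Qpar Q j) = (\sum_(0 <= i < j.+1 | odd i == odd j) rk (Q i))%N.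
Proof. by apply: (big_morph (@rk K)). Qed.

Lemma rk_par_pair w : (0 < w)%N ->
  (rk (Qpar Q w.-1) + rk (Qpar Q w) = \sum_(0 <= i < w.+1) rk (Q i))%N.
Proof.
case: w => // w _; rewrite [RHS](bigID (fun i => odd i == odd w.+1)) /= addnC !rk_par; congr (_ + _)%N.
rewrite [RHS]big_mkcond big_nat_recr //= eqxx /= addn0 -big_mkcond; apply: eq_bigl => i.
by case: (odd i); case: (odd w).
Qed.

End Family.

End Recursion.

(** * Haar integrals *)

Section HaarIntegral.
Variables (K : dyadicField) (RR : realType) (n : nat).
Variable mu : {measure set borelKn K n -> \bar RR}.
Hypothesis Hmu : haar mu.
Local Notation R := (@valring K).
Local Notation q := ((resq K)%:R : RR).
Local Notation T M := (M.-tuple (resF K)).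
Local Notation rep M d := (map_mx (fun d : T M => expansion d) d).
Local Open Scope classical_set_scope.

Lemma open_measurable_Kn (U : set (borelKn K n)) : @openKn K n U -> measurable U.
Proof. by move=> oU; apply: sub_sigma_algebra. Qed.

Definition coset M (x : 'rV[K]_n) : set (borelKn K n) :=
  [set y | (y : 'rV[K]_n) - x \is a mxOver (idl K M)].

Lemma near_coset M (x y : 'rV[K]_n) :
  (forall i, dvdR (2 ^+ M) (y 0 i - x 0 i)) -> y - x \is a mxOver (idl K M).
Proof.
by move=> h; apply/mxOverP => i j; rewrite !mxE ord1 -dvdR2X.
Qed.

Lemma coset_open M x : @openKn K n (coset M x).
Proof.
move=> y xy; exists M => z /near_coset zy.
by rewrite /coset /= -[z](subrK y) -addrA rpredD.
Qed.

Lemma coset_translate M x : coset M x = [set x + (y : 'rV[K]_n) | y in coset M 0].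
Proof.
apply/seteqP; split=> y /=.
  by move=> xy; exists (y - x); rewrite /coset /= ?subr0 // addrC subrK.
by case=> z; rewrite /coset /= subr0 => z0 <-; rewrite addrC addKr.
Qed.

Lemma Rn_open : @openKn K n (@Rn K n).
Proof.
move=> x xR; exists 0%N => y /near_coset yx; by rewrite /Rn /= -[y](subrK x) rpredD.
Qed.

Lemma Rn_cosets M : @Rn K n = \big[setU/set0]_(d <- enum {: 'rV[T M]_n}) coset M (rep M d).
Proof.
apply/seteqP; split=> x /=.
  move=> xR; rewrite -bigcup_seq; exists (map_mx (digits M) x); first by rewrite /= mem_enum.
  by apply/mxOverP => i j; rewrite !mxE; apply: digitsP; move/mxOverP: xR; apply.
rewrite -bigcup_seq => -[d _ xd]; rewrite /Rn /= -[x](subrK (rep M d)) rpredD //.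
  by apply/mxOverP => i j; apply: (@idl_ring K M); move/mxOverP: xd; apply.
exact: map_expansion_ring.
Qed.

Lemma coset_trivIset M (A : set 'rV[T M]_n) : trivIset A (fun d => coset M (rep M d)).
Proof.
move=> d e _ _ [x [/mxOverP xd /mxOverP xe]]; apply/matrixP => i j.
apply: expansion_inj; have := rpredB (xe i j) (xd i j); rewrite !mxE.
by rewrite (_ : _ - _ - _ = expansion (d i j) - expansion (e i j)) //; ring.
Qed.

Lemma measurable_Rn : measurable (@Rn K n : set (borelKn K n)).
Proof. by apply: open_measurable_Kn; exact: Rn_open. Qed.

Lemma measurable_coset M x : measurable (coset M x).
Proof. by apply: open_measurable_Kn; exact: coset_open. Qed.

(** Off [Z] the function is locally constant, so preimages are open there, and [Z] as a whole falls
    in the preimage or in its complement. This fits |f|^s, which is locally constant only away from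
    the zeros of f. *)
Lemma measurable_off_zeros (Z : set 'rV[K]_n) (c : RR) (g : borelKn K n -> RR) :
  (forall x : 'rV[K]_n, x \is a mxOver R -> ~ Z x -> exists m, forall y : 'rV[K]_n,
     y - x \is a mxOver (idl K m) -> ~ Z y /\ g y = g x) ->
  (forall x, Z x -> g x = c) -> measurable_fun (@Rn K n : set (borelKn K n)) g.
Proof.
move=> gloc gZ _ Y _.
pose U W : set (borelKn K n) := [set x | [/\ Rn x, ~ Z x & W (g x)]].
have oU W : measurable (U W).
  apply: open_measurable_Kn => x [xR xZ xW]; have [m hm] := gloc x xR xZ.
  exists m => y /near_coset yx; have [yZ yE] := hm y yx; split=> //; last by rewrite yE.
  rewrite /Rn /= -[y](subrK x) rpredD //.
  by apply/mxOverP => i j; apply: (@idl_ring K m); move/mxOverP: yx; apply.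
case: (pselect (Y c)) => Yc; last first.
  rewrite (_ : _ `&` _ = U Y) //; apply/seteqP; split=> x /=; last by case.
  by move=> [xR xY]; split=> // xZ; move: xY; rewrite gZ.
rewrite (_ : _ `&` _ = Rn (n:=n) `\` U (~` Y)); first by apply: measurableD => //; exact: measurable_Rn.
apply/seteqP; split=> x /= [xR]; first by move=> xY; split=> // -[].
move=> xU; split=> //; apply: contrapT => xY; apply: xU; split=> // xZ.
by apply: xY; rewrite gZ.
Qed.

Lemma measurable_perv M (g : 'rV[K]_n -> RR) : perv M g ->
  measurable_fun (@Rn K n : set (borelKn K n)) (g : borelKn K n -> RR).
Proof.
move=> pg; apply: (@measurable_off_zeros set0 0) => // x xR _; exists M => y yx; split=> //.
apply: pg => //; rewrite -[y](subrK x) rpredD //.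
by apply/mxOverP => i j; apply: (@idl_ring K M); move/mxOverP: yx; apply.
Qed.

Lemma integral_cosets M (g : 'rV[K]_n -> RR) : perv M g ->
  (\int[mu]_(x in @Rn K n) (g x)%:E =
   \sum_(d : 'rV[T M]_n) ((g (rep M d))%:E * mu (coset M 0)))%E.
Proof.
move=> pg; rewrite (Rn_cosets M) integral_bigsetU_EFin; first last.
- by rewrite -Rn_cosets; apply/measurable_EFinP; exact: measurable_perv pg.
- exact: coset_trivIset.
- exact: enum_uniq.
- by move=> d; exact: measurable_coset.
rewrite big_enum /=; apply: eq_bigr => d _.
rewrite -[in RHS]((proj2 Hmu) (rep M d) _ (measurable_coset M 0)) -coset_translate.
rewrite -integral_cst; last exact: measurable_coset.
apply: eq_integral => x; rewrite inE /coset /= => xd; congr (_%:E).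
have dR := map_expansion_ring d; apply: pg => //.
rewrite -[x](subrK (rep M d)) rpredD //.
by apply/mxOverP => i j; apply: (@idl_ring K M); move/mxOverP: xd; apply.
Qed.

(** The q^(M n) translates of this coset partition R^n, whose measure is 1; integrating the constant
    1 gives the equation. *)
Lemma mu_coset0 M : mu (coset M 0) = ((q ^+ (M * n))^-1)%:E.
Proof.
have [mu1 _] := Hmu.
have := @integral_cosets M (fun=> 1) (fun _ _ _ _ _ => erefl).
rewrite integral_cst; last exact: measurable_Rn.
rewrite mu1 mule1.
have le1 : (mu (coset M 0) <= 1)%E.
  rewrite -mu1; apply: le_measure; rewrite ?inE; [exact: measurable_coset|exact: measurable_Rn|].
  move=> x; rewrite /coset /Rn /= subr0 => /mxOverP h; apply/mxOverP => i j; exact: (idl_ring (h i j)).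
have /fineK <- : mu (coset M 0) \is a fin_num.
  by rewrite ge0_fin_numE ?measure_ge0 // (le_lt_trans le1) // ltry.
move: (fine _) => r; under eq_bigr do rewrite mul1e.
rewrite sumEFin sumr_const card_mx card_tuple mul1n -expnM -[#|_|]/(resq K) => -[e].
congr (_%:E); apply: (mulfI (x := q ^+ (M * n))); first by rewrite expf_neq0 ?q_neq0.
by rewrite mulfV ?expf_neq0 ?q_neq0 // [RHS]e -natrX mulr_natl.
Qed.

Lemma Rintegral_mean M (g : 'rV[K]_n -> RR) : perv M g ->
  \int[mu]_(x in @Rn K n) g x = mean M g.
Proof.
move=> pg; rewrite /Rintegral (integral_cosets pg) mu_coset0.
under eq_bigr do rewrite -EFinM; rewrite sumEFin /= -mulr_suml mulrC.
by [].
Qed.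

End HaarIntegral.

(** * Complex powers of the absolute value, and the truncation error *)

Section ComplexPower.
Variable RR : realType.
Local Notation C := RR[i].
Implicit Types z : C.
Local Open Scope classical_set_scope.

Lemma cexpD z w : cexp (z + w) = cexp z * cexp w :> C.
Proof.
case: z w => [a b] [c d]; rewrite /cexp /= expRD cosD sinD; apply/eqP.
by rewrite eq_complex /=; apply/andP; split; apply/eqP; ring.
Qed.

Lemma cexp0 : cexp 0 = 1 :> C.
Proof. by rewrite -[X in cexp X]/((0 +i* 0)%C) /cexp expR0 cos0 sin0 mulr1 mulr0. Qed.

Lemma norm_cexp z : `|cexp z| = (expR (complex.Re z))%:C%C :> C.
Proof.
case: z => a b; rewrite normc_def /=; congr (_%:C)%C.
by rewrite !exprMn -mulrDr cos2Dsin2 mulr1 sqrtr_sqr ger0_norm ?expR_ge0.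
Qed.

Lemma Re_mulC (a : RR) z : complex.Re (a%:C%C * z) = a * complex.Re z.
Proof. by case: z => b c /=; rewrite mul0r subr0. Qed.

Lemma Im_mulC (a : RR) z : complex.Im (a%:C%C * z) = a * complex.Im z.
Proof. by case: z => b c /=; rewrite mul0r addr0. Qed.

Lemma ReD z w : complex.Re (z + w) = complex.Re z + complex.Re w.
Proof. by case: z w => [a b] [c d]. Qed.

Lemma ImD z w : complex.Im (z + w) = complex.Im z + complex.Im w.
Proof. by case: z w => [a b] [c d]. Qed.

Lemma norm_ge_Im z : (`|complex.Im z|)%:C%C <= `|z|.
Proof.
rewrite normc_def lecR -sqrtr_sqr; apply: ler_wsqrtr.
by rewrite lerDr sqr_ge0.
Qed.

Lemma norm_le_ReIm z : `|z| <= (`|complex.Re z|)%:C%C + (`|complex.Im z|)%:C%C.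
Proof.
rewrite -rmorphD normc_def lecR /=.
rewrite -[leRHS]ger0_norm ?addr_ge0 // -sqrtr_sqr; apply: ler_wsqrtr.
rewrite sqrrD !real_normK ?num_real //.
by rewrite lerD2r lerDl mulrn_wge0 // mulr_ge0.
Qed.

Lemma le_norm_Re (z : C) (e : C) : `|z| <= e -> `|complex.Re z| <= complex.Re e.
Proof.
move=> h; have er : e \is Num.real by rewrite (ger0_real (le_trans (normr_ge0 _) h)).
by rewrite -lecR RRe_real // (le_trans _ h) // normc_ge_Re.
Qed.

Lemma le_norm_Im (z : C) (e : C) : `|z| <= e -> `|complex.Im z| <= complex.Re e.
Proof.
move=> h; have er : e \is Num.real by rewrite (ger0_real (le_trans (normr_ge0 _) h)).
by rewrite -lecR RRe_real // (le_trans _ h) // norm_ge_Im.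
Qed.

(** Turns estimates at every level into an identity of complex numbers; the only limit involved is
    that of a real geometric sequence. *)
Lemma norm_geometric_eq0 (x t c : C) : `|t| < 1 ->
  (forall k : nat, `|x| <= c * `|t| ^+ k) -> x = 0.
Proof.
have nE (z : C) : `|z| = (complex.Re `|z|)%:C%C by rewrite RRe_real ?normr_real.
move=> t1 h; have := h 0%N; rewrite expr0 mulr1 => h0.
have c0 : 0 <= c by apply: le_trans h0; exact: normr_ge0.
have cE : c = (complex.Re c)%:C%C by rewrite RRe_real ?ger0_real.
move: t1 h c0; rewrite cE [`|t|]nE; set tau := complex.Re `|t|; set g := complex.Re c.
rewrite -[1]/(1%:C%C) ltcR => t1 h; rewrite -[0]/(0%:C%C) lecR => g0.
apply/normr0_eq0/eqP; rewrite nE; set y := complex.Re `|x|.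
have tau0 : 0 <= tau by rewrite -lecR -nE normr_ge0.
have y0 : 0 <= y by rewrite -lecR -nE normr_ge0.
suff -> : y = 0 by [].
apply/eqP; rewrite eq_le y0 andbT leNgt; apply/negP => y1.
have hk k : y <= g * tau ^+ k by have := h k; rewrite nE -rmorphXn -rmorphM lecR.
have : tau ^+ k @[k --> \oo] --> (0 : RR) by apply: cvg_expr; rewrite ger0_norm.
(* Dividing by g + 1 rather than g avoids a separate case g = 0. *)
move=> /cvgr0Pnorm_lt /(_ (y / (g + 1))) []; first by rewrite divr_gt0 // ltr_wpDl.
move=> N _ /(_ N (leqnn N)); rewrite /= ger0_norm ?exprn_ge0 // ltr_pdivlMr ?ltr_wpDl //.
move=> hN; have : y < y by apply: le_lt_trans (hk N) (le_lt_trans _ hN);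
  rewrite mulrC ler_wpM2l ?exprn_ge0 // lerDl ler01.
by rewrite ltxx.
Qed.

End ComplexPower.

Section DyadicPower.
Variables (K : dyadicField) (RR : realType) (s : RR[i]).
Hypothesis s0 : 0 < complex.Re s.
Local Notation C := RR[i].
Local Notation R := (@valring K).
Local Notation q := ((resq K)%:R : RR).
Local Notation t := (cpow q (- s)).
Local Notation P x := (cpow (@dyadic_abs K RR x) s).

Lemma q_gt1 : 1 < q.
Proof. by rewrite ltr1n resq_gt1. Qed.

Lemma cpow_neq0 (x : RR) z : 0 < x -> cpow x z = cexp ((ln x)%:C%C * z).
Proof. by move=> x0; rewrite /cpow gt_eqF. Qed.

Lemma norm_t_lt1 : `|t| < 1 :> C.
Proof.
have q1 := q_gt1; rewrite cpow_neq0 ?(lt_trans _ q1) // norm_cexp Re_mulC -[ltRHS]/(1%:C%C) ltcR.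
rewrite expR_lt1; case: s s0 => a b /= a0; rewrite mulrN oppr_lt0 mulr_gt0 //.
exact: ln_gt0.
Qed.

Lemma tq_neq0 : 1 - t / (resq K)%:R != 0 :> C.
Proof.
rewrite subr_eq0; apply/eqP => h.
have : `|t / (resq K)%:R| < 1 :> C.
  rewrite normrM normfV normr_nat (le_lt_trans _ norm_t_lt1) // ler_piMr //.
  by rewrite invf_le1 ?ltr0n ?(ltn_trans _ (resq_gt1 K)) // ler1n ltnW ?resq_gt1.
by rewrite -h normr1 ltxx.
Qed.

Lemma dyadic_abs_gt0 x : x != 0 -> 0 < @dyadic_abs K RR x.
Proof. by move=> x0; rewrite /dyadic_abs (negbTE x0) exprz_gt0 // (lt_trans _ q_gt1). Qed.

Lemma cpow_abs0 : P 0 = 0.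
Proof. by rewrite /dyadic_abs eqxx /cpow eqxx. Qed.

Lemma cpow_abs_mul2 x : P (2 * x) = t * P x.
Proof.
have [->|x0] := eqVneq x 0; first by rewrite mulr0 cpow_abs0 mulr0.
have q0 : 0 < q by rewrite (lt_trans _ q_gt1).
have xx0 : 2 * x != 0 by rewrite mulf_neq0 // two_neq0.
rewrite !cpow_neq0 ?dyadic_abs_gt0 // -cexpD; congr cexp.
have -> : dyadic_abs RR (2 * x) = q^-1 * dyadic_abs RR x.
  rewrite /dyadic_abs (negbTE xx0) (negbTE x0) (dv_M (dfieldP K)) ?two_neq0 // (dv_two (dfieldP K)).
  by rewrite opprD expfzDr ?gt_eqF // exprN1.
rewrite lnM ?posrE ?invr_gt0 ?dyadic_abs_gt0 // lnV ?posrE //.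
by rewrite rmorphD rmorphN /= mulrDl mulNr mulrN.
Qed.

Lemma cpow_abs_unit u : valunit u -> P u = 1.
Proof.
move=> /andP[u0 /eqP vu]; rewrite /dyadic_abs (negbTE u0) vu oppr0 expr0z cpow_neq0 // ln1.
by rewrite -[0%:C%C]/(0 : C) mul0r cexp0.
Qed.

Lemma norm_cpow_abs x : x \in R -> `|P x| <= 1.
Proof.
move=> xR; have [->|x0] := eqVneq x 0; first by rewrite cpow_abs0 normr0 ler01.
rewrite cpow_neq0 ?dyadic_abs_gt0 // norm_cexp -[leRHS]/(1%:C%C) lecR Re_mulC.
rewrite -expR0 ler_expR mulr_le0_ge0 //; last exact: ltW.
apply: ln_le0.
move: xR; rewrite /valring val_geE (negbTE x0) /= /dyadic_abs (negbTE x0).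
case: (vK x) => // m _; rewrite -invr_expz invf_le1 ?exprn_gt0 ?(lt_trans _ q_gt1) //.
by rewrite exprn_ege1 // ltW // q_gt1.
Qed.

Lemma dyadic_unit_factor x : x \in R -> x != 0 -> exists m u, valunit u /\ x = 2 ^+ m * u.
Proof.
rewrite /valring val_geE => /orP[/eqP->|]; first by rewrite eqxx.
case E : (vK x) => [m|//] _ x0; exists m, (x / 2 ^+ m).
have m0 : (2 : K) ^+ m != 0 by rewrite expf_neq0 ?two_neq0.
split; last by rewrite mulrC divfK.
rewrite /valunit mulf_neq0 ?invr_eq0 // andTb (dv_M (dfieldP K)) ?invr_eq0 // (valV (dfieldP K)) //.
by rewrite E (val2X (dfieldP K)); apply/eqP; exact: (subrr m%:Z).
Qed.

Lemma cpow_abs_loc x : x \in R -> x != 0 -> exists m, forall y,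
  y - x \in idl K m -> y != 0 /\ P y = P x.
Proof.
move=> xR x0; have [m [u [uu xE]]] := dyadic_unit_factor xR x0; exists m.+1 => y.
move=> /idlP[w wR yE].
have -> : y = 2 ^+ m * (u + 2 * w) by rewrite -(subrK x y) yE xE exprSr; ring.
have vu : valunit (u + 2 * w) by apply: unit_cong uu _; rewrite addrC addKr idl_two.
split; first by rewrite mulf_neq0 ?(unit_neq0 vu) ?expf_neq0 ?two_neq0.
have Pm v : valunit v -> P (2 ^+ m * v) = t ^+ m.
  move=> hv; elim: (m) => [|k IH]; first by rewrite mul1r cpow_abs_unit.
  by rewrite exprS -mulrA cpow_abs_mul2 IH -exprS.
by rewrite xE !Pm.
Qed.

(** The error at level 0 is at most 1 + |iota|, and each factor 2 multiplies it by |t|; units carry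
    no error. *)
Lemma cpow_abs_ztrunc J x : x \in R ->
  `|P x - ztrunc t J x| <= (1 + `|iota_q K t|) * `|t| ^+ J.
Proof.
elim: J x => [|J IH] x xR.
  rewrite mulr1; apply: le_trans (ler_normB _ _) _; by rewrite lerD2r norm_cpow_abs.
case: (boolP (x \in idl K 1)) => [/idlP[y yR ->]|x1]; last first.
  rewrite ztrunc_unit // cpow_abs_unit ?valunitE ?xR // subrr normr0.
  by rewrite mulr_ge0 ?addr_ge0 ?exprn_ge0.
rewrite expr1 ztruncS2 // cpow_abs_mul2 -mulrBr normrM exprS mulrCA.
by rewrite ler_wpM2l // IH.
Qed.

End DyadicPower.

Section ZetaEstimate.
Variables (K : dyadicField) (RR : realType) (n : nat).
Variable mu : {measure set borelKn K n -> \bar RR}.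
Hypothesis Hmu : haar mu.
Local Notation C := RR[i].
Local Notation R := (@valring K).
Local Notation Rn := (@Rn K n : set (borelKn K n)).
Local Open Scope classical_set_scope.

Lemma bounded_integrable (g : borelKn K n -> RR) b : measurable_fun Rn g ->
  (forall x, Rn x -> `|g x| <= b) -> mu.-integrable Rn (EFin \o g).
Proof.
move=> mg gb; apply: measurable_bounded_integrable => //; first exact: measurable_Rn.
  by rewrite (proj1 Hmu) ltry.
exists b; split; first exact: num_real.
by move=> r br x xR; apply: le_trans (gb x xR) (ltW br).
Qed.

Lemma Rintegral_near_mean M (g h : 'rV[K]_n -> RR) b e :
  measurable_fun Rn (g : borelKn K n -> RR) -> (forall x, Rn x -> `|g x| <= b) ->
  perv M h -> (forall x, Rn x -> `|g x - h x| <= e) ->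
  `|\int[mu]_(x in Rn) g x - mean M h| <= e.
Proof.
move=> mg gb ph gh; have mR := @measurable_Rn K n.
have mh := measurable_perv ph.
have hb x : Rn x -> `|h x| <= b + e.
  move=> xR; rewrite -(subKr (g x) (h x)); apply: le_trans (ler_normB _ _) _.
  by rewrite lerD ?gb ?gh.
have ig := bounded_integrable mg gb; have ih := bounded_integrable mh hb.
have igh : mu.-integrable Rn (EFin \o (fun x => g x - h x)).
  apply: (bounded_integrable (b := e)) => //; exact: measurable_funB.
rewrite -(Rintegral_mean Hmu ph) -RintegralB //.
apply: le_trans (le_normr_Rintegral mR igh) _.
have -> : e = \int[mu]_(x in Rn) e by rewrite Rintegral_cst // (proj1 Hmu) mulr1.
apply: le_Rintegral => //.
  exact: (integrable_norm igh).
by apply: (bounded_integrable (b := `|e|)) => //; exact: measurable_cst.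
Qed.

Variables (s : RR[i]) (f : 'rV[K]_n -> K).
Hypothesis s0 : 0 < complex.Re s.
Hypothesis fR : forall x, x \is a mxOver R -> f x \in R.
Hypothesis fcong : forall m x y, x \is a mxOver R -> y \is a mxOver R ->
  x - y \is a mxOver (idl K m) -> f x - f y \in idl K m.
Local Notation t := (cpow ((resq K)%:R : RR) (- s)).
Local Notation P x := (cpow (@dyadic_abs K RR x) s).

Lemma measurable_cpow_abs (g : C -> RR) :
  measurable_fun Rn ((fun x : 'rV[K]_n => g (P (f x))) : borelKn K n -> RR).
Proof.
apply: (measurable_off_zeros (Z := [set x | f x = 0]) (c := g (P 0))) => [x xR /eqP fx0|x ->//].
have [m hm] := cpow_abs_loc s (fR xR) fx0; exists m => y yx.
have yR : y \is a mxOver R.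
  rewrite -[y](subrK x) rpredD //; apply/mxOverP => i j.
  by apply: (@idl_ring K m); move/mxOverP: yx; apply.
by have [/eqP fy0 ->] := hm _ (fcong yR xR yx).
Qed.

Lemma perv_ztrunc J (g : C -> RR) : perv J (fun x => g (ztrunc t J (f x))).
Proof. by move=> x y xR yR xy; congr g; apply: ztrunc_per; rewrite ?fR ?fcong. Qed.

Lemma mean_Re M (F : 'rV[K]_n -> C) : complex.Re (mean M F) = mean M (fun x => complex.Re (F x)).
Proof.
rewrite /mean -natrX -(rmorph_nat (real_complex RR)) -fmorphV Re_mulC natrX; congr (_ * _).
exact: (big_morph _ (@ReD RR)).
Qed.

Lemma mean_Im M (F : 'rV[K]_n -> C) : complex.Im (mean M F) = mean M (fun x => complex.Im (F x)).
Proof.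
rewrite /mean -natrX -(rmorph_nat (real_complex RR)) -fmorphV Im_mulC natrX; congr (_ * _).
exact: (big_morph _ (@ImD RR)).
Qed.

(** Real and imaginary parts are separate real integrals, each estimated on its own; hence the
    factor 2. *)
Lemma zeta_near_mean J :
  `|zeta mu f s - mean J (fun x => ztrunc t J (f x))| <=
  (1 + `|iota_q K t|) *+ 2 * `|t| ^+ J.
Proof.
set e := (1 + `|iota_q K t|) * `|t| ^+ J.
have hP (x : 'rV[K]_n) : Rn x -> `|P (f x) - ztrunc t J (f x)| <= e.
  by move=> xR; apply: cpow_abs_ztrunc => //; exact: fR.
have hb (x : 'rV[K]_n) : Rn x -> `|P (f x)| <= 1.
  by move=> xR; apply: norm_cpow_abs => //; exact: fR.
apply: le_trans (norm_le_ReIm _) _.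
have eE : (complex.Re e)%:C%C = e.
  by rewrite RRe_real // realM ?ger0_real ?addr_ge0 ?exprn_ge0.
rewrite mulrnAl -/e mulr2n -[in leRHS]eE; apply: lerD; rewrite lecR.
- rewrite raddfB /= mean_Re; apply: (Rintegral_near_mean (b := 1)).
  + exact: measurable_cpow_abs.
  + by move=> x /hb /le_norm_Re.
  + exact: perv_ztrunc.
  + by move=> x /hP /le_norm_Re; rewrite raddfB.
- rewrite raddfB /= mean_Im; apply: (Rintegral_near_mean (b := 1)).
  + exact: measurable_cpow_abs.
  + by move=> x /hb /le_norm_Im.
  + exact: perv_ztrunc.
  + by move=> x /hP /le_norm_Im; rewrite raddfB.
Qed.

End ZetaEstimate.

(** * The linear term *)

Section LinearPart.
Variables (K : dyadicField) (C : numFieldType) (M : nat).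
Local Notation R := (@valring K).
Variables (Q : nat -> qform K) (w l : nat) (L : 'rV[K]_l).
Hypothesis uQ : forall i, unimodular (Q i).
Hypothesis LR : L \is a mxOver R.

Lemma symint_total : symint (qftotal Q w).
Proof.
apply: big_ind => [||i _]; [exact: unimod_symint (unimod0 K)|exact: symint_add|].
by apply: symint_scale; [exact: valringX (ring_two K)|exact: unimod_symint].
Qed.

Lemma linear_idl m (y : 'rV[K]_l) : y \is a mxOver (idl K m) -> (y *m L^T) 0 0 \in idl K m.
Proof.
move=> /mxOverP hy; rewrite mxE rpred_sum // => i _; apply: idlMr => //.
by rewrite mxE; move/mxOverP: LR; apply.
Qed.

Lemma quad_poly_ring x : x \is a mxOver R -> @quad_poly K Q w l L x \in R.
Proof.
move=> /mxOverP xR; apply: valringD; last first.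
  by rewrite -idl0; apply: linear_idl; apply/mxOverP => i j; rewrite mxE.
by apply: qeval_ring; [case: symint_total|apply/mxOverP => i j; rewrite mxE].
Qed.

Lemma quad_poly_cong m x y : x \is a mxOver R -> y \is a mxOver R ->
  x - y \is a mxOver (idl K m) -> @quad_poly K Q w l L x - quad_poly L y \in idl K m.
Proof.
move=> /mxOverP xR /mxOverP yR /mxOverP xy; rewrite /quad_poly opprD addrACA rpredD //.
  apply: qeval_cong; [exact: symint_total| | |]; apply/mxOverP => i j; rewrite ?mxE //.
  by have := xy i (lshift l j); rewrite !mxE.
have -> : (rsubmx x *m L^T) 0 0 - (rsubmx y *m L^T) 0 0 = ((rsubmx x - rsubmx y) *m L^T) 0 0.
  by rewrite mulmxBl [RHS]mxE; congr (_ + _); rewrite [RHS]mxE.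
apply: linear_idl; apply/mxOverP => i j; by have := xy i (rshift _ j); rewrite !mxE.
Qed.

Lemma mean_quad_poly G : mean M (fun x => G (@quad_poly K Q w l L x)) =
  dist M (qftotal Q w) (fun c => mean M (fun y : 'rV[K]_l => G (c + (y *m L^T) 0 0)) : C) 0.
Proof.
rewrite mean_cat; apply: mean_ext => x _; apply: mean_ext => y _.
by rewrite /quad_poly row_mxKl row_mxKr add0r.
Qed.

Lemma mean_quad_poly0 G : L = 0 ->
  mean M (fun x => G (@quad_poly K Q w l L x)) = dist M (qftotal Q w) G 0 :> C.
Proof.
move=> L0; rewrite mean_quad_poly; apply: mean_ext => x _.
rewrite -[RHS](mean_cst K M l); apply: mean_ext => y _.
by rewrite L0 trmx0 mulmx0 mxE addr0.
Qed.

(** The linear form is 2^lambda times a unit times one coordinate, hence uniform on 2^lambda R, and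
    integrating it out is [unif]. *)
Lemma mean_quad_poly_linear (G : K -> C) (j : 'I_l) lambda : per M G ->
  (forall i, i != j -> L 0 i = 0) -> L 0 j != 0 -> vK (L 0 j) = lambda%:Z ->
  mean M (fun x => G (@quad_poly K Q w l L x)) = dist M (qftotal Q w) (unif M lambda G) 0.
Proof.
move=> pG Lj Lj0 vL; rewrite mean_quad_poly.
have [m [u [uu LE]]] : exists m u, valunit u /\ L 0 j = 2 ^+ m * u.
  by apply: dyadic_unit_factor => //; move/mxOverP: LR; apply.
have mE : m = lambda.
  move: vL; rewrite LE (dv_M (dfieldP K)) ?expf_neq0 ?two_neq0 ?(unit_neq0 uu) //.
  rewrite (val2X (dfieldP K)); move/andP: uu => [_ /eqP ->].
  by rewrite [LHS](addr0 m%:Z) => -[].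
rewrite mE in LE; apply: dist_ext; [by case: symint_total|exact: valring0|].
move=> c cR.
have lE (y : 'rV[K]_l) : (y *m L^T) 0 0 = L 0 j * y 0 j.
  rewrite mxE (bigD1 j) //= mxE big1 ?addr0 1?mulrC // => i ij.
  by rewrite mxE Lj // mulr0.
have LjR : L 0 j \in R by move/mxOverP: LR; apply.
have pv : perv M (fun y : 'rV[K]_l => G (c + (y *m L^T) 0 0)).
  move=> x y /mxOverP xR /mxOverP yR /mxOverP xy; rewrite !lE.
  apply: pG; [by inR; exact: xR|by inR; exact: yR|].
  rewrite opprD addrACA subrr add0r -mulrBr idlMl //.
  by have := xy 0 j; rewrite !mxE.
rewrite (@mean_avg1 K C M l (fun z => z *: delta_mx 0 j)) //; last first.
  by move=> y yR; apply/mxOverP => i k; rewrite !mxE; inR; rewrite rpred_nat.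
rewrite -[RHS](mean_cst K M l); apply: mean_ext => y /mxOverP yR.
rewrite (mean1_ext M (G' := fun z => G (c + 2 ^+ lambda * (u * y 0 j + u * z)))) => [|z zR]; last first.
  by congr G; rewrite lE !mxE !eqxx /= LE mulr1; ring.
rewrite (@mean1_unit K C M u (u * y 0 j) (fun z => G (c + 2 ^+ lambda * z))) //.
  by apply: valringM; [exact: unit_ring|exact: yR].
move=> x z xR zR xz; apply: pG; rewrite ?valringD ?valringM ?valringX ?ring_two //.
by rewrite opprD addrACA subrr add0r -mulrBr idlMl // valringX // ring_two.
Qed.

End LinearPart.

Section Bounds.
Variables (K : dyadicField) (C : numFieldType) (M : nat) (t : C).
Local Notation R := (@valring K).
Hypothesis t1 : `|t| <= 1.

Lemma norm_mean n (F : 'rV[K]_n -> C) b : (forall x, x \is a mxOver R -> `|F x| <= b) ->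
  `|mean M F| <= b.
Proof.
move=> Fb; rewrite -[b](mean_cst K M n) /mean normrM normfV normrX normr_nat.
rewrite ler_wpM2l ?invr_ge0 ?exprn_ge0 //; apply: le_trans (ler_norm_sum _ _ _) _.
by apply: ler_sum => x _; apply/Fb/map_expansion_ring.
Qed.

Lemma norm_ztrunc j (c : K) : `|ztrunc t j c| <= 1 + `|iota_q K t|.
Proof.
elim: j c => [|j IH] c /=; first by rewrite lerDr.
case: ifP => _; last by rewrite normr1 lerDl.
by rewrite normrM -[leRHS]mul1r ler_pM.
Qed.

Lemma norm_pairsum (A B : qform K) j : `|pairsum M t A B j| <= 1 + `|iota_q K t|.
Proof. by apply: norm_mean => x _; apply: norm_mean => y _; exact: norm_ztrunc. Qed.

Hypothesis tq : 1 - t / (resq K)%:R != 0.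

(** Two steps of [pairsum_step] form an affine map of slope a b with fixed point [z]. The iteration
    bottoms out at level 2 because each step needs level at least 3. *)
Lemma pairsum_iter (A B : qform K) z k : (2 < M)%N -> unimodular A -> unimodular B ->
  let a := ((resq K)%:R ^+ rk A)^-1 * t in let b := ((resq K)%:R ^+ rk B)^-1 * t in
  z = Iq t A B (qf0 K) + a * (Iq t B A (qf0 K) + b * z) -> (k.*2.+2 <= M)%N ->
  pairsum M t A B k.*2.+2 - z = (a * b) ^+ k * (pairsum M t A B 2 - z).
Proof.
move=> M2 uA uB a b zE; elim: k => [|k IH] kM; first by rewrite mul1r.
have kM' : (k.*2.+2 <= M)%N by apply: leq_trans kM; rewrite doubleS !ltnS ltnW.
rewrite doubleS pairsum_step // pairsum_step //; last by apply: leq_trans kM; rewrite doubleS !ltnS ltnW.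
rewrite exprS -mulrA -(IH kM') {1}zE /a /b; ring.
Qed.

End Bounds.

(** * Passage to the zeta function *)

Section Assembly.
Variables (RR : realType) (K : dyadicField) (Q : nat -> qform K) (w l : nat) (L : 'rV[K]_l).
Variable mu : {measure set (borelKn K (rk (qftotal Q w) + l)) -> \bar RR}.
Variable s : RR[i].
Hypothesis uQ : forall i, unimodular (Q i).
Hypothesis w0 : (0 < w)%N.
Hypothesis Qw : forall i, (w < i)%N -> Q i = qf0 K.
Hypothesis LR : L \is a mxOver (valring (K := K)).
Hypothesis Hmu : haar mu.
Hypothesis s0 : 0 < complex.Re s.
Local Notation C := RR[i].
Local Notation q := ((resq K)%:R : C).
Local Notation t := (cpow ((resq K)%:R : RR) (- s)).
Local Notation Z := (zeta mu (@quad_poly K Q w l L) s).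
Local Notation smean J := (mean J (fun x => ztrunc t J (@quad_poly K Q w l L x))).
Local Notation wt i := (weight t Q i).

Let tq : 1 - t / q != 0 := tq_neq0 K s0.
Let t1 : `|t| <= 1 := ltW (norm_t_lt1 K s0).

Lemma zeta_limit X d : (forall k, exists2 J, (k <= J)%N & `|smean J - X| <= d * `|t| ^+ k) ->
  Z = X.
Proof.
move=> h; apply/eqP; rewrite -subr_eq0; apply/eqP.
apply: (norm_geometric_eq0 (c := (1 + `|iota_q K t|) *+ 2 + d) (norm_t_lt1 K s0)) => k.
have [J kJ hJ] := h k; rewrite -(subrKA (smean J)) mulrDl.
apply: le_trans (ler_normD _ _) (lerD _ hJ).
have hz := zeta_near_mean Hmu s0 (quad_poly_ring uQ LR) (quad_poly_cong uQ LR) J.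
apply: (le_trans hz).
by rewrite ler_wpM2l ?mulrn_wge0 ?addr_ge0 // ler_wiXn2l.
Qed.

Lemma zeta_stable X J0 : (forall J, (J0 <= J)%N -> (2 < J)%N -> smean J = X) -> Z = X.
Proof.
move=> h; apply: (@zeta_limit X 0) => k; exists (k + (J0 + 3))%N; first exact: leq_addr.
by rewrite h ?subrr ?normr0 ?mul0r //; lia.
Qed.

(** Integrating the linear term lowers the level from J to lambda, so the truncated mean equals [X]
    exactly for all large J. *)
Lemma zeta_linear (j : 'I_l) lambda X : (forall i i', L 0 i != 0 -> L 0 i' != 0 -> i = i') ->
  L 0 j != 0 -> vK (L 0 j) = lambda%:Z ->
  (forall J, (lambda <= J)%N -> (2 < J)%N ->
     exists n, state J Q 0 (w.-1 + n) (ztrunc t lambda) = X) -> Z = X.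
Proof.
move=> L1 Lj vL h; apply: (@zeta_stable _ lambda) => J lJ J2; have [n <-] := h J lJ J2.
have pJ : per J (ztrunc (K := K) t J) := @ztrunc_per K C t J.
rewrite (mean_quad_poly_linear _ uQ LR pJ _ Lj vL); last first.
  by move=> i ij; apply/eqP; apply: contraNT ij => Li; apply/eqP; exact: L1.
rewrite -(dist_qftotal J n _ w0 Qw).
apply: dist_ext; [by case: (symint_total w uQ)|exact: valring0|].
by move=> x xR; rewrite unif_ztrunc // lJ leqnn.
Qed.

Lemma zeta_quadratic : L = 0 -> let r := (\sum_(0 <= i < w.+1) rk (Q i))%N in
  Z = \sum_(0 <= i < w.-1) wt i * Iq t (Qpar Q i) (Qpar Q i.+1) (Q i.+2)
    + (wt w.-1 * Iq t (Qpar Q w.-1) (Qpar Q w) (qf0 K)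
       + wt w * Iq t (Qpar Q w) (Qpar Q w.-1) (qf0 K)) * (1 - t ^+ 2 / q ^+ r)^-1.
Proof.
move=> L0 r; set A := Qpar Q w.-1; set B := Qpar Q w.
set a := (q ^+ rk A)^-1 * t; set b := (q ^+ rk B)^-1 * t.
have abE : a * b = t ^+ 2 / q ^+ r.
  by rewrite /a /b /r -rk_par_pair // exprD invfM; ring.
have qn1 m : `|(q ^+ m)^-1| <= 1.
  rewrite normfV normrX normr_nat invf_le1 ?exprn_gt0 ?exprn_ege1 ?ler1n ?ltr0n //;
  by have := resq_gt1 K; lia.
have ab_le : `|a * b| <= `|t| ^+ 2.
  rewrite /a /b mulrACA [t * t]mulrC normrM -expr2 normrX mulrC ler_piMr ?exprn_ge0 //.
  by rewrite normrM -[leRHS]mulr1 ler_pM.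
have ab1 : 1 - a * b != 0.
  rewrite subr_eq0; apply/eqP => e; move: ab_le; rewrite -e normr1.
  by move=> /le_lt_trans h; have := h 1; rewrite exprn_ilt1 ?norm_t_lt1 // ltxx => /(_ isT).
set z := (Iq t A B (qf0 K) + a * Iq t B A (qf0 K)) / (1 - a * b).
have zE : z = Iq t A B (qf0 K) + a * (Iq t B A (qf0 K) + b * z).
  by rewrite /z; field.
have -> : (wt w.-1 * Iq t A B (qf0 K) + wt w * Iq t B A (qf0 K)) * (1 - t ^+ 2 / q ^+ r)^-1 =
   wt w.-1 * z.
  rewrite -abE -[in wt w](prednK w0) weightS -/A /z /a; ring.
apply: (@zeta_limit _ (`|wt w.-1| * (1 + `|iota_q K t| + `|z|))) => k.
(* The initial unrolling uses w - 1 levels, the alternation 2 (k + 1), and 2 remain at the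
   bottom. *)
pose J := (w.-1 + k.+1.*2.+2)%N; exists J; first by rewrite /J; lia.
have J2 : (2 < J)%N by rewrite /J; lia.
have uA := unimod_par uQ w.-1; have uB := unimod_par uQ w.
rewrite mean_quad_poly0 // (dist_qftotal J 0 _ w0 Qw) state_unroll // state_pairsum //.
rewrite opprD addrACA subrr add0r -mulrBr normrM.
rewrite (pairsum_iter tq J2 uA uB zE); last by rewrite /J; lia.
rewrite -[leRHS]mulrA; apply: ler_wpM2l => //; rewrite normrM mulrC; apply: ler_pM => //.
  by apply: le_trans (ler_normB _ _) _; rewrite lerD2r norm_pairsum.
rewrite normrX; apply: le_trans (lerXn2r _ _ _ ab_le) _; rewrite ?nnegrE ?exprn_ge0 //.
by rewrite -exprM ler_wiXn2l //; lia.
Qed.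

End Assembly.

Theorem theorem2p3 (R : realType) (K : dyadicField)
    (Q : nat -> qform K) (omega : nat) (l : nat) (L : 'rV[K]_l)
    (mu : {measure set (borelKn K (rk (qftotal Q omega) + l)) -> \bar R})
    (s : R[i]) :
  (forall i, unimodular (Q i)) ->
  (0 < omega)%N ->
  (forall i, (omega < i)%N -> Q i = qf0 K) ->
  L \is a mxOver (valring (K := K)) ->
  (forall i j, L 0 i != 0 -> L 0 j != 0 -> i = j) ->
  haar mu ->
  0 < complex.Re s ->
  let q : R[i] := (resq K)%:R in
  let t : R[i] := cpow (resq K)%:R (- s) in
  let I := Iq t in
  let Z := zeta mu (@quad_poly K Q omega l L) s in
  let r := (\sum_(0 <= i < omega.+1) rk (Q i))%N in
  let term i Q0 Q1 Q2 := t ^+ i / (qpar Q i)%:R * I Q0 Q1 Q2 in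
  [/\ L = 0 ->
      Z = \sum_(0 <= i < omega.-1)
            term i (Qpar Q i) (Qpar Q i.+1) (Q i.+2)
          + (term omega.-1 (Qpar Q omega.-1) (Qpar Q omega) (qf0 K)
             + term omega (Qpar Q omega) (Qpar Q omega.-1) (qf0 K))
            * (1 - t ^+ 2 / q ^+ r)^-1,
      forall (j : 'I_l) (lambda : nat),
        L 0 j != 0 -> vK (L 0 j) = lambda%:Z -> (2 <= lambda)%N ->
      Z = \sum_(0 <= i < lambda - 2)
            term i (Qpar Q i) (Qpar Q i.+1) (Q i.+2)
          + term (lambda - 2)%N (Qpar Q (lambda - 2)%N) (Qpar Q (lambda - 1)%N)
              (qf1 (1 : K))
          + term (lambda - 1)%N (Qpar Q (lambda - 1)%N)
              (qf1 (1 : K)) (qf1 (1 : K))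
          + t ^+ lambda / (qpar Q lambda)%:R * ((1 - 1 / q) / (1 - t / q)),
      forall j : 'I_l, L 0 j != 0 -> vK (L 0 j) = 1 ->
      Z = I (Qpar Q 0) (qf1 (1 : K)) (qf1 (1 : K))
          + t / q ^+ rk (Q 0%N) * ((1 - 1 / q) / (1 - t / q))
    & forall j : 'I_l, L 0 j != 0 -> vK (L 0 j) = 0 ->
      Z = (1 - 1 / q) / (1 - t / q)].
Proof.
move=> uQ w0 Qw LR L1 Hmu s0 q t I Z r term.
have tq : 1 - t / q != 0 := tq_neq0 K s0.
have -> : (1 - 1 / q) / (1 - t / q) = iota_q K t by rewrite /iota_q div1r.
have ZL := zeta_linear uQ w0 Qw LR Hmu s0 L1.
split.
- by move=> L0; rewrite /Z (zeta_quadratic uQ w0 Qw LR Hmu s0 L0).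
- move=> j [|[|m]] // Lj vL _; rewrite !subSS !subn0.
  (* The padding keeps the tail nonempty after [m] unrolling steps, even when lambda exceeds omega;
     levels 2 and 1 are then closed by [state_zt2] and [state_zt1]. *)
  apply: (ZL j m.+2) => // J mJ J2; exists m.+1.
  rewrite (_ : (omega.-1 + m.+1)%N = (m + omega.-1.+1)%N); last by rewrite addnS addnC addnS.
  have := state_unroll J2 tq uQ (m := m) omega.-1.+1 (j := 0); rewrite addn2 => -> //.
  rewrite state_zt2 // state_zt1 // mulrDr -!addrA; congr (_ + (_ + _)).
  by rewrite /term /I -/(weight t Q m.+1) -/(weight t Q m.+2) !weightS; ring.
- move=> j Lj vL; rewrite [X in Z = X + _]/I.
  apply: (ZL j 1%N) => // J mJ J2; exists 0%N; rewrite state_zt1 //.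
  have -> : rk (Qpar Q 0) = rk (Q 0%N) by rewrite rk_par big_mkcond big_nat1.
  by congr (_ + _); rewrite /t /q; ring.
- by move=> j Lj vL; apply: (ZL j 0%N) => // J _ J2; exists 0%N; rewrite state_zt0.
Qed.
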